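(* Let $\mathfrak a>0$, $\mathfrak h,p\ge 1$, put $\mathfrak p=\lceil \mathfrak h/\mathfrak a\rceil$, $q=p\,2^{\mathfrak p+4}$, and let $J_m^+\in\mathbb N$. Let $\mathcal D,\widehat{\mathcal D}$ be as in the context, and assume that for a universal constant $C$ and a universal sequence $s_m=o(1)$, as $m\to\infty$: (1) $m^{1/2}\max_{i,j\in\mathbb N}\|\overline{\eta}^{\mathcal D}_{i,j}(m)\|_q\le C$ and $m^{1/2}\max_{i,j\in\mathbb N}\|\eta^{\mathcal R}_{i,j}(m)\|_q\le s_m$; (2) $\max_{1\le j\le J_m^+}\Big\{m^{-1/2+\mathfrak a}\sum_{i\ne j}\frac{\lambda_i}{|\lambda_j-\lambda_i|},\ m^{-1+2\mathfrak a}\sum_{i\neq j}\frac{\lambda_i\lambda_j}{(\lambda_j-\lambda_i)^2}\Big\}\le C$ and $\lambda_{J_m^+}\ge m^{-\mathfrak h}/C$; (3) $1/C\le \mathbb E[\eta^{\mathcal D}_{j,j}(m)]\le C$ for all $j\in\mathbb N$, and $\sum_{j\ge1}\lambda_j\le C$. Put $\Lambda_j=\sum_{k\ne j}\frac{\lambda_j\lambda_k}{(\lambda_j-\lambda_k)^2}$. Then for $1\le J<J_m^+$, $$\bigg\|\max_{1\le j\le J}\bigg\|\frac1{\sqrt{\Lambda_j}}\Big(\widehat e_j-e_j+\frac{e_j}2\|\widehat e_j-e_j\|_{L^2}^2-\sum_{k\ne j}e_k\frac{I_{k,j}}{\lambda_j-\lambda_k}\Big)\bigg\|_{L^2}\bigg\|_p\lesssim\frac{J^{1/p}m^{-\mathfrak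 a}}{\sqrt m},$$ and $$\bigg\|\max_{1\le j\le J}\bigg|\frac1{\Lambda_j}\Big(\|\widehat e_j-e_j\|_{L^2}^2-\sum_{k\neq j}\frac{I_{k,j}^2}{(\lambda_j-\lambda_k)^2}\Big)\bigg|\bigg\|_p\lesssim\frac{J^{1/p}m^{-\mathfrak a}}{m}.$$
   Context: $\mathcal T\subset\mathbb R^d$ is compact, $L^2=L^2(\mathcal T)$ with inner product $\langle\cdot,\cdot\rangle$ and norm $\|\cdot\|_{L^2}$. For a real random variable $Y$, $\|Y\|_q=(\mathbb E|Y|^q)^{1/q}$ and $\overline Y=Y-\mathbb E Y$. $A\lesssim B$ means $A\le cB$ with a constant $c$ not depending on $m,j,J$. ''Universal'' means not depending on $m$ or on indices. Setup. $m$ runs through a sequence tending to infinity; all objects below may depend on $m$. The operator $\mathcal D:L^2\to L^2$ has non-negative eigenvalues $\lambda_1\ge\lambda_2\ge\dots$ and an orthonormal basis of eigenfunctions $(e_j)_{j\in\mathbb N}$, with $\mathcal D(\cdot)=\sum_j\lambda_j\langle e_j,\cdot\rangle e_j$, $\sum_j\lambda_j<\infty$. For non-negative numbers $\widetilde\lambda_j$ with $\sum_j\widetilde\lambda_j<\infty$ and real random variables $\eta^{\mathcal D}_{i,j}=\eta^{\mathcal D}_{i,j}(m)$, $\eta^{\mathcal R}_{i,j}=\eta^{\mathcal R}_{i,j}(m)$, $i,j\in\mathbb N$, put $$\widehat{\mathcal D}(\cdot)=\sum_{i,j\ge1}\sqrt{\widetilde\lambda_i\widetilde\lambda_j}\,(\eta^{\mathcal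 D}_{i,j}-\eta^{\mathcal R}_{i,j})\langle e_i,\cdot\rangle e_j,$$ where it is required that $\mathcal D(\cdot)=\sum_{i,j\ge1}\sqrt{\widetilde\lambda_i\widetilde\lambda_j}\,\mathbb E[\eta^{\mathcal D}_{i,j}]\langle e_i,\cdot\rangle e_j$. The operator $\widehat{\mathcal D}$ is self-adjoint, with $\widehat{\mathcal D}(\widehat e_j)=\widehat\lambda_j\widehat e_j$, where $\widehat\lambda_j$ is the $j$-th largest eigenvalue and the $\widehat e_j$ are orthonormal, with signs chosen so that $\langle\widehat e_j,e_j\rangle\ge0$. Finally $I_{i,j}=\langle(\widehat{\mathcal D}-\mathcal D)(e_i),e_j\rangle$. *)

(* Defs.v *)
From HB Require Import structures.
From mathcomp Require Import all_boot all_order all_algebra.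
From mathcomp Require Import lra.
From mathcomp Require Import all_classical all_reals all_analysis.
Set Implicit Arguments.
Unset Strict Implicit.
Unset Printing Implicit Defensive.
Import Order.TTheory GRing.Theory Num.Theory.
Import numFieldNormedType.Exports.
Local Open Scope classical_set_scope.
Local Open Scope ring_scope.

(* The sigma-algebra on R^n generated by the coordinates, which is the Borel
   one. *)
Definition rV_display : measure_display.
Proof. exact: default_measure_display. Qed.

Section measurable_rV.
Context {R : realType} (n : nat).

Let coor : 'I_n -> 'rV[R]_n -> measurableTypeR R := fun i v => v ord0 i.

Let rV_set0 : g_sigma_preimage coor set0.
Proof. exact: sigma_algebra0. Qed.

Let rV_setC A : g_sigma_preimage coor A -> g_sigma_preimage coor (~` A).
Proof. exact: sigma_algebraC. Qed.

Let rV_bigcup (F : _^nat) : (forall i, g_sigma_preimage coor (F i)) ->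
  g_sigma_preimage coor (\bigcup_i (F i)).
Proof. exact: sigma_algebra_bigcup. Qed.

HB.instance Definition _ := @isMeasurable.Build rV_display
  'rV[R]_n (g_sigma_preimage coor) rV_set0 rV_setC rV_bigcup.

Lemma measurable_coor (i : 'I_n) :
  measurable_fun [set: 'rV[R]_n]
    (fun v : 'rV[R]_n => v ord0 i : measurableTypeR R).
Proof.
move=> _ Y mY; rewrite setTI; apply: sub_sigma_algebra => /=.
rewrite -bigcup_seq/=; exists i => /=; first by rewrite mem_index_enum.
by exists Y => //; rewrite setTI.
Qed.

Lemma measurable_fun_rV d1 (T1 : measurableType d1) (f : T1 -> 'rV[R]_n) :
  (forall i,
    measurable_fun [set: T1] (fun x => f x ord0 i : measurableTypeR R)) ->
  measurable_fun [set: T1] f.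
Proof.
move=> mf _ Y mY.
pose S := image_set_system setT f measurable.
suff : S Y by [].
move: Y mY; apply: smallest_sub.
  exact/sigma_algebra_image/sigma_algebra_measurable.
move=> A; rewrite -bigcup_seq => -[i _ [B mB <-]].
rewrite /S /image_set_system/= !setTI.
by have := mf i measurableT B mB; rewrite setTI.
Qed.

Lemma measurable_mx_ball (x : 'rV[R]_n) e : measurable (ball x e).
Proof.
have [e0|e0] := ltP 0 e; last first.
  by rewrite (_ : ball x e = set0)//;
    apply/seteqP; split => // y []; rewrite ltNge e0.
rewrite (_ : ball x e = \big[setI/setT]_(i < n)
  ([set: 'rV[R]_n] `&`
   (fun v : 'rV[R]_n => v ord0 i) @^-1` (ball (x ord0 i) e))).
  apply: bigsetI_measurable => i _; apply: measurable_coor => //.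
  by rewrite ball_itv; exact: measurable_itv.
rewrite -bigcap_seq; apply/seteqP; split => y /=.
  by move=> [_ yB] i _; split => //; exact: yB.
move=> yB; split => // i j; rewrite (ord1 i).
by have [|_] := yB j; first by rewrite /= mem_index_enum.
Qed.

Lemma open_measurable_rV (U : set 'rV[R]_n) : open U -> measurable U.
Proof.
move=> oU.
pose q (k : 'rV[rat]_n * nat) : set 'rV[R]_n :=
  let b := ball (map_mx (@ratr R) k.1) k.2.+1%:R^-1 in
  if `[< b `<=` U >] then b else set0.
suff -> : U = \bigcup_k q k.
  apply: countable_bigcupT_measurable => [|k]; first exact: countableP.
  by rewrite /q; case: ifP => _; [exact: measurable_mx_ball|exact: measurable0].
apply/seteqP; split => [x Ux|x [k _]]; last first.
  by rewrite /q; case: ifPn => [/asboolP bU /bU|].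
have := oU x Ux.
rewrite -nbhs_ballE => -[e /= e0 xeU].
have [N /= Ne] : exists N : nat, N.+1%:R^-1 < e / 2.
  have [N _ H] := near_infty_natSinv_lt (PosNum (divr_gt0 e0 (ltr0Sn R 1))).
  by exists N; apply: (H N) => /=.
have /choice [r Hr] : forall i : 'I_n, exists r : rat,
    ball (ratr r : R) N.+1%:R^-1 (x ord0 i).
  move=> i; set x0 := x ord0 i; set e1 := N.+1%:R^-1.
  have e10 : 0 < e1 :> R by rewrite invr_gt0.
  have lt12 : x0 - e1 < x0 + e1.
    by rewrite (lt_trans (y := x0))// ?ltrDl// ltrBlDr ltrDl.
  have [r] := rat_in_itvoo lt12.
  rewrite in_itv/= => /andP[h1 h2]; exists r; rewrite /ball/= ltr_norml.
  by apply/andP; split; move: h1 h2; lra.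
have xq : ball (map_mx (@ratr R) (\row_i r i)) N.+1%:R^-1 x.
  by split; rewrite ?invr_gt0// => i j; rewrite (ord1 i) !mxE; exact: Hr.
exists (\row_i r i, N) => //; rewrite /q/=; case: ifPn => // /asboolP; apply.
apply: subset_trans xeU => y qy.
apply: (@le_ball _ _ _ (N.+1%:R^-1 + N.+1%:R^-1)).
  by rewrite ltW// [ltRHS]splitr ltrD.
by apply: ball_triangle qy; apply: ball_sym.
Qed.

Lemma compact_measurable_rV (K : set 'rV[R]_n) : compact K -> measurable K.
Proof.
move=> cK; rewrite -(setCK K); apply: measurableC; apply: open_measurable_rV.
by rewrite openC; exact: compact_closed.
Qed.

End measurable_rV.

Section lebesgue_rV.
Context {R : realType}.

Definition rV_cons n (xv : measurableTypeR R * 'rV[R]_n) : 'rV[R]_n.+1 :=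
  \row_i oapp (fun j => xv.2 ord0 j) xv.1 (unlift ord0 i).

Lemma measurable_rV_cons n : measurable_fun setT (@rV_cons n).
Proof.
apply: measurable_fun_rV => i; rewrite /rV_cons.
case: (unliftP ord0 i) => [j ->|->].
  rewrite (_ : (fun _ => _) = (fun v : 'rV[R]_n => v ord0 j) \o snd).
    by apply: measurableT_comp => //; exact: measurable_coor.
  by apply/funext => x /=; rewrite mxE liftK.
rewrite (_ : (fun _ => _) = fst)//.
by apply/funext => x /=; rewrite mxE unlift_none.
Qed.

HB.instance Definition _ n :=
  isMeasurableFun.Build _ _ _ _ (@rV_cons n) (@measurable_rV_cons n).

Section lebesgue_rVS.
Variables (n : nat) (mu : {sigma_finite_measure set 'rV[R]_n -> \bar R}).

Definition lebesgue_rVS : set 'rV[R]_n.+1 -> \bar R :=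
  pushforward ((@lebesgue_measure R) \x mu)%E (@rV_cons n).

Let lebesgue_rVS0 : lebesgue_rVS set0 = 0%E.
Proof. by rewrite /lebesgue_rVS measure0. Qed.

Let lebesgue_rVS_ge0 A : (0 <= lebesgue_rVS A)%E.
Proof. exact: measure_ge0. Qed.

Let lebesgue_rVS_sigma_additive : semi_sigma_additive lebesgue_rVS.
Proof. exact: measure_semi_sigma_additive. Qed.

HB.instance Definition _ := isMeasure.Build _ _ _ lebesgue_rVS
  lebesgue_rVS0 lebesgue_rVS_ge0 lebesgue_rVS_sigma_additive.

Let lebesgue_rVS_sigma_finite : sigma_finite setT lebesgue_rVS.
Proof.
have /sigma_finiteP[F [FT Fnd Foo]] := sigma_finiteT (@lebesgue_measure R).
have /sigma_finiteP[G [GT Gnd Goo]] := sigma_finiteT mu.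
pose tl (v : 'rV[R]_n.+1) : 'rV[R]_n := \row_j v ord0 (lift ord0 j).
have mtl : measurable_fun setT tl.
  apply: measurable_fun_rV => j.
  rewrite (_ : (fun _ => _) = fun v : 'rV[R]_n.+1 => v ord0 (lift ord0 j)).
    exact: measurable_coor.
  by apply/funext => v; rewrite mxE.
exists (fun k =>
  (fun v : 'rV[R]_n.+1 => v ord0 ord0) @^-1` (F k) `&` tl @^-1` (G k)).
  apply/seteqP; split => // v _.
  have : setT (v ord0 ord0) by [].
  have : setT (tl v) by [].
  rewrite FT GT => -[k _ Gk] [l _ Fl]; exists (maxn k l) => //; split => /=.
    exact: (subsetPset _ _ (Fnd _ _ (leq_maxr k l))).
  exact: (subsetPset _ _ (Gnd _ _ (leq_maxl k l))).
move=> k; split.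
  apply: measurableI; rewrite -[X in measurable X]setTI.
    by apply: measurable_coor => //; exact: (Foo k).1.
  by apply: mtl => //; exact: (Goo k).1.
rewrite /lebesgue_rVS /pushforward (_ : _ @^-1` _ = F k `*` G k).
  rewrite product_measure1E; [|exact: (Foo k).1|exact: (Goo k).1].
  apply: lte_mul_pinfty => //; last exact: (Goo k).2.
  by rewrite ge0_fin_numE//; exact: (Foo k).2.
have tlK (xv : measurableTypeR R * 'rV[R]_n) : tl (rV_cons xv) = xv.2.
  by apply/rowP => j; rewrite !mxE liftK.
have hdK (xv : measurableTypeR R * 'rV[R]_n) : rV_cons xv ord0 ord0 = xv.1.
  by rewrite mxE unlift_none.
by apply/seteqP; split => xv /=; rewrite tlK hdK.
Qed.

HB.instance Definition _ :=
  @Measure_isSigmaFinite.Build _ _ _ lebesgue_rVS lebesgue_rVS_sigma_finite.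

End lebesgue_rVS.

Fixpoint lebesgue_rV n : {sigma_finite_measure set 'rV[R]_n -> \bar R} :=
  if n is n'.+1 then lebesgue_rVS (lebesgue_rV n') else \d_(0 : 'rV[R]_0).

End lebesgue_rV.

Definition lebesgue_on {R : realType} n (T : set 'rV[R]_n) (cT : compact T) :
    {measure set 'rV[R]_n -> \bar R} :=
  mrestr (lebesgue_rV n) (compact_measurable_rV cT).

Section L2.
Context d (X : measurableType d) (R : realType).
Variable mu : {measure set X -> \bar R}.

(* Elements of [L2] are square-integrable functions, not classes: equality in
   L^2 is [f = g %[ae mu]]. *)
Definition L2 := LfunType mu (lee1n 2 : (1 <= 2%:R%:E :> \bar R)%E).

Definition inner (f g : L2) : R := \int[mu]_x (f x * g x).

Definition norm2 (f : L2) : R := fine ('N[mu]_2%:E[EFin \o f]).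

Definition L2_cvg (u : nat -> L2) (f : L2) :=
  norm2 (u n - f) @[n --> \oo] --> 0.

(* A limit in L^2, unique up to [mu]-a.e. equality; 0 if there is none. *)
Definition L2_lim (u : nat -> L2) : L2 := xget 0 [set f | L2_cvg u f].

Definition orthonormal_system (e : nat -> L2) :=
  forall i j, inner (e i) (e j) = (i == j)%:R.

Definition orthonormal_basis (e : nat -> L2) :=
  orthonormal_system e /\
  forall f, L2_cvg (fun N => \sum_(j < N) inner (e j) f *: e j) f.

(* [l j] is the (j+1)-st largest eigenvalue of the self-adjoint operator [A],
   counted with multiplicity, and [f j] is a corresponding eigenfunction:
   [l j] dominates every eigenvalue with an eigenfunction orthogonal to
   [f 0, ..., f (j-1)]. *)
Definition ordered_eigensystem (A : L2 -> L2) (l : nat -> R) (f : nat -> L2) :=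
  [/\ orthonormal_system f,
      nonincreasing_seq l,
      forall j, A (f j) = l j *: f j %[ae mu] &
      forall j (c : R) (g : L2), norm2 g != 0 -> A g = c *: g %[ae mu] ->
        (forall k, (k < j)%N -> inner (f k) g = 0) -> c <= l j].

End L2.

(* [lam], [eigfun], [opD] are the lambda_j, e_j, D; [lamt] is lambda-tilde;
   [lamhat], [eigfunhat], [opDhat] are the estimated lambda_j, e_j, D. Indices
   start at 0, i.e. [lam j] is lambda_(j+1). The double series converge along
   square partial sums, strongly in L^2, and identities between realizations
   hold almost surely. *)
Record model d (X : measurableType d) (R : realType)
    (mu : {measure set X -> \bar R}) d' (Om : measurableType d')
    (P : probability Om R) := Model {
  lam : nat -> R ;
  eigfun : nat -> L2 mu ;
  opD : L2 mu -> L2 mu ;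
  lamt : nat -> R ;
  etaD : nat -> nat -> {RV P >-> R} ;
  etaR : nat -> nat -> {RV P >-> R} ;
  opDhat : Om -> L2 mu -> L2 mu ;
  lamhat : nat -> {RV P >-> R} ;
  eigfunhat : nat -> Om -> L2 mu ;
  lam_ge0 : forall j, 0 <= lam j ;
  lam_nonincreasing : nonincreasing_seq lam ;
  lam_summable : (\sum_(0 <= j <oo) (lam j)%:E < +oo)%E ;
  eigfun_basis : orthonormal_basis eigfun ;
  opDE : forall f,
    L2_cvg (fun N => \sum_(j < N) (lam j * inner (eigfun j) f) *: eigfun j)
      (opD f) ;
  lamt_ge0 : forall j, 0 <= lamt j ;
  lamt_summable : (\sum_(0 <= j <oo) (lamt j)%:E < +oo)%E ;
  opD_meanE : forall f,
    L2_cvg (fun N => \sum_(i < N) \sum_(j < N)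
        (Num.sqrt (lamt i * lamt j) * fine 'E_P[etaD i j] * inner (eigfun i) f)
          *: eigfun j)
      (opD f) ;
  opDhatE : {ae P, forall w, forall f,
    L2_cvg (fun N => \sum_(i < N) \sum_(j < N)
        (Num.sqrt (lamt i * lamt j) * (etaD i j w - etaR i j w)
           * inner (eigfun i) f) *: eigfun j)
      (opDhat w f)} ;
  opDhat_selfadjoint : {ae P, forall w, forall f g,
    inner (opDhat w f) g = inner f (opDhat w g)} ;
  eigfunhat_measurable : forall j f,
    measurable_fun setT (fun w => inner (eigfunhat j w) f : R) ;
  eigfunhatP : {ae P, forall w,
    ordered_eigensystem (opDhat w) (fun j => lamhat j w) (eigfunhat ^~ w)} ;
  eigfunhat_sign : {ae P, forall w, forall j,
    0 <= inner (eigfunhat j w) (eigfun j)}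
}.

Section quantities.
Context d (X : measurableType d) (R : realType)
  (mu : {measure set X -> \bar R}) d' (Om : measurableType d')
  (P : probability Om R) (M : model mu P).

Definition centered (Y : Om -> R) : Om -> R := fun w => Y w - fine 'E_P[Y].

(* Extended reals: x / 0 = +oo for x > 0, so that a finite sum forces the
   eigenvalue [lam M j], if positive, to be simple. *)
Definition gap_sum (j : nat) : \bar R :=
  (\sum_(0 <= i <oo | i != j) ((lam M i)%:E / `|lam M j - lam M i|%:E))%E.

Definition Lambda (j : nat) : \bar R :=
  (\sum_(0 <= k <oo | k != j)
     ((lam M j * lam M k)%:E / ((lam M j - lam M k) ^+ 2)%:E))%E.

(* The random coefficient I_{k,j} = <(Dhat - D) e_k, e_j>. *)
Definition pert (k j : nat) (w : Om) : R :=
  inner (opDhat M w (eigfun M k) - opD M (eigfun M k)) (eigfun M j).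

(* The sum over k <> j of I_{k,j} / (lam_j - lam_k) e_k. *)
Definition first_order (j : nat) (w : Om) : L2 mu :=
  L2_lim (fun N => \sum_(k < N | k != j :> nat)
    (pert k j w / (lam M j - lam M k)) *: eigfun M k).

Definition eigenfunction_error (j : nat) (w : Om) : R :=
  let diff := eigfunhat M j w - eigfun M j in
  norm2 ((Num.sqrt (fine (Lambda j)))^-1 *:
    (diff + (norm2 diff ^+ 2 / 2) *: eigfun M j - first_order j w)).

Definition norm_error (j : nat) (w : Om) : R :=
  `| (fine (Lambda j))^-1 *
     (norm2 (eigfunhat M j w - eigfun M j) ^+ 2 -
      fine (\sum_(0 <= k <oo | k != j)
              ((pert k j w) ^+ 2 / (lam M j - lam M k) ^+ 2)%:E)%E) |.

End quantities.

(* Main.v *)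
Require Import Defs.
From HB Require Import structures.
From mathcomp Require Import all_boot all_order all_algebra.
From mathcomp Require Import ring lra.
From mathcomp Require Import all_classical all_reals all_analysis measurable_realfun.
Set Implicit Arguments.
Unset Strict Implicit.
Unset Printing Implicit Defensive.
Import Order.TTheory GRing.Theory Num.Theory.
Import numFieldNormedType.Exports.
Local Open Scope classical_set_scope.
Local Open Scope ring_scope.

(** Why the expansions hold.

    Fix an index j.  Write x_k for the coordinates of the j-th estimated
    eigenfunction in the basis e, mu for its eigenvalue, I_(k,l) for the entries
    of the perturbation of the operator, and g_k = |lam_j - lam_k|.  Coordinate k
    of the eigenvalue equation reads
      (lam_j - lam_k) x_k
        = I_(k,j) x_j + sum_(l <> j) I_(k,l) x_l - (mu - lam_j) x_k,
    so x_k is the first-order term I_(k,j) / (lam_j - lam_k) up to three errors.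
    As a whole the perturbation may be large compared with g_k; but the entry
    I_(k,l) has size sqrt (lam_k lam_l / m) only, so after coordinate k is
    rescaled by sqrt g_k the perturbation becomes I_(k,l) / sqrt (g_k g_l), whose
    Hilbert-Schmidt norm is about m^(-1/2) sum_k lam_k / g_k, that is m^(-a).
    The index j itself has no gap; it gets as weight y a small multiple of
    lam_j m^(-1/2+a).  This y is below a quarter of every gap, and yet
    lam_j / y is of the order m^(1/2-a) assumed of sum_k lam_k / g_k.  Let G be the
    weights G_k = g_k off j, and G_j = y.  Two numbers control everything:
      om^2 = sum_(k,l) I_(k,l)^2 / (G_k G_l), of order m^(-2a),
      ph^2 = y sum_(k <> j, l) I_(k,l)^2 / (G_k^2 G_l), of order Lambda_j / m.
    If om <= 1/8, Cauchy-Schwarz on the three errors, absorbing the terms that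
    contain x again, bounds the remainder by 4 om ph ([expansion_remainder_le])
    and the error on the squared norm by 11 om ph^2 ([norm_expansion_le]).

    That argument presupposes that mu is within y of lam_j.  This is a relative
    Weyl inequality: om <= 1 means that the quadratic form of the perturbation
    is dominated by that of the weights G, so the form of the perturbed operator
    is at most lam_j + y on the closed span of e_j, e_(j+1), ... and at least
    lam_j - y on the span of e_0, ..., e_j.  Intersecting with the span, or with
    the orthogonal complement, of the first estimated eigenfunctions gives
    [weyl_upper] and [weyl_lower].  The second one must produce an eigenvector
    of the perturbed operator from a large value of its form: the form of a
    Hilbert-Schmidt matrix is continuous on the unit ball of l^2 for the product
    topology, in which the ball is compact by Tychonoff, and a maximiser is an
    eigenvector ([qform_eigenvector]).  It is turned back into a function by
    completeness of L^2 ([Riesz_Fischer]), which also makes the first-order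
    series converge.

    For the moments, om^2 and ph^2 are weighted sums of squared noise variables,
    and Minkowski's inequality with monotone convergence bounds their moments by
    the total weight ([weighted_square_moment]).  When om > 1/8 only crude
    bounds, of order 1 / Lambda_j <= C^2 m^h, are available; but then
    1 <= (8 om)^sig with sig = 2^(ceil (h / a) + 4), and the p-th moment of this
    power uses exactly the q = p sig moments assumed and is of order m^(-a sig),
    which beats m^h with room to spare.  The maximum over j < J is bounded by a
    sum of p-th powers, whence the factor J^(1/p). *)

(** * The Hilbert space of square-integrable functions *)

Lemma quadratic_discriminant (R : realFieldType) (a b c : R) : 0 <= c ->
  (forall t, 0 <= a + 2 * t * b + t ^+ 2 * c) -> b ^+ 2 <= a * c.
Proof.
move=> c0 H.
have [cc|cn0] := eqVneq c 0; last first.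
  have cp : 0 < c by rewrite lt_neqAle eq_sym cn0.
  have := H (- b / c); rewrite -(pmulr_lge0 _ cp).
  have -> : (a + 2 * (- b / c) * b + (- b / c) ^+ 2 * c) * c = a * c - b ^+ 2.
    by field.
  by rewrite subr_ge0.
rewrite cc mulr0.
have [->|b0] := eqVneq b 0; first by rewrite expr0n.
have := H (- (a + 1) / (2 * b)); rewrite cc mulr0 addr0.
have -> : 2 * (- (a + 1) / (2 * b)) * b = - (a + 1) by field.
by move=> ?; exfalso; lra.
Qed.

Lemma sum_CS (R : realFieldType) I (s : seq I) (P : pred I) (a b : I -> R) :
  (\sum_(i <- s | P i) a i * b i) ^+ 2 <=
  (\sum_(i <- s | P i) a i ^+ 2) * (\sum_(i <- s | P i) b i ^+ 2).
Proof.
apply: quadratic_discriminant => [|t].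
  by apply: sumr_ge0 => i _; exact: sqr_ge0.
rewrite !mulr_sumr -!big_split/=; apply: sumr_ge0 => i _.
have -> : a i ^+ 2 + 2 * t * (a i * b i) + t ^+ 2 * b i ^+ 2 = (a i + t * b i) ^+ 2.
  by ring.
exact: sqr_ge0.
Qed.

Section L2_geometry.
Context d (X : measurableType d) (R : realType).
Variable mu : {measure set X -> \bar R}.
Implicit Types (f g h : L2 mu) (e : nat -> L2 mu).

Lemma L2_mul_integrable f g :
  mu.-integrable setT (EFin \o (fun x => f x * g x)).
Proof. by apply/Lfun1_integrable; apply: Lfun2_mul_Lfun1; exact: LfunP. Qed.

Lemma innerC f g : inner f g = inner g f.
Proof. by rewrite /inner; apply: eq_Rintegral => x _; rewrite mulrC. Qed.

Lemma innerDl f g h : inner (f + g) h = inner f h + inner g h.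
Proof.
rewrite /inner -RintegralD//; [|exact: L2_mul_integrable..].
by apply: eq_Rintegral => x _; rewrite -mulrDl.
Qed.

Lemma innerZl (c : R) f g : inner (c *: f) g = c * inner f g.
Proof.
rewrite /inner -RintegralZl//; last exact: L2_mul_integrable.
by apply: eq_Rintegral => x _; rewrite mulrA.
Qed.

Lemma innerDr f g h : inner h (f + g) = inner h f + inner h g.
Proof. by rewrite innerC innerDl !(innerC h). Qed.

Lemma innerZr (c : R) f g : inner g (c *: f) = c * inner g f.
Proof. by rewrite innerC innerZl innerC. Qed.

Lemma inner0l f : inner 0 f = 0.
Proof. by have := innerZl 0 0 f; rewrite scale0r mul0r. Qed.

Lemma innerNl f g : inner (- f) g = - inner f g.
Proof. by rewrite -scaleN1r innerZl mulN1r. Qed.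

Lemma innerBl f g h : inner (f - g) h = inner f h - inner g h.
Proof. by rewrite innerDl innerNl. Qed.

Lemma innerBr f g h : inner h (f - g) = inner h f - inner h g.
Proof. by rewrite innerC innerBl !(innerC h). Qed.

Lemma inner_suml I (s : seq I) (p : pred I) (F : I -> L2 mu) g :
  inner (\sum_(i <- s | p i) F i) g = \sum_(i <- s | p i) inner (F i) g.
Proof.
elim/big_rec2: _ => [|i _ x _ <-]; first exact: inner0l.
by rewrite innerDl.
Qed.

Lemma inner_sumr I (s : seq I) (p : pred I) (F : I -> L2 mu) g :
  inner g (\sum_(i <- s | p i) F i) = \sum_(i <- s | p i) inner g (F i).
Proof. by rewrite innerC inner_suml; apply: eq_bigr => i _; exact: innerC. Qed.

Lemma norm2_ge0 f : 0 <= norm2 f.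
Proof. by rewrite /norm2 fine_ge0// Lnorm_ge0. Qed.

Lemma norm2_sqrE f : ((norm2 f ^+ 2)%:E = \int[mu]_x ((f x) ^+ 2)%:E)%E.
Proof.
rewrite -powR_mulrn ?norm2_ge0// -poweR_EFin /norm2 finite_norm_fine.
rewrite powR_Lnorm//; apply: eq_integral => x _.
by rewrite abse_EFin poweR_EFin powR_mulrn ?normr_ge0// real_normK ?num_real.
Qed.

Lemma inner_norm2 f : inner f f = norm2 f ^+ 2.
Proof. by rewrite -[RHS]/(fine (norm2 f ^+ 2)%:E) norm2_sqrE. Qed.

Lemma inner_ge0 f : 0 <= inner f f.
Proof. by rewrite inner_norm2 sqr_ge0. Qed.

Lemma norm2Z (c : R) f : norm2 (c *: f) = `|c| * norm2 f.
Proof.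
apply/eqP; rewrite -(eqrXn2 (n := 2)) ?mulr_ge0 ?norm2_ge0//; apply/eqP.
by rewrite exprMn real_normK ?num_real// -!inner_norm2 innerZl innerZr mulrA.
Qed.

Lemma inner_CS f g : `|inner f g| <= norm2 f * norm2 g.
Proof.
rewrite -ler_sqr ?nnegrE ?mulr_ge0 ?norm2_ge0//.
rewrite real_normK ?num_real// exprMn -!inner_norm2.
apply: quadratic_discriminant (inner_ge0 g) _ => t.
have := inner_ge0 (f + t *: g).
rewrite !innerDl !innerDr !innerZl !innerZr (innerC g f).
by congr (_ <= _); ring.
Qed.

Lemma L2_cvg_inner (u : nat -> L2 mu) f :
  L2_cvg u f -> forall g, inner (u n) g @[n --> \oo] --> inner f g.
Proof.
move=> uf g; apply/subr_cvg0; apply/norm_cvg0P.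
have ufg : norm2 (u n - f) * norm2 g @[n --> \oo] --> 0.
  by rewrite -(mul0r (norm2 g)); apply: cvgMl.
apply: (squeeze_cvgr _ (cvg_cst 0) ufg); apply/nearW => n.
by rewrite normr_ge0 -innerBl inner_CS.
Qed.

End L2_geometry.
Arguments L2_cvg_inner {d X R mu u f} _ g.

Section L2_complete.
Context d (X : measurableType d) (R : realType).
Variable mu : {measure set X -> \bar R}.
Implicit Types (f g h : L2 mu) (e : nat -> L2 mu).

Lemma cvg_of_geometric_increments (u : nat -> R) (H : R) :
  (forall k, `|u k.+1 - u k| <= H * 2^-1 ^+ k) -> cvgn u.
Proof.
move=> Hu; have H0 : 0 <= H.
  by have := le_trans (normr_ge0 _) (Hu 0%N); rewrite expr0 mulr1.
have -> : u = (fun n => u 0%N + series (telescope u) n).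
  by apply/funext => n; exact: eq_sum_telescope.
apply: is_cvgD; first exact: is_cvg_cst.
apply: normed_cvg; apply: (@series_le_cvg _ _ (geometric H 2^-1)) => [n|n|n|].
- exact: normr_ge0.
- by rewrite /= mulr_ge0// exprn_ge0.
- exact: Hu.
- apply: is_cvg_geometric_series; rewrite ger0_norm//; lra.
Qed.

Lemma nneseries_le_bound (P : pred nat) (u : nat -> \bar R) (b : \bar R) :
  (forall k, P k -> (0 <= u k)%E) ->
  (forall n, (\sum_(0 <= k < n | P k) u k <= b)%E) ->
  (\sum_(0 <= k <oo | P k) u k <= b)%E.
Proof.
move=> u0 ub; apply: lime_le; last exact: nearW.
by apply: is_cvg_nneseries => k _; exact: u0.
Qed.

(** Lets a function built by hand, such as a pointwise limit, be used as an
    element of L^2. *)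
Lemma Lfun2_of_sqr_integral (f : X -> R) : measurable_fun setT f ->
  (\int[mu]_x ((f x) ^+ 2)%:E < +oo)%E -> exists g : L2 mu, g =1 f.
Proof.
move=> mf foo.
have fL : f \in Lfun mu 2%:E.
  rewrite inE; apply/andP; split; rewrite inE//=.
  rewrite /finite_norm unlock; apply: poweR_lty.
  rewrite (_ : integral _ _ _ = (\int[mu]_x ((f x) ^+ 2)%:E)%E)//.
  apply: eq_integral => x _ /=.
  by rewrite powR_mulrn ?normr_ge0// real_normK ?num_real.
by exists (Lfun_Sub (lee1n 2) fL) => x.
Qed.

(** Passing to a subsequence v with |v_k - v_(k+1)|^2 <= 8^-k in L^2 makes the
    weighted sum of the 4^k (v_k - v_(k+1))^2 integrable, hence finite almost
    everywhere; where it is finite, the increments decay geometrically and v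
    converges.  Fatou's lemma then gives convergence in L^2, directly for the
    whole sequence. *)
Lemma L2_complete (u : nat -> L2 mu) :
  (forall eps : R, 0 < eps -> exists N, forall m n, (N <= m)%N -> (N <= n)%N ->
    norm2 (u m - u n) ^+ 2 <= eps) ->
  exists f, L2_cvg u f.
Proof.
move=> cu.
have /choice[N NP] : forall k, exists N, forall m n, (N <= m)%N -> (N <= n)%N ->
    norm2 (u m - u n) ^+ 2 <= (8^-1 ^+ k : R).
  by move=> k; apply: cu; rewrite exprn_gt0.
(* a sum rather than N itself, so that the subsequence is nondecreasing *)
pose phi k := (\sum_(i < k.+1) N i)%N.
have phiN k : (N k <= phi k)%N by rewrite /phi big_ord_recr leq_addl.
have phi_nd m n : (m <= n)%N -> (phi m <= phi n)%N.
  elim: n => [|n IH]; first by rewrite leqn0 => /eqP ->.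
  rewrite leq_eqVlt => /predU1P[->//|/IH mn].
  by rewrite (leq_trans mn)// /phi [leqRHS]big_ord_recr leq_addr.
pose v k := u (phi k).
have vdist k n : (phi k <= n)%N -> norm2 (v k - u n) ^+ 2 <= 8^-1 ^+ k.
  by move=> kn; apply: NP => //; exact: leq_trans kn.
pose dv k x := ((4 ^+ k * (v k x - v k.+1 x) ^+ 2)%:E : \bar R).
have mv k : measurable_fun setT (v k) by exact: measurable_funPT.
have mdv k : measurable_fun setT (dv k).
  apply/measurable_EFinP; apply: measurable_funM => //.
  by apply: measurable_funX; exact: measurable_funB.
have dv0 k x : (0 <= dv k x)%E by rewrite lee_fin mulr_ge0 ?sqr_ge0 ?exprn_ge0.
have dvint k : (\int[mu]_x dv k x <= (2^-1 ^+ k)%:E)%E.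
  rewrite /dv; under eq_integral do rewrite EFinM.
  rewrite ge0_integralZl_EFin ?exprn_ge0//;
    [|by move=> x _; rewrite lee_fin sqr_ge0|
     by apply/measurable_EFinP/measurable_funX; exact: measurable_funB].
  have -> : (\int[mu]_x ((v k x - v k.+1 x) ^+ 2)%:E =
             (norm2 (v k - v k.+1) ^+ 2)%:E)%E by rewrite norm2_sqrE.
  rewrite -EFinM lee_fin.
  apply: (@le_trans _ _ (4 ^+ k * 8^-1 ^+ k)).
    by rewrite ler_wpM2l ?exprn_ge0// vdist// phi_nd.
  by rewrite -exprMn (_ : 4 * 8^-1 = 2^-1)//; field.
pose h x := (\sum_(0 <= k <oo) dv k x)%E.
have mh : measurable_fun setT h by apply: ge0_emeasurable_sum.
have h0 x : (0 <= h x)%E by apply: nneseries_ge0.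
have hint : (\int[mu]_x h x < +oo)%E.
  rewrite /h integral_nneseries//.
  apply: (@le_lt_trans _ _ (\sum_(0 <= k <oo) (2^-1 ^+ k)%:E)%E).
    by apply: lee_nneseries => // k _ _; exact: integral_ge0.
  apply: (@le_lt_trans _ _ 2%:E); last exact: ltry.
  apply: nneseries_le_bound => [k _|n]; first by rewrite lee_fin exprn_ge0.
  rewrite sumEFin lee_fin big_mkord.
  have -> : \sum_(k < n) 2^-1 ^+ k = 2 - 2 * 2^-1 ^+ n :> R.
    elim: n => [|n IH]; first by rewrite big_ord0 expr0; lra.
    by rewrite big_ord_recr/= IH exprS; field.
  by rewrite gerBl mulr_ge0// exprn_ge0.
have hfin : {ae mu, forall x, h x \is a fin_num}.
  have hi : mu.-integrable setT h.
    apply/integrableP; split => //.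
    by under eq_integral do rewrite gee0_abs//.
  by apply: filterS (integrable_ae measurableT hi) => x; exact.
pose G := [set x | (h x < +oo)%E].
have mG : measurable G.
  have := emeasurable_fun_infty_o measurableT mh +oo%E.
  by rewrite setTI.
(* cut off outside G so that the limit exists, and is measurable, everywhere *)
pose w k x := v k x * \1_G x.
have mw k : measurable_fun setT (w k).
  by apply: measurable_funM => //; exact: measurable_indic.
have wcvg x : cvgn (w ^~ x).
  rewrite /w; have [xG|xG] := pselect (G x); last first.
    under eq_fun do rewrite indicE memNset// mulr0.
    exact: is_cvg_cst.
  under eq_fun do rewrite indicE mem_set// mulr1.
  apply: (@cvg_of_geometric_increments _ (Num.sqrt (fine (h x)))) => k.
  have hk : 4 ^+ k * (v k x - v k.+1 x) ^+ 2 <= fine (h x).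
    rewrite -lee_fin fineK ?ge0_fin_numE//.
    apply: le_trans (nneseries_lim_ge k.+1 _) => //.
    by rewrite big_mkord big_ord_recr/= leeDr// sume_ge0.
  rewrite -ler_sqr ?nnegrE ?mulr_ge0 ?sqrtr_ge0 ?exprn_ge0//.
  rewrite real_normK ?num_real// exprMn sqr_sqrtr ?fine_ge0//.
  have -> : (v k.+1 x - v k x) ^+ 2 =
      4 ^+ k * (v k x - v k.+1 x) ^+ 2 * (2^-1 ^+ k) ^+ 2.
    rewrite -exprM mulnC exprM mulrAC -exprMn (_ : 4 * 2^-1 ^+ 2 = 1) ?expr1n.
      by ring.
    by field.
  by rewrite ler_wpM2r// exprn_ge0// exprn_ge0.
pose f0 x := limn (w ^~ x).
have mf0 : measurable_fun setT f0.
  apply/measurable_EFinP; apply: (emeasurable_fun_cvg (fun k x => (w k x)%:E)).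
    by move=> k; exact/measurable_EFinP.
  move=> x _; apply: cvg_EFin; first exact: nearW.
  exact: wcvg.
have aeG : {ae mu, forall x, w ^~ x = v ^~ x}.
  apply: filterS hfin => x; rewrite ge0_fin_numE// => xG.
  by apply/funext => k; rewrite /w indicE mem_set// mulr1.
have key n k0 : (phi k0 <= n)%N ->
    (\int[mu]_x ((f0 x - u n x) ^+ 2)%:E <= (8^-1 ^+ k0)%:E)%E.
  move=> kn.
  have mun : measurable_fun setT (u n) by exact: measurable_funPT.
  pose F k x := ((w k x - u n x) ^+ 2)%:E.
  have FE : (\int[mu]_x ((f0 x - u n x) ^+ 2)%:E =
             \int[mu]_x limn_einf (F ^~ x))%E.
    apply: eq_integral => x _; apply/esym.
    have : F k x @[k --> \oo] --> ((f0 x - u n x) ^+ 2)%:E.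
      apply: cvg_EFin; first exact: nearW.
      apply: (@cvg_comp _ _ _ _ (fun y : R => y ^+ 2)); last exact: exprn_continuous.
      by apply: cvgB; [exact: wcvg|exact: cvg_cst].
    by move=> /cvg_limn_einf_sup[].
  rewrite FE; apply: (le_trans (fatou _ _ _ _)) => //.
    by move=> k; apply/measurable_EFinP/measurable_funX; exact: measurable_funB.
    by move=> k x _; rewrite lee_fin sqr_ge0.
  rewrite limn_einf_lim; apply: lime_le; first exact: is_cvg_einfs.
  apply/nearW => k; apply: (@le_trans _ _ (\int[mu]_x F (maxn k k0) x)%E).
    by apply: ereal_inf_lbound; exists (maxn k k0) => //=; rewrite leq_maxl.
  have -> : (\int[mu]_x F (maxn k k0) x =
             (norm2 (v (maxn k k0) - u n) ^+ 2)%:E)%E.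
    rewrite norm2_sqrE; apply: ge0_ae_eq_integral => //.
    - by apply/measurable_EFinP/measurable_funX; exact: measurable_funB.
    - by apply/measurable_EFinP/measurable_funX; exact: measurable_funPT.
    - by move=> x _; rewrite lee_fin sqr_ge0.
    - by move=> x _; rewrite lee_fin sqr_ge0.
    - apply: filterS aeG => x wv _; rewrite /F.
      by rewrite (_ : w (maxn k k0) x = v (maxn k k0) x)// -[LHS]/((w ^~ x) _) wv.
  rewrite lee_fin NP//; last by rewrite (leq_trans (phiN _)).
  by rewrite (leq_trans (phiN _))// phi_nd// leq_maxr.
have f0fin : (\int[mu]_x ((f0 x) ^+ 2)%:E < +oo)%E.
  pose n := phi 0%N.
  have mun : measurable_fun setT (u n) by exact: measurable_funPT.
  have mB : measurable_fun setT (fun x => ((f0 x - u n x) ^+ 2)%:E).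
    by apply/measurable_EFinP/measurable_funX; exact: measurable_funB.
  have mU : measurable_fun setT (fun x => ((u n x) ^+ 2)%:E).
    by apply/measurable_EFinP/measurable_funX.
  apply: (@le_lt_trans _ _
    (\int[mu]_x (2%:E * (((f0 x - u n x) ^+ 2)%:E + ((u n x) ^+ 2)%:E)))%E).
    apply: ge0_le_integral => //.
    - by move=> x _; rewrite lee_fin sqr_ge0.
    - by apply/measurable_EFinP/measurable_funX.
    - by apply: (emeasurable_funM (measurable_cst _)); exact: emeasurable_funD.
    - move=> x _; rewrite lee_fin -subr_ge0.
      have -> : 2 * ((f0 x - u n x) ^+ 2 + u n x ^+ 2) - f0 x ^+ 2 =
        (f0 x - 2 * u n x) ^+ 2 by ring.
      exact: sqr_ge0.
  rewrite ge0_integralZl_EFin//; last 2 first.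
    by move=> x _; rewrite adde_ge0// lee_fin sqr_ge0.
    exact: emeasurable_funD.
  rewrite ge0_integralD//; [|by move=> x _; rewrite lee_fin sqr_ge0..].
  rewrite -norm2_sqrE lte_mul_pinfty// lte_add_pinfty ?ltry//.
  by rewrite (le_lt_trans (key n 0%N (leqnn _)))// ltry.
have [f ff0] := Lfun2_of_sqr_integral mf0 f0fin.
exists f; apply/cvgrPdist_le => eps eps0.
have [k0 k0eps] : exists k0, 8^-1 ^+ k0 <= eps ^+ 2.
  have := @cvg_geometric R 1 8^-1.
  rewrite ger0_norm// => /(_ _)/cvgrPdist_le/(_ (eps ^+ 2)).
  rewrite exprn_gt0// => -[|//|k0 _ /(_ k0 (leqnn _))]; first by lra.
  rewrite sub0r normrN /= mul1r ger0_norm ?exprn_ge0// => ?.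
  by exists k0.
near=> n; rewrite sub0r normrN ger0_norm ?norm2_ge0//.
rewrite -ler_sqr ?nnegrE ?norm2_ge0 ?(ltW eps0)// (le_trans _ k0eps)//.
rewrite -lee_fin norm2_sqrE; apply: (le_trans _ (key n k0 _)).
  rewrite le_eqVlt; apply/orP; left; apply/eqP; apply: eq_integral => x _.
  by rewrite -ff0 -sqrrN opprB.
by near: n; exact: nbhs_infty_ge.
Unshelve. all: by end_near. Qed.
End L2_complete.

Section L2_bases.
Context d (X : measurableType d) (R : realType).
Variable mu : {measure set X -> \bar R}.
Implicit Types (f g h : L2 mu) (e : nat -> L2 mu).

Lemma inner_basis_sum e (c : nat -> R) N k : orthonormal_system e ->
  inner (e k) (\sum_(i < N) c i *: e i) = if (k < N)%N then c k else 0.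
Proof.
move=> oe; rewrite inner_sumr.
under eq_bigr do rewrite innerZr oe.
case: ifPn => [kN|kN].
  rewrite (bigD1 (Ordinal kN))//= eqxx mulr1 big1 ?addr0// => i.
  by rewrite -val_eqE/= eq_sym => /negbTE ->; rewrite mulr0.
rewrite big1// => i _; case: eqVneq => [ki|_]; last by rewrite mulr0.
by rewrite ki ltn_ord in kN.
Qed.

Lemma Parseval e : orthonormal_basis e -> forall f g,
  \sum_(k < N) inner (e k) f * inner (e k) g @[N --> \oo] --> inner f g.
Proof.
move=> [oe ecvg] f g; have := L2_cvg_inner (ecvg f) g.
apply: cvg_trans; apply: near_eq_cvg; apply: nearW => N.
by rewrite inner_suml; apply: eq_bigr => k _; rewrite innerZl.
Qed.

Arguments Parseval {e} _ f g.

Lemma Parseval_sqr e : orthonormal_basis e -> forall f,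
  \sum_(k < N) inner (e k) f ^+ 2 @[N --> \oo] --> norm2 f ^+ 2.
Proof.
move=> oe f; have := Parseval oe f f; rewrite inner_norm2.
by under eq_fun do under eq_bigr do rewrite -expr2.
Qed.

Arguments Parseval_sqr {e} _ f.

Lemma sum_ord_nondecreasing (a : nat -> R) : (forall k, 0 <= a k) ->
  nondecreasing_seq (fun N => \sum_(k < N) a k).
Proof.
by move=> a0; apply/nondecreasing_seqP => n; rewrite big_ord_recr lerDl.
Qed.

Lemma Bessel e : orthonormal_basis e -> forall f N,
  \sum_(k < N) inner (e k) f ^+ 2 <= norm2 f ^+ 2.
Proof.
move=> oe f N; have cf := Parseval_sqr oe f.
have nd := sum_ord_nondecreasing (fun k => sqr_ge0 (inner (e k) f)).
rewrite -(cvg_lim (@Rhausdorff _) cf); apply: (nondecreasing_cvgn_le nd).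
by apply/cvg_ex; eexists; exact: cf.
Qed.

Lemma norm2_eq0_of_coef e f : orthonormal_basis e ->
  (forall k, inner (e k) f = 0) -> norm2 f = 0.
Proof.
move=> oe f0; have := Parseval_sqr oe f.
under eq_fun do under eq_bigr do rewrite f0 expr0n.
under eq_fun do rewrite big1//.
move=> /(cvg_lim (@Rhausdorff _)); rewrite lim_cst// => /esym/eqP.
by rewrite sqrf_eq0 => /eqP.
Qed.

(** Elements of L^2 are functions here, so a vanishing norm only yields
    equality almost everywhere. *)
Lemma ae_eq_of_coef e f g : orthonormal_basis e ->
  (forall k, inner (e k) f = inner (e k) g) -> f = g %[ae mu].
Proof.
move=> oe fg.
have /(fine_Lnormr_eq0 (f := f - g)) : norm2 (f - g) = 0.
  by apply: (norm2_eq0_of_coef oe) => k; rewrite innerBr fg subrr.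
by apply: filterS => x h _; apply/eqP; rewrite -subr_eq0; apply/eqP; exact: h.
Qed.

Lemma inner_ae_eq f g h : f = g %[ae mu] -> inner f h = inner g h.
Proof.
move=> fg; rewrite /inner /Rintegral; congr fine.
apply: ae_eq_integral => //.
- by apply/measurable_EFinP; apply: measurable_funM; exact: measurable_funPT.
- by apply/measurable_EFinP; apply: measurable_funM; exact: measurable_funPT.
- by apply: filterS fg => x E xT /=; rewrite E.
Qed.

Lemma Riesz_Fischer e (c : nat -> R) (B : R) : orthonormal_system e ->
  (forall N, \sum_(k < N) c k ^+ 2 <= B) ->
  exists f, L2_cvg (fun N => \sum_(k < N) c k *: e k) f.
Proof.
move=> oe cB; apply: L2_complete => eps eps0.
pose s N := \sum_(k < N) c k ^+ 2.
have nds : nondecreasing_seq s.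
  exact: (sum_ord_nondecreasing (fun k => sqr_ge0 (c k))).
have : cvgn s.
  apply: nondecreasing_is_cvgn => //; exists B => _ [N _ <-]; exact: cB.
move=> /cvg_ex[l sl]; have sle n : s n <= l.
  rewrite -(cvg_lim (@Rhausdorff _) sl); apply: (nondecreasing_cvgn_le nds).
  by apply/cvg_ex; exists l.
have [N _ NP] := (@cvgrPdist_le _ _ _ _ _ _ _).1 sl eps eps0.
exists N.
have main m n : (N <= n)%N -> (n <= m)%N ->
    norm2 (\sum_(k < m) c k *: e k - \sum_(k < n) c k *: e k) ^+ 2 <= eps.
  move=> Nn nm; rewrite -inner_norm2 !innerBr !innerBl.
  have E i j : (i <= j)%N ->
      inner (\sum_(k < i) c k *: e k) (\sum_(k < j) c k *: e k) = s i.
    move=> ij; rewrite inner_suml /s; apply: eq_bigr => k _.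
    by rewrite innerZl inner_basis_sum// (leq_trans (ltn_ord k) ij) expr2.
  rewrite (E m m)// (E n n)// (E n m)// (innerC (\sum_(k < m) _)) (E n m)//.
  have := NP n Nn; rewrite ger0_norm ?subr_ge0// => h.
  by have := sle m; lra.
move=> m n Nm Nn; case: (leqP n m) => nm; first exact: main.
have -> : \sum_(k < m) c k *: e k - \sum_(k < n) c k *: e k =
  -1 *: (\sum_(k < n) c k *: e k - \sum_(k < m) c k *: e k).
  by rewrite scaleN1r opprB.
by rewrite -inner_norm2 innerZl innerZr !mulN1r opprK inner_norm2 main// ltnW.
Qed.

(** [L2_lim] picks an arbitrary limit if there is one, which [Riesz_Fischer]
    guarantees; the coefficients do not depend on the choice. *)
Lemma L2_limP e (c : nat -> R) (B : R) : orthonormal_system e ->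
  (forall N, \sum_(k < N) c k ^+ 2 <= B) ->
  forall k, inner (e k) (L2_lim (fun N => \sum_(i < N) c i *: e i)) = c k.
Proof.
move=> oe cB k.
have [f uf] := Riesz_Fischer oe cB.
have : L2_cvg (fun N => \sum_(i < N) c i *: e i)
              (L2_lim (fun N => \sum_(i < N) c i *: e i)).
  exact: (@xgetPex _ 0 [set g | L2_cvg _ g] (ex_intro _ f uf)).
move=> /L2_cvg_inner -/(_ (e k)) h; rewrite innerC.
apply: (cvg_unique (@Rhausdorff R) h).
apply: cvg_near_cst; exists k.+1 => // N /= kN.
by rewrite innerC inner_basis_sum// kN.
Qed.

End L2_bases.
Arguments Parseval {d X R mu e} _ f g.
Arguments Parseval_sqr {d X R mu e} _ f.
Arguments Bessel {d X R mu e} _ f N.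

(** * Deterministic expansion of an eigenvector *)

Section sums.
Context (R : realType).
Implicit Types (P Q : pred nat).

Lemma cvg_sum (T : Type) (F : set_system T) {FF : Filter F} (I : Type)
    (r : seq I) (P : pred I) (f : I -> T -> R) (l : I -> R) :
  (forall i, P i -> f i x @[x --> F] --> l i) ->
  \sum_(i <- r | P i) f i x @[x --> F] --> \sum_(i <- r | P i) l i.
Proof. by apply: cvg_big => //; exact: add_continuous. Qed.

Lemma ler_sum_sub P Q N L (a : nat -> R) : (forall k, 0 <= a k) ->
  (forall k, P k -> Q k) -> (N <= L)%N ->
  \sum_(k < N | P k) a k <= \sum_(k < L | Q k) a k.
Proof.
move=> a0 PQ NL.
rewrite (big_ord_widen_cond _ P a NL) big_mkcond [leRHS]big_mkcond/=.
apply: ler_sum => k _; case: ifPn => [/andP[/PQ -> //]|_].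
by case: ifPn.
Qed.

Lemma sum_ord_split (a : nat -> R) N j : (j < N)%N ->
  \sum_(k < N) a k = a j + \sum_(k < N | k != j :> nat) a k.
Proof. by move=> jN; rewrite (bigD1 (Ordinal jN)). Qed.

(** Bounds the rows c_k of A applied to x when only weighted sums are available:
    Cauchy-Schwarz puts sqrt (G_l) on x_l and 1 / sqrt (G_l) on the entry.  The
    hypothesis on A is about rectangles that contain the N rows, so that bounds
    on square partial sums suffice. *)
Lemma weighted_rows_le P Q (w x G c : nat -> R) (A : nat -> nat -> R) (U B : R) N :
  (forall k, 0 <= w k) -> (forall l, 0 < G l) ->
  (forall k, P k -> \sum_(l < L | Q l) A k l * x l @[L --> \oo] --> c k) ->
  (forall L, \sum_(l < L | Q l) G l * x l ^+ 2 <= U) ->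
  (forall L, (N <= L)%N ->
     \sum_(k < N | P k) \sum_(l < L | Q l) w k * (A k l ^+ 2 / G l) <= B) ->
  \sum_(k < N | P k) w k * c k ^+ 2 <= U * B.
Proof.
move=> w0 G0 cc xU AB.
have U0 : 0 <= U by have := xU 0%N; rewrite big_ord0.
have cv : \sum_(k < N | P k) w k * (\sum_(l < L | Q l) A k l * x l) ^+ 2
    @[L --> \oo] --> \sum_(k < N | P k) w k * c k ^+ 2.
  apply: cvg_sum => k Pk; apply: cvgM; first exact: cvg_cst.
  by apply: (@cvg_comp _ _ _ _ (fun y : R => y ^+ 2));
    [exact: cc|exact: exprn_continuous].
rewrite -(cvg_lim (@Rhausdorff _) cv); apply: limr_le.
  by apply/cvg_ex; eexists; exact: cv.
exists N => // L /= NL; apply: le_trans (ler_wpM2l U0 (AB L NL)).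
rewrite mulr_sumr; apply: ler_sum => k Pk.
rewrite -mulr_sumr [leRHS]mulrCA ler_wpM2l//.
have -> : \sum_(l < L | Q l) A k l * x l =
  \sum_(l < L | Q l) (Num.sqrt (G l) * x l) * (A k l / Num.sqrt (G l)).
  apply: eq_bigr => l _; field.
  by rewrite gt_eqF// sqrtr_gt0.
apply: (le_trans (sum_CS _ _ _ _)); apply: ler_pM.
- by apply: sumr_ge0 => l _; exact: sqr_ge0.
- by apply: sumr_ge0 => l _; exact: sqr_ge0.
- apply: le_trans (xU L); apply: ler_sum => l _.
  by rewrite exprMn sqr_sqrtr// ltW.
- by apply: ler_sum => l _; rewrite expr_div_n sqr_sqrtr// ltW.
Qed.

End sums.

(** In this section x is a unit eigenvector of diag lam + A with eigenvalue ev;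
    ev_eq is the eigenvalue equation, coordinate by coordinate. *)
Section eigenvector_expansion.
Context (R : realType).
Variables (lam G x : nat -> R) (A : nat -> nat -> R) (j : nat).
Variables (y om ph ev Gmax : R).
Hypothesis y_gt0 : 0 < y.
Hypothesis GjE : G j = y.
Hypothesis GE : forall k, k != j -> G k = `|lam j - lam k|.
Hypothesis G_ge : forall k, k != j -> 4 * y <= G k.
Hypothesis G_le : forall k, G k <= Gmax.
Hypothesis om_ge0 : 0 <= om.
Hypothesis ph_ge0 : 0 <= ph.
Hypothesis om_le : om <= 8^-1.
Hypothesis A_om : forall N,
  \sum_(k < N) \sum_(l < N) A k l ^+ 2 / (G k * G l) <= om ^+ 2.
Hypothesis A_ph : forall N,
  \sum_(k < N | k != j :> nat) \sum_(l < N) A k l ^+ 2 * y / (G k ^+ 2 * G l)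
  <= ph ^+ 2.
Hypothesis x_unit : \sum_(k < N) x k ^+ 2 @[N --> \oo] --> (1 : R).
Hypothesis xj_ge0 : 0 <= x j.
Hypothesis ev_eq : forall k,
  \sum_(l < N) A k l * x l @[N --> \oo] --> (ev - lam k) * x k.
Hypothesis ev_close : `|ev - lam j| <= y.

Let G_gt0 k : 0 < G k.
Proof.
have [->|kj] := eqVneq k j; first by rewrite GjE.
by rewrite (lt_le_trans _ (G_ge kj))// mulr_gt0.
Qed.

Let sum_x_le N : \sum_(k < N) x k ^+ 2 <= 1.
Proof.
rewrite -(cvg_lim (@Rhausdorff _) x_unit).
apply: (nondecreasing_cvgn_le (sum_ord_nondecreasing (fun k => sqr_ge0 (x k)))).
by apply/cvg_ex; eexists; exact: x_unit.
Qed.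

Let xj_le1 : x j ^+ 2 <= 1.
Proof.
apply: le_trans (sum_x_le j.+1); rewrite big_ord_recr/= lerDr.
by apply: sumr_ge0 => k _; exact: sqr_ge0.
Qed.

(** The off-diagonal part of row k of A applied to x. *)
Let rem k := (ev - lam k) * x k - A k j * x j.

Let rem_cvg k :
  \sum_(l < N | l != j :> nat) A k l * x l @[N --> \oo] --> rem k.
Proof.
have : \sum_(l < N) A k l * x l - A k j * x j @[N --> \oo] --> rem k.
  by apply: cvgB; [exact: ev_eq|exact: cvg_cst].
apply: cvg_trans; apply: near_eq_cvg; exists j.+1 => // N /= jN.
by rewrite (sum_ord_split (fun l => A k l * x l) jN) addrAC subrr add0r.
Qed.

Let off_le (P : pred nat) N (a : nat -> R) : (forall k, 0 <= a k) ->
  \sum_(k < N | P k) a k <= \sum_(k < N) a k.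
Proof.
move=> a0; have := @ler_sum_sub R P predT N N a a0.
by move=> ->.
Qed.

(** The squared norm of the part of x off j in the rescaled coordinates
    sqrt (G_k) x_k.  It is finite as the weights are bounded. *)
Let U := limn (fun N => \sum_(k < N | k != j :> nat) G k * x k ^+ 2).

Let offU_bound N : \sum_(k < N | k != j :> nat) G k * x k ^+ 2 <= Gmax.
Proof.
have Gm0 : 0 <= Gmax := le_trans (ltW (G_gt0 0)) (G_le 0).
apply: (@le_trans _ _ (Gmax * \sum_(k < N) x k ^+ 2)); last first.
  by rewrite -[leRHS]mulr1 ler_wpM2l.
rewrite mulr_sumr; apply: (@le_trans _ _ (\sum_(k < N) G k * x k ^+ 2)).
  apply: (@off_le (fun k => k != j) N (fun k => G k * x k ^+ 2)) => k.
  by rewrite mulr_ge0 ?sqr_ge0// ltW.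
by apply: ler_sum => k _; rewrite ler_wpM2r ?sqr_ge0.
Qed.

Let off_nd (a : nat -> R) : (forall k, 0 <= a k) ->
  nondecreasing_seq (fun N => \sum_(k < N | k != j :> nat) a k).
Proof.
move=> a0 m n mn.
exact: (@ler_sum_sub R (fun k => k != j) (fun k => k != j)).
Qed.

Let Gx_ge0 k : 0 <= G k * x k ^+ 2.
Proof. by rewrite mulr_ge0 ?sqr_ge0// ltW. Qed.

Let U_cvg : cvgn (fun N => \sum_(k < N | k != j :> nat) G k * x k ^+ 2).
Proof.
apply: nondecreasing_is_cvgn; first exact: (off_nd Gx_ge0).
by exists Gmax => _ [N _ <-]; exact: offU_bound.
Qed.

Let U_ge N : \sum_(k < N | k != j :> nat) G k * x k ^+ 2 <= U.
Proof. exact: (nondecreasing_cvgn_le (off_nd Gx_ge0) U_cvg). Qed.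

Let U_le B : (forall N, \sum_(k < N | k != j :> nat) G k * x k ^+ 2 <= B) -> U <= B.
Proof. by move=> UB; apply: limr_le; [exact: U_cvg|exact: nearW]. Qed.

Let U_ge0 : 0 <= U.
Proof. by have := U_ge 0; rewrite big_ord0. Qed.

Let om_rect (P Q : pred nat) N L : (N <= L)%N ->
  \sum_(k < N | P k) \sum_(l < L | Q l) A k l ^+ 2 / (G k * G l) <= om ^+ 2.
Proof.
move=> NL; apply: le_trans (A_om L).
have a0 k l : 0 <= A k l ^+ 2 / (G k * G l).
  by rewrite divr_ge0 ?sqr_ge0// ltW// mulr_gt0.
apply: (@le_trans _ _ (\sum_(k < N | P k) \sum_(l < L) A k l ^+ 2 / (G k * G l))).
  apply: ler_sum => k _.
  exact: (@off_le Q L (fun l => A k l ^+ 2 / (G k * G l))).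
by apply: (@ler_sum_sub R P predT N L
  (fun k => \sum_(l < L) A k l ^+ 2 / (G k * G l))) => // k; apply: sumr_ge0.
Qed.

Let ph_rect (Q : pred nat) N L : (N <= L)%N ->
  \sum_(k < N | k != j :> nat) \sum_(l < L | Q l) A k l ^+ 2 * y / (G k ^+ 2 * G l)
  <= ph ^+ 2.
Proof.
move=> NL; apply: le_trans (A_ph L).
have a0 k l : 0 <= A k l ^+ 2 * y / (G k ^+ 2 * G l).
  by apply: divr_ge0; apply: mulr_ge0; rewrite ?sqr_ge0 ?ltW.
apply: (@le_trans _ _ (\sum_(k < N | k != j :> nat) \sum_(l < L)
    A k l ^+ 2 * y / (G k ^+ 2 * G l))).
  apply: ler_sum => k _.
  exact: (@off_le Q L (fun l => A k l ^+ 2 * y / (G k ^+ 2 * G l))).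
by apply: (@ler_sum_sub R (fun k => k != j) (fun k => k != j) N L
  (fun k => \sum_(l < L) A k l ^+ 2 * y / (G k ^+ 2 * G l))) => // k; apply: sumr_ge0.
Qed.

Let single (a : nat -> R) k L : (k < L)%N ->
  \sum_(l < L | l == k :> nat) a l = a k.
Proof.
move=> kL; rewrite (big_pred1 (Ordinal kL))// => l.
Qed.

Let col_om N : \sum_(k < N | k != j :> nat) A k j ^+ 2 / G k <= y * om ^+ 2.
Proof.
have h := @om_rect (fun k => k != j) (fun l => l == j) N (maxn N j.+1) (leq_maxl _ _).
apply: le_trans (ler_wpM2l (ltW y_gt0) h).
rewrite mulr_sumr; apply: ler_sum => k _.
rewrite (@single (fun l => A k l ^+ 2 / (G k * G l)) j) ?leq_maxr//.
rewrite GjE le_eqVlt; apply/orP; left; apply/eqP; field.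
by rewrite !gt_eqF.
Qed.

Let Ajj_om : A j j ^+ 2 <= y ^+ 2 * om ^+ 2.
Proof.
have h := @om_rect (fun k => k == j) (fun l => l == j) j.+1 j.+1 (leqnn _).
apply: le_trans (ler_wpM2l (sqr_ge0 y) h).
rewrite (@single (fun k => \sum_(l < j.+1 | l == j :> nat) A k l ^+ 2 / (G k * G l)) j)//.
rewrite (@single (fun l => A j l ^+ 2 / (G j * G l)) j)//.
rewrite GjE le_eqVlt; apply/orP; left; apply/eqP; field.
by rewrite !gt_eqF.
Qed.

Let F k := A k j / (lam j - lam k).

Let F_sqrE k : k != j -> F k ^+ 2 = A k j ^+ 2 / G k ^+ 2.
Proof. by move=> kj; rewrite expr_div_n GE// real_normK ?num_real. Qed.

Lemma first_order_sqr_le N : \sum_(k < N | k != j :> nat) F k ^+ 2 <= ph ^+ 2.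
Proof.
apply: le_trans (@ph_rect (fun l => l == j) N (maxn N j.+1) (leq_maxl _ _)).
apply: ler_sum => k kj.
rewrite (@single (fun l => A k l ^+ 2 * y / (G k ^+ 2 * G l)) j) ?leq_maxr//.
rewrite GjE F_sqrE// le_eqVlt; apply/orP; left; apply/eqP; field.
by rewrite !gt_eqF.
Qed.

Let rem_om N : \sum_(k < N | k != j :> nat) (G k)^-1 * rem k ^+ 2 <= U * om ^+ 2.
Proof.
apply: (@weighted_rows_le R (fun k => k != j) (fun l => l != j)
  (fun k => (G k)^-1) x G rem A) => // [k|L NL].
  by rewrite invr_ge0 ltW.
apply: le_trans (@om_rect (fun k => k != j) (fun l => l != j) N L NL).
apply: ler_sum => k _; apply: ler_sum => l _.
by rewrite le_eqVlt; apply/orP; left; apply/eqP; field; rewrite !gt_eqF.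
Qed.

Let rem_j : rem j ^+ 2 <= U * (y * om ^+ 2).
Proof.
have := @weighted_rows_le R (fun k => k == j) (fun l => l != j)
  (fun k => 1) x G rem A U (y * om ^+ 2) j.+1.
rewrite (@single (fun k => 1 * rem k ^+ 2) j)// mul1r; apply => // L jL.
have h := @om_rect (fun k => k == j) (fun l => l != j) j.+1 L jL.
apply: le_trans (ler_wpM2l (ltW y_gt0) h).
rewrite mulr_sumr; apply: ler_sum => k /eqP ->; rewrite mulr_sumr.
apply: ler_sum => l _; rewrite GjE.
by rewrite le_eqVlt; apply/orP; left; apply/eqP; field; rewrite !gt_eqF.
Qed.

Let rem_ph N :
  \sum_(k < N | k != j :> nat) (G k ^+ 2)^-1 * rem k ^+ 2 <= U * (ph ^+ 2 / y).
Proof.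
apply: (@weighted_rows_le R (fun k => k != j) (fun l => l != j)
  (fun k => (G k ^+ 2)^-1) x G rem A) => // [k|L NL].
  by rewrite invr_ge0 sqr_ge0.
rewrite ler_pdivlMr//.
apply: le_trans (@ph_rect (fun l => l != j) N L NL).
rewrite mulr_suml; apply: ler_sum => k _; rewrite mulr_suml; apply: ler_sum => l _.
by rewrite le_eqVlt; apply/orP; left; apply/eqP; field; rewrite !gt_eqF.
Qed.

Let rhs k := A k j * x j + rem k - (ev - lam j) * x k.

Let rowE k : (lam j - lam k) * x k = rhs k.
Proof. by rewrite /rhs /rem; ring. Qed.

Let om2_le : om ^+ 2 <= 64^-1.
Proof.
have -> : 64^-1 = 8^-1 ^+ 2 :> R by field.
by rewrite lerXn2r// nnegrE; lra.
Qed.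

Let sqr3 (a b c : R) : (a + b - c) ^+ 2 <= 3 * (a ^+ 2 + b ^+ 2 + c ^+ 2).
Proof.
rewrite -subr_ge0.
have -> : 3 * (a ^+ 2 + b ^+ 2 + c ^+ 2) - (a + b - c) ^+ 2 =
  (a - b) ^+ 2 + (a + c) ^+ 2 + (b + c) ^+ 2 by ring.
by rewrite !addr_ge0 ?sqr_ge0.
Qed.

Let ev_sqr : (ev - lam j) ^+ 2 <= y ^+ 2.
Proof. by rewrite -[leLHS]real_normK ?num_real// lerXn2r// nnegrE ltW. Qed.

Let y_le_G k : k != j -> y ^+ 2 <= G k ^+ 2 / 16.
Proof.
move=> kj; rewrite ler_pdivlMr//.
have -> : y ^+ 2 * 16 = (4 * y) ^+ 2 by ring.
by rewrite lerXn2r ?nnegrE ?G_ge// ltW// mulr_gt0.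
Qed.

(** U is bounded by y om^2, up to a constant, plus a fraction of itself, which
    is absorbed on the left; this needs U to be finite. *)
Let U_small : U <= 4 * y * om ^+ 2.
Proof.
have : U <= 3 * (y * om ^+ 2 + U * om ^+ 2 + U / 16).
  apply: U_le => N.
  apply: (@le_trans _ _ (\sum_(k < N | k != j :> nat)
     3 * (A k j ^+ 2 / G k + (G k)^-1 * rem k ^+ 2 + G k * x k ^+ 2 / 16))).
    apply: ler_sum => k kj.
    have E : G k * x k ^+ 2 = (G k)^-1 * ((lam j - lam k) * x k) ^+ 2.
      rewrite exprMn -[(lam j - lam k) ^+ 2]real_normK ?num_real// -GE//.
      by field; rewrite gt_eqF.
    rewrite [leLHS]E rowE ler_pdivrMl//.
    apply: (le_trans (sqr3 _ _ _)).
    rewrite [leRHS]mulrCA ler_pM2l// !mulrDr.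
    apply: lerD; [apply: lerD|].
    - rewrite mulrCA mulfV ?gt_eqF// mulr1 exprMn -[leRHS]mulr1.
      by rewrite ler_wpM2l ?sqr_ge0.
    - by rewrite mulVKf ?gt_eqF.
    - rewrite exprMn.
      have -> : G k * (G k * x k ^+ 2 / 16) = G k ^+ 2 / 16 * x k ^+ 2 by ring.
      by rewrite ler_wpM2r ?sqr_ge0// (le_trans ev_sqr)// y_le_G.
  rewrite -mulr_sumr ler_pM2l// !big_split/=.
  apply: lerD; [apply: lerD|]; [exact: col_om|exact: rem_om|].
  by rewrite -mulr_suml ler_pM2r//; exact: U_ge.
move=> h.
have h1 : U * om ^+ 2 <= U * 64^-1 by rewrite ler_wpM2l.
have h2 : 0 <= y * om ^+ 2 by rewrite mulr_ge0 ?sqr_ge0// ltW.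
rewrite -mulrA; lra.
Qed.

Let pi_om N : \sum_(k < N | k != j :> nat) x k ^+ 2 <= om ^+ 2.
Proof.
have : \sum_(k < N | k != j :> nat) (4 * y) * x k ^+ 2 <= 4 * y * om ^+ 2.
  apply: le_trans U_small; apply: le_trans (U_ge N); apply: ler_sum => k kj.
  by rewrite ler_wpM2r ?sqr_ge0// G_ge.
by rewrite -mulr_sumr ler_pM2l// mulr_gt0.
Qed.

Let pi_cvg : \sum_(k < N | k != j :> nat) x k ^+ 2 @[N --> \oo] --> 1 - x j ^+ 2.
Proof.
have : \sum_(k < N) x k ^+ 2 - x j ^+ 2 @[N --> \oo] --> 1 - x j ^+ 2.
  by apply: cvgB; [exact: x_unit|exact: cvg_cst].
apply: cvg_trans; apply: near_eq_cvg; exists j.+1 => // N /= jN.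
by rewrite (sum_ord_split (fun k => x k ^+ 2) jN) addrAC subrr add0r.
Qed.

Let pi_le_of B : (forall N, \sum_(k < N | k != j :> nat) x k ^+ 2 <= B) ->
  1 - x j ^+ 2 <= B.
Proof.
move=> xB; rewrite -(cvg_lim (@Rhausdorff _) pi_cvg); apply: limr_le.
  by apply/cvg_ex; eexists; exact: pi_cvg.
exact: nearW.
Qed.

Let pi_ge N : \sum_(k < N | k != j :> nat) x k ^+ 2 <= 1 - x j ^+ 2.
Proof.
rewrite -(cvg_lim (@Rhausdorff _) pi_cvg).
apply: (nondecreasing_cvgn_le (off_nd (fun k => sqr_ge0 (x k)))).
by apply/cvg_ex; eexists; exact: pi_cvg.
Qed.

Let pi_om' : 1 - x j ^+ 2 <= om ^+ 2. Proof. exact: pi_le_of pi_om. Qed.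

Let xj_le : x j <= 1.
Proof. by rewrite -(expr_le1 (n := 2)). Qed.

(** Coordinate j of the eigenvalue equation improves the a priori bound y on
    |ev - lam_j| by the factor om. *)
Let ev_fine : (ev - lam j) ^+ 2 <= 4 * y ^+ 2 * om ^+ 2.
Proof.
have E : (ev - lam j) * x j = A j j * x j + rem j by rewrite /rem; ring.
have xj2 : 63 / 64 <= x j ^+ 2 by have := pi_om'; have := om2_le; lra.
have U2 : rem j ^+ 2 <= 4 * y ^+ 2 * om ^+ 2 * 64^-1.
  apply: (le_trans rem_j).
  apply: (@le_trans _ _ (4 * y * om ^+ 2 * (y * om ^+ 2))).
    by rewrite ler_wpM2r ?U_small// mulr_ge0 ?sqr_ge0// ltW.
  have -> : 4 * y * om ^+ 2 * (y * om ^+ 2) = 4 * y ^+ 2 * om ^+ 2 * om ^+ 2.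
    by ring.
  by apply: ler_wpM2l => //; apply: mulr_ge0; rewrite ?sqr_ge0// mulr_ge0// sqr_ge0.
have h : ((ev - lam j) * x j) ^+ 2 <= 2 * (A j j * x j) ^+ 2 + 2 * rem j ^+ 2.
  rewrite E -subr_ge0.
  have -> : 2 * (A j j * x j) ^+ 2 + 2 * rem j ^+ 2 - (A j j * x j + rem j) ^+ 2 =
    (A j j * x j - rem j) ^+ 2 by ring.
  exact: sqr_ge0.
have h2 : (A j j * x j) ^+ 2 <= y ^+ 2 * om ^+ 2.
  rewrite exprMn; apply: le_trans Ajj_om; rewrite -[leRHS]mulr1.
  by rewrite ler_wpM2l ?sqr_ge0.
move: h; rewrite exprMn => h.
have h3 : (ev - lam j) ^+ 2 * (63 / 64) <= (ev - lam j) ^+ 2 * x j ^+ 2.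
  by rewrite ler_wpM2l ?sqr_ge0.
have := mulr_ge0 (sqr_ge0 y) (sqr_ge0 om).
move: U2; rewrite -[4 * y ^+ 2 * _]mulrA; move: h h2 h3.
move: (y ^+ 2 * om ^+ 2) ((A j j * x j) ^+ 2) (rem j ^+ 2) ((ev - lam j) ^+ 2)
  ((ev - lam j) ^+ 2 * x j ^+ 2) => a b c e f.
lra.
Qed.

Let rem_fine N :
  \sum_(k < N | k != j :> nat) (G k ^+ 2)^-1 * rem k ^+ 2 <= 4 * om ^+ 2 * ph ^+ 2.
Proof.
apply: (le_trans (rem_ph N)).
have -> : 4 * om ^+ 2 * ph ^+ 2 = 4 * y * om ^+ 2 * (ph ^+ 2 / y).
  by field; rewrite gt_eqF.
by rewrite ler_wpM2r ?U_small// divr_ge0 ?sqr_ge0// ltW.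
Qed.

Let x_bound k : k != j -> x k ^+ 2 <=
  3 * (F k ^+ 2 + (G k ^+ 2)^-1 * rem k ^+ 2 + x k ^+ 2 / 16).
Proof.
move=> kj.
have G2 : 0 < G k ^+ 2 by rewrite exprn_gt0.
have E : x k ^+ 2 = (G k ^+ 2)^-1 * ((lam j - lam k) * x k) ^+ 2.
  by rewrite exprMn -[(lam j - lam k) ^+ 2]real_normK ?num_real// -GE// mulKf ?gt_eqF.
rewrite [leLHS]E rowE ler_pdivrMl//.
apply: (le_trans (sqr3 _ _ _)).
rewrite [leRHS]mulrCA ler_pM2l// !mulrDr F_sqrE//.
apply: lerD; [apply: lerD|].
- rewrite mulrCA mulfV ?gt_eqF// mulr1 exprMn -[leRHS]mulr1.
  by rewrite ler_wpM2l ?sqr_ge0.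
- by rewrite mulVKf ?gt_eqF.
- rewrite exprMn.
  have -> : G k ^+ 2 * (x k ^+ 2 / 16) = G k ^+ 2 / 16 * x k ^+ 2 by ring.
  by rewrite ler_wpM2r ?sqr_ge0// (le_trans ev_sqr)// y_le_G.
Qed.

Let pi_ph : 1 - x j ^+ 2 <= 4 * ph ^+ 2.
Proof.
have : 1 - x j ^+ 2 <= 3 * (ph ^+ 2 + 4 * om ^+ 2 * ph ^+ 2 + (1 - x j ^+ 2) / 16).
  apply: pi_le_of => N.
  apply: (@le_trans _ _ (\sum_(k < N | k != j :> nat)
     3 * (F k ^+ 2 + (G k ^+ 2)^-1 * rem k ^+ 2 + x k ^+ 2 / 16))).
    by apply: ler_sum => k; exact: x_bound.
  rewrite -mulr_sumr ler_pM2l// !big_split/=.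
  apply: lerD; [apply: lerD|]; [exact: first_order_sqr_le|exact: rem_fine|].
  by rewrite -mulr_suml ler_pM2r//; exact: pi_ge.
have h1 : om ^+ 2 * ph ^+ 2 <= 64^-1 * ph ^+ 2 by rewrite ler_wpM2r ?sqr_ge0.
have := sqr_ge0 ph; rewrite -mulrA; lra.
Qed.

(** The three terms are: first order times 1 - x_j, where 1 - x_j is at most
    om^2; the off-diagonal part, of norm at most 2 om ph; and the shift of the
    eigenvalue, relative to the gaps at most om / 2, times the part of x off j,
    of norm at most 2 ph. *)
Lemma expansion_remainder_le N :
  \sum_(k < N | k != j :> nat) (x k - F k) ^+ 2 <= 16 * om ^+ 2 * ph ^+ 2.
Proof.
have t0 : 0 <= 1 - x j by rewrite subr_ge0.
have t1 : (1 - x j) ^+ 2 <= om ^+ 2 / 64.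
  have q : 1 - x j <= om ^+ 2.
    by apply: le_trans pi_om'; have := xj_ge0; have := t0; rewrite expr2; nra.
  by rewrite expr2; apply: ler_pM => //; exact: le_trans om2_le.
apply: (@le_trans _ _ (\sum_(k < N | k != j :> nat)
  3 * (om ^+ 2 / 64 * F k ^+ 2 + (G k ^+ 2)^-1 * rem k ^+ 2 + om ^+ 2 / 4 * x k ^+ 2))).
  apply: ler_sum => k kj.
  have gn : lam j - lam k != 0 by rewrite -normr_gt0 -GE.
  have G2 : G k ^+ 2 = (lam j - lam k) ^+ 2 by rewrite GE// real_normK ?num_real.
  have G20 : 0 < G k ^+ 2 by rewrite exprn_gt0.
  have -> : x k - F k = (x j - 1) * F k + rem k / (lam j - lam k) -
      (ev - lam j) * x k / (lam j - lam k).
    have -> : x k = rhs k / (lam j - lam k) by rewrite -rowE mulrAC mulfV// mul1r.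
    rewrite {1}/rhs {1}(_ : x k = rhs k / (lam j - lam k)); last first.
      by rewrite -rowE mulrAC mulfV// mul1r.
    by rewrite /F; field.
  apply: (le_trans (sqr3 _ _ _)); rewrite ler_pM2l//.
  apply: lerD; [apply: lerD|].
  - by rewrite exprMn ler_wpM2r ?sqr_ge0// -sqrrN opprB.
  - by rewrite expr_div_n -G2 mulrC.
  - rewrite expr_div_n -G2 exprMn mulrAC ler_wpM2r ?sqr_ge0//.
    rewrite ler_pdivrMr//; apply: (le_trans ev_fine).
    have -> : 4 * y ^+ 2 * om ^+ 2 = om ^+ 2 / 4 * (y ^+ 2 * 16) by field.
    rewrite ler_wpM2l ?divr_ge0 ?sqr_ge0//.
    by rewrite -ler_pdivlMr// y_le_G.
rewrite -mulr_sumr !big_split/= -!mulr_sumr.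
have h1 : om ^+ 2 / 64 * \sum_(k < N | k != j :> nat) F k ^+ 2 <= om ^+ 2 / 64 * ph ^+ 2.
  by rewrite ler_wpM2l ?divr_ge0 ?sqr_ge0// first_order_sqr_le.
have h2 := rem_fine N.
have h3 : om ^+ 2 / 4 * \sum_(k < N | k != j :> nat) x k ^+ 2 <=
    om ^+ 2 / 4 * (4 * ph ^+ 2).
  by rewrite ler_wpM2l ?divr_ge0 ?sqr_ge0// (le_trans (pi_ge N)).
have := mulr_ge0 (sqr_ge0 om) (sqr_ge0 ph).
move: h1 h2 h3; rewrite -[4 * _ * _]mulrA -[16 * _ * _]mulrA.
have -> : om ^+ 2 / 4 * (4 * ph ^+ 2) = om ^+ 2 * ph ^+ 2 by field.
rewrite [om ^+ 2 / 64 * ph ^+ 2]mulrAC; lra.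
Qed.

(** As |x - e_j|^2 = 2 (1 - x_j) differs from 1 - x_j^2, the squared norm of the
    part of x off j, by (1 - x_j)^2 only, it remains to compare the squared
    norms of that part and of the first-order term, whose difference is the
    remainder bounded before. *)
Lemma norm_expansion_le :
  `|2 * (1 - x j) - limn (fun N => \sum_(k < N | k != j :> nat) F k ^+ 2)|
   <= 11 * (om * ph ^+ 2).
Proof.
have cF : cvgn (fun N => \sum_(k < N | k != j :> nat) F k ^+ 2).
  apply: nondecreasing_is_cvgn; first exact: (off_nd (fun k => sqr_ge0 (F k))).
  by exists (ph ^+ 2) => _ [N _ <-]; exact: first_order_sqr_le.
have omph0 : 0 <= om * ph ^+ 2 by rewrite mulr_ge0 ?sqr_ge0.
have omph1 : om ^+ 2 * ph ^+ 2 <= 8^-1 * (om * ph ^+ 2).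
  by rewrite [leRHS]mulrA ler_wpM2r ?sqr_ge0// expr2 ler_wpM2r.
have main N : `|\sum_(k < N | k != j :> nat) x k ^+ 2 -
               \sum_(k < N | k != j :> nat) F k ^+ 2| <= 10 * (om * ph ^+ 2).
  rewrite -sumrB.
  have -> : \sum_(k < N | k != j :> nat) (x k ^+ 2 - F k ^+ 2) =
      2 * (\sum_(k < N | k != j :> nat) (x k - F k) * F k) +
      \sum_(k < N | k != j :> nat) (x k - F k) ^+ 2.
    by rewrite mulr_sumr -big_split; apply: eq_bigr => k _ /=; ring.
  have r2 := expansion_remainder_le N.
  have r0 : 0 <= \sum_(k < N | k != j :> nat) (x k - F k) ^+ 2.
    by apply: sumr_ge0 => k _; exact: sqr_ge0.
  have : `|\sum_(k < N | k != j :> nat) (x k - F k) * F k| <= 4 * (om * ph ^+ 2).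
    rewrite -ler_sqr ?nnegrE ?mulr_ge0// ?sqr_ge0// real_normK ?num_real//.
    apply: (le_trans (sum_CS _ _ _ _)).
    have -> : (4 * (om * ph ^+ 2)) ^+ 2 = 16 * om ^+ 2 * ph ^+ 2 * ph ^+ 2 by ring.
    apply: ler_pM => //; last exact: first_order_sqr_le.
    by apply: sumr_ge0 => k _; exact: sqr_ge0.
  move: r2; rewrite -[16 * _ * _]mulrA !ler_norml => r2 /andP[h1 h2].
  by apply/andP; split; lra.
have c : \sum_(k < N | k != j :> nat) x k ^+ 2 -
         \sum_(k < N | k != j :> nat) F k ^+ 2 @[N --> \oo] -->
         1 - x j ^+ 2 - limn (fun N => \sum_(k < N | k != j :> nat) F k ^+ 2).
  by apply: cvgB; [exact: pi_cvg|exact: cF].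
have : `|1 - x j ^+ 2 - limn (fun N => \sum_(k < N | k != j :> nat) F k ^+ 2)|
    <= 10 * (om * ph ^+ 2).
  rewrite -(cvg_lim (@Rhausdorff _) (cvg_norm c)); apply: limr_le.
    by apply/cvg_ex; eexists; exact: cvg_norm c.
  exact: nearW.
have t0 : 0 <= 1 - x j by rewrite subr_ge0.
have t1 : (1 - x j) ^+ 2 <= 4 * (om ^+ 2 * ph ^+ 2).
  have q : 1 - x j <= 1 - x j ^+ 2 by have := xj_ge0; have := t0; rewrite expr2; nra.
  have -> : 4 * (om ^+ 2 * ph ^+ 2) = om ^+ 2 * (4 * ph ^+ 2) by ring.
  rewrite expr2; apply: ler_pM => //; first exact: le_trans pi_om'.
  exact: le_trans pi_ph.
have -> : 2 * (1 - x j) = 1 - x j ^+ 2 + (1 - x j) ^+ 2 by ring.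
have := sqr_ge0 (1 - x j).
move: t1; move: (limn _) ((1 - x j) ^+ 2) (1 - x j ^+ 2) => L a b.
rewrite !ler_norml => a1 a2 /andP[h1 h2]; apply/andP; split; lra.
Qed.


End eigenvector_expansion.

(** * Largest eigenvalue of a Hilbert-Schmidt matrix *)

Section quadratic_form.
Context (R : realType).
Variable A : nat -> nat -> R.
Variable H : R.
Hypothesis A_sym : forall k l, A k l = A l k.
Hypothesis A_hs : forall N, \sum_(k < N) \sum_(l < N) A k l ^+ 2 <= H.
Implicit Types x z : nat -> R.

Definition qform N (x : nat -> R) := \sum_(k < N) \sum_(l < N) A k l * x k * x l.

(** The product topology on sequences is the weak topology on this ball. *)
Definition l2_ball : set (prod_topology (fun _ : nat => R)) :=
  [set x : nat -> R | forall N, \sum_(k < N) x k ^+ 2 <= 1].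

Let hs N := \sum_(k < N) \sum_(l < N) A k l ^+ 2.

Let square_mask (a : nat -> nat -> R) N L : (N <= L)%N ->
  \sum_(k < L) \sum_(l < L) (if (k < N)%N && (l < N)%N then a k l else 0) =
  \sum_(k < N) \sum_(l < N) a k l.
Proof.
move=> NL; rewrite (big_ord_widen_cond _ predT (fun k => \sum_(l < N) a k l) NL).
rewrite [RHS]big_mkcond/=; apply: eq_bigr => k _.
case: (ltnP k N) => kN /=; last by rewrite big1.
by rewrite -big_mkcond/= (big_ord_widen_cond _ predT (fun l => a k l) NL).
Qed.

(** The bound does not depend on x: this uniformity makes the limit form
    continuous in the product topology. *)
Lemma qform_tail N L x : (N <= L)%N -> l2_ball x ->
  (qform L x - qform N x) ^+ 2 <= hs L - hs N.
Proof.
move=> NL xB.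
(* A outside the square of side N *)
pose c k l := if (k < N)%N && (l < N)%N then 0 else A k l.
have -> : qform L x - qform N x = \sum_(k < L) \sum_(l < L) c k l * (x k * x l).
  rewrite /qform -(square_mask (fun k l => A k l * x k * x l) NL) -sumrB.
  apply: eq_bigr => k _; rewrite -sumrB; apply: eq_bigr => l _.
  by rewrite /c; case: ifP => _; ring.
have -> : hs L - hs N = \sum_(k < L) \sum_(l < L) c k l ^+ 2.
  rewrite /hs -(square_mask (fun k l => A k l ^+ 2) NL) -sumrB.
  apply: eq_bigr => k _; rewrite -sumrB; apply: eq_bigr => l _.
  by rewrite /c; case: ifP => _; ring.
rewrite !pair_bigA/=; apply: (le_trans (sum_CS _ _ _ _)).
rewrite -[leRHS]mulr1 ler_wpM2l//; first by apply: sumr_ge0 => i _; exact: sqr_ge0.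
rewrite -(pair_bigA _ (fun k l : 'I_L => (x k * x l) ^+ 2))/=.
under eq_bigr do under eq_bigr do rewrite exprMn.
under eq_bigr do rewrite -mulr_sumr.
rewrite -mulr_suml -[leRHS]mulr1 ler_pM ?xB//;
  by apply: sumr_ge0 => i _; exact: sqr_ge0.
Qed.

Let hs_nd : nondecreasing_seq hs.
Proof.
move=> N L NL; rewrite -subr_ge0; apply: le_trans (qform_tail NL (x := fun=> 0) _).
  exact: sqr_ge0.
by move=> n; rewrite big1// => k _; rewrite expr0n.
Qed.

Let hs_cvg : cvgn hs.
Proof.
apply: nondecreasing_is_cvgn => //.
by exists H => _ [N _ <-]; exact: A_hs.
Qed.

Let hs_le N : hs N <= limn hs. Proof. exact: nondecreasing_cvgn_le. Qed.

Lemma qform_cvg x : l2_ball x -> cvgn (qform ^~ x).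
Proof.
move=> xB; apply: cauchy_cvg; apply: cauchy_exP => eps e0.
have [N _ NP] := (@cvgrPdist_lt _ _ _ _ _ _ _).1 hs_cvg (eps ^+ 2) (exprn_gt0 _ e0).
exists (qform N x); exists N => // L /= NL; rewrite /ball/= distrC.
rewrite -ltr_sqr ?nnegrE ?(ltW e0)// real_normK ?num_real//.
apply: (le_lt_trans (qform_tail NL xB)).
apply: le_lt_trans (NP N (leqnn _)); rewrite ger0_norm ?subr_ge0//.
by rewrite lerD2r.
Qed.

Lemma qform_lim_dist N x : l2_ball x ->
  (limn (qform ^~ x) - qform N x) ^+ 2 <= limn hs - hs N.
Proof.
move=> xB.
have c : (qform L x - qform N x) ^+ 2 @[L --> \oo] -->
    (limn (qform ^~ x) - qform N x) ^+ 2.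
  apply: (@cvg_comp _ _ _ _ (fun y : R => y ^+ 2)); last exact: exprn_continuous.
  by apply: cvgB; [exact: qform_cvg|exact: cvg_cst].
rewrite -(cvg_lim (@Rhausdorff _) c); apply: limr_le.
  by apply/cvg_ex; eexists; exact: c.
exists N => // L /= NL; apply: (le_trans (qform_tail NL xB)).
by rewrite lerD2r.
Qed.

Let coord_cont k : continuous (fun x : prod_topology (fun _ : nat => R) => x k : R).
Proof. exact: (@proj_continuous nat (fun _ => R) k). Qed.

Let qform_cont N : continuous (fun x : prod_topology (fun _ : nat => R) => qform N x : R).
Proof.
move=> x; rewrite /qform.
apply: (@cvg_sum R _ (nbhs x)) => k _; apply: (@cvg_sum R _ (nbhs x)) => l _.
apply: (@cvgM _ _ (nbhs x)); last exact: coord_cont.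
by apply: (@cvgM _ _ (nbhs x)); [exact: cvg_cst|exact: coord_cont].
Qed.

Let l2_ball_compact : compact l2_ball.
Proof.
apply: (@subclosed_compact _ _
  [set x : prod_topology (fun _ : nat => R) |
    forall i, (`[(-1 : R), 1]%classic : set R) (x i)]).
- rewrite (_ : l2_ball = \bigcap_N
    ((fun x : prod_topology (fun _ : nat => R) => \sum_(k < N) x k ^+ 2 : R)
       @^-1` [set r | r <= 1])); last first.
    by apply/seteqP; split => x /= h N; [move=> _|]; apply: h.
  apply: closed_bigI => N _; apply: preimage_closed; last exact: closed_le.
  move=> x _; apply: (@cvg_sum R _ (nbhs x)) => k _.
  apply: (@cvg_comp _ _ _ _ (fun y : R => y ^+ 2) (nbhs x)).
    exact: coord_cont.
  exact: exprn_continuous.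
- apply: (@tychonoff nat (fun _ => R) (fun=> `[(-1 : R), 1]%classic)) => _.
  exact: segment_compact.
- move=> x xB i /=; have := xB i.+1; rewrite big_ord_recr/= => h.
  have : x i ^+ 2 <= 1.
    apply: le_trans h; rewrite lerDr.
    by apply: sumr_ge0 => k _; exact: sqr_ge0.
  by rewrite in_itv/= -ler_norml -[x i ^+ 2]real_normK ?num_real// expr_le1.
Qed.

Lemma qform_max : exists2 x, l2_ball x &
  forall z, l2_ball z -> limn (qform ^~ z) <= limn (qform ^~ x).
Proof.
have [||x xB xmax] := @compact_EVT_max (prod_topology (fun _ : nat => R)) R
    (fun x => limn (fun N => qform N x)) l2_ball _ l2_ball_compact.
- by exists (fun=> 0) => n; rewrite big1// => k _; rewrite expr0n.
- apply/subspace_continuousP => x xB; apply/cvgrPdist_le => /= eps e0.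
  have e3 : 0 < eps / 3 by rewrite divr_gt0.
  have [N _ NP] := (@cvgrPdist_le _ _ _ _ _ _ _).1 hs_cvg ((eps / 3) ^+ 2)
    (exprn_gt0 _ e3).
  have dist z : l2_ball z -> `|limn (qform ^~ z) - qform N z| <= eps / 3.
    move=> zB; rewrite -ler_sqr ?nnegrE ?(ltW e3)// real_normK ?num_real//.
    apply: (le_trans (qform_lim_dist N zB)).
    by apply: le_trans (NP N (leqnn _)); rewrite ger0_norm ?subr_ge0.
  have cx : \forall z \near nbhs x, `|qform N x - qform N z| <= eps / 3.
    exact: ((@cvgrPdist_le _ _ _ _ _ _ _).1 (@qform_cont N x)).
  rewrite near_withinE; apply: filterS cx => z xz zB.
  have := dist x xB; have := dist z zB; move: xz.
  rewrite !ler_norml => /andP[h1 h2] /andP[h3 h4] /andP[h5 h6].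
  by rewrite /from_subspace; apply/andP; split; lra.
- exists x; first exact: set_mem.
  by move=> z zB; apply: xmax; exact: mem_set.
Qed.

Lemma qform_scale (c : R) N x : qform N (fun k => c * x k) = c ^+ 2 * qform N x.
Proof.
rewrite /qform mulr_sumr; apply: eq_bigr => k _; rewrite mulr_sumr.
by apply: eq_bigr => l _; ring.
Qed.

Let ball_scale x (S : R) : 0 < S -> (forall N, \sum_(k < N) x k ^+ 2 <= S) ->
  l2_ball (fun k => (Num.sqrt S)^-1 * x k).
Proof.
move=> S0 xS N.
under eq_bigr do rewrite exprMn exprVn sqr_sqrtr ?(ltW S0)//.
by rewrite -mulr_sumr ler_pdivrMl// mulr1.
Qed.

Lemma qform_bounded x (S M : R) : 0 < S -> (forall N, \sum_(k < N) x k ^+ 2 <= S) ->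
  (forall z, l2_ball z -> limn (qform ^~ z) <= M) ->
  cvgn (qform ^~ x) /\ limn (qform ^~ x) <= M * S.
Proof.
move=> S0 xS zM; have wB := ball_scale S0 xS.
have E : qform ^~ x = (fun N => S * qform N (fun k => (Num.sqrt S)^-1 * x k)).
  apply/funext => N; rewrite qform_scale exprVn sqr_sqrtr ?(ltW S0)//.
  by rewrite mulVKf// gt_eqF.
have cx : qform N x @[N --> \oo] -->
    S * limn (qform ^~ (fun k => (Num.sqrt S)^-1 * x k)).
  by rewrite E; apply: cvgM; [exact: cvg_cst|exact: qform_cvg].
split; first by apply/cvg_ex; eexists; exact: cx.
by rewrite (cvg_lim (@Rhausdorff _) cx) mulrC ler_wpM2r ?(ltW S0)// zM.
Qed.

Lemma qform_shift x i (s : R) N : (i < N)%N ->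
  qform N (fun k => x k + (if k == i then s else 0)) =
  qform N x + 2 * s * \sum_(l < N) A i l * x l + s ^+ 2 * A i i.
Proof.
move=> iN; pose dl k : R := if k == i then s else 0.
have pick (g : nat -> R) : \sum_(k < N) dl k * g k = s * g i.
  rewrite (bigD1 (Ordinal iN))//= /dl eqxx big1 ?addr0// => k.
  by rewrite -val_eqE/= => /negbTE ->; rewrite mul0r.
have -> : qform N (fun k => x k + dl k) = qform N x +
    (\sum_(k < N) dl k * \sum_(l < N) A k l * x l) +
    (\sum_(l < N) dl l * \sum_(k < N) A k l * x k) +
    \sum_(k < N) dl k * \sum_(l < N) dl l * A k l.
  have -> : \sum_(l < N) dl l * \sum_(k < N) A k l * x k =
      \sum_(k < N) \sum_(l < N) dl l * (A k l * x k).
    by rewrite exchange_big; apply: eq_bigr => l _; rewrite mulr_sumr.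
  rewrite -!big_split; apply: eq_bigr => k _.
  rewrite !mulr_sumr -!big_split; apply: eq_bigr => l _ /=; ring.
rewrite [X in _ + X + _ + _](pick (fun k => \sum_(l < N) A k l * x l)).
rewrite [X in _ + X + _](pick (fun l => \sum_(k < N) A k l * x k)).
rewrite [X in _ + X](pick (fun k => \sum_(l < N) dl l * A k l)).
rewrite (pick (fun l => A i l)).
have -> : \sum_(k < N) A k i * x k = \sum_(l < N) A i l * x l.
  by apply: eq_bigr => k _; rewrite A_sym.
by ring.
Qed.

(** At a maximiser x, moving along each basis vector of l^2 changes the form
    minus M times the squared norm by a nonpositive quadratic polynomial without
    constant term, so its linear coefficient vanishes; this is the eigenvalue
    equation. *)
Lemma qform_eigenvector z : l2_ball z -> 0 < limn (qform ^~ z) ->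
  exists x M, [/\ l2_ball x, exists i, x i != 0, limn (qform ^~ z) <= M &
    forall i, \sum_(l < N) A i l * x l @[N --> \oo] --> M * x i].
Proof.
move=> zB z0; have [x xB xmax] := qform_max.
exists x; set M := limn (qform ^~ x); exists M.
have M0 : 0 < M := lt_le_trans z0 (xmax _ zB).
split => //; last 2 first.
- exact: xmax.
- move=> i.
  pose w s k := x k + (if k == i then s else 0).
  have wS s N : \sum_(k < N) w s k ^+ 2 <= 1 + 2 * s * x i + s ^+ 2.
    apply: (@le_trans _ _ (\sum_(k < maxn N i.+1) w s k ^+ 2)).
      by apply: (sum_ord_nondecreasing (fun k => sqr_ge0 (w s k))); exact: leq_maxl.
    have iN : (i < maxn N i.+1)%N by exact: leq_maxr.
    rewrite (sum_ord_split (fun k => w s k ^+ 2) iN).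
    have := xB (maxn N i.+1); rewrite (sum_ord_split (fun k => x k ^+ 2) iN).
    have -> : \sum_(k < maxn N i.+1 | k != i :> nat) w s k ^+ 2 =
        \sum_(k < maxn N i.+1 | k != i :> nat) x k ^+ 2.
      by apply: eq_bigr => k /negbTE ki; rewrite /w ki addr0.
    rewrite /w eqxx; move: (\sum_(_ < _ | _) _) => t h.
    have -> : (x i + s) ^+ 2 + t = x i ^+ 2 + t + 2 * s * x i + s ^+ 2 by ring.
    lra.
  have bnd s e : 0 < e -> cvgn (qform ^~ (w s)) /\
      limn (qform ^~ (w s)) <= M * (1 + 2 * s * x i + s ^+ 2 + e).
    move=> e0; apply: qform_bounded => //.
      by rewrite ltr_wpDl//; have := wS s 0%N; rewrite big_ord0.
    by move=> N; rewrite (le_trans (wS s N))// lerDl ltW.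
  have [l rl] : exists l : R, \sum_(k < N) A i k * x k @[N --> \oo] --> l.
    exists ((limn (qform ^~ (w 1)) - M - A i i) / 2).
    have : (qform N (w 1) - qform N x - A i i) / 2 @[N --> \oo] -->
       (limn (qform ^~ (w 1)) - M - A i i) / 2.
      apply: cvgM; last exact: cvg_cst.
      apply: cvgB; last exact: cvg_cst.
      by apply: cvgB; [exact: (bnd 1 1 ltr01).1|exact: qform_cvg].
    apply: cvg_trans; apply: near_eq_cvg; exists i.+1 => // N /= iN.
    by rewrite qform_shift//; field.
  suff : (M * x i - l) ^+ 2 <= 0 * (M - A i i).
    rewrite mul0r => h; have : (M * x i - l) ^+ 2 == 0.
      by rewrite eq_le h sqr_ge0.
    by rewrite sqrf_eq0 subr_eq0 => /eqP ->.
  have key s : 0 <= 0 + 2 * s * (M * x i - l) + s ^+ 2 * (M - A i i).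
    have cw : qform N (w s) @[N --> \oo] --> M + 2 * s * l + s ^+ 2 * A i i.
      have : qform N x + 2 * s * (\sum_(l < N) A i l * x l) + s ^+ 2 * A i i
          @[N --> \oo] --> M + 2 * s * l + s ^+ 2 * A i i.
        apply: cvgD; last exact: cvg_cst.
        apply: cvgD; first exact: qform_cvg.
        by apply: cvgM; [exact: cvg_cst|exact: rl].
      apply: cvg_trans; apply: near_eq_cvg; exists i.+1 => // N /= iN.
      by rewrite qform_shift.
    have : M + 2 * s * l + s ^+ 2 * A i i <= M * (1 + 2 * s * x i + s ^+ 2).
      (* the bound 1 + 2 s x_i + s^2 on the squared norm may be 0, which
         [qform_bounded] excludes; hence the slack e / M *)
      apply/ler_addgt0Pr => e e0.
      have [_] := bnd s (e / M) (divr_gt0 e0 M0).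
      rewrite (cvg_lim (@Rhausdorff _) cw) => h; apply: (le_trans h).
      by rewrite mulrDr mulrCA mulfV ?mulr1// gt_eqF.
    rewrite -subr_ge0 => h; apply: (le_trans h).
    by rewrite le_eqVlt; apply/orP; left; apply/eqP; ring.
  apply: (quadratic_discriminant _ key).
  by have := key 1; have := key (-1); lra.
- apply: contrapT => /forallNP x0.
  suff : M = 0 by move=> M00; rewrite M00 ltxx in M0.
  rewrite /M (_ : qform ^~ x = fun=> 0) ?lim_cst//.
  apply/funext => N; rewrite /qform big1// => k _; rewrite big1// => l _.
  by have /negP/negPn/eqP -> := x0 k; rewrite mulr0 mul0r.
Qed.

End quadratic_form.

Lemma underdetermined (R : fieldType) (j : nat) (b : nat -> nat -> R) :
  exists c : nat -> R, (exists2 i, (i < j.+1)%N & c i != 0) /\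
    forall k, (k < j)%N -> \sum_(i < j.+1) c i * b i k = 0.
Proof.
pose B : 'M[R]_(j.+1, j) := \matrix_(i, k) b i k.
have K0 : kermx B != 0.
  by rewrite -mxrank_eq0 mxrank_ker -lt0n subn_gt0 ltnS rank_leq_col.
have [v vB v0] := rowV0Pn K0.
pose c i := if insub i is Some k then v ord0 k else 0.
have cE (i : 'I_j.+1) : c i = v ord0 i by rewrite /c valK.
exists c; split.
  move: v0 => /rV0Pn[i vi]; exists i => //; first by rewrite cE (ord1 ord0).
move=> k kj; have /matrixP/(_ ord0 (Ordinal kj)) := sub_kermxP vB.
rewrite mxE [RHS]mxE => h; rewrite -[RHS]h.
by apply: eq_bigr => i _; rewrite cE mxE.
Qed.

(** * Min-max bounds for the ordered eigenvalues *)

Section matrix_operator.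
Context d (X : measurableType d) (R : realType).
Variable mu : {measure set X -> \bar R}.
Variables (e : nat -> L2 mu) (A : nat -> nat -> R) (T : L2 mu -> L2 mu).
Hypothesis e_basis : orthonormal_basis e.
Hypothesis TE : forall f, L2_cvg (fun N => \sum_(i < N) \sum_(l < N)
  (A i l * inner (e i) f) *: e l) (T f).
Hypothesis T_sym : forall f g, inner (T f) g = inner f (T g).

Lemma matrix_operator_coef f k :
  \sum_(i < N) A i k * inner (e i) f @[N --> \oo] --> inner (e k) (T f).
Proof.
have := L2_cvg_inner (TE f) (e k); rewrite innerC.
apply: cvg_trans; apply: near_eq_cvg; exists k.+1 => // N /= kN.
rewrite inner_suml; apply: eq_bigr => i _.
have [oe _] := e_basis.
by rewrite innerC (inner_basis_sum (fun l => A i l * inner (e i) f))// kN.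
Qed.

Arguments matrix_operator_coef f k : clear implicits.

Lemma matrix_operator_form f :
  qform A N (fun k => inner (e k) f) @[N --> \oo] --> inner (T f) f.
Proof.
have := L2_cvg_inner (TE f) f.
apply: cvg_trans; apply: near_eq_cvg; apply: nearW => N.
rewrite inner_suml; apply: eq_bigr => i _; rewrite inner_suml.
by apply: eq_bigr => l _; rewrite innerZl.
Qed.

Arguments matrix_operator_form f : clear implicits.

Lemma matrix_operator_entry i k : A i k = inner (e k) (T (e i)).
Proof.
have h := matrix_operator_coef (e i) k.
apply/esym; apply: (cvg_unique (@Rhausdorff R) h).
apply: cvg_near_cst; exists i.+1 => // N /= iN.
have [oe _] := e_basis.
rewrite (bigD1 (Ordinal iN))//= oe eqxx mulr1 big1 ?addr0// => l.
by rewrite -val_eqE/= oe => /negbTE ->; rewrite mulr0.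
Qed.

Lemma matrix_operator_sym i k : A i k = A k i.
Proof. by rewrite !matrix_operator_entry innerC T_sym. Qed.

Section eigenvalue_bounds.
Variables (l : nat -> R) (f : nat -> L2 mu) (j : nat).
Hypothesis lf : ordered_eigensystem T l f.

Let of_ : orthonormal_system f. Proof. by case: lf. Qed.

Let eigf i g : inner (T (f i)) g = l i * inner (f i) g.
Proof.
case: lf => _ _ fE _.
by rewrite (inner_ae_eq _ (fE i)) innerZl.
Qed.

(** The span of the eigenfunctions f_0, ..., f_j has dimension j + 1 and so
    contains a nonzero g orthogonal to e_0, ..., e_(j-1); the form of T at g is
    at least l_j times the squared norm. *)
Lemma eigenvalue_le (tau : R) :
  (forall g, (forall i, (i < j)%N -> inner (e i) g = 0) ->
     inner (T g) g <= tau * norm2 g ^+ 2) -> l j <= tau.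
Proof.
move=> H.
have [c [[i0 i0j ci0] cf]] := underdetermined j (fun i k => inner (e k) (f i)).
pose g := \sum_(i < j.+1) c i *: f i.
have fg i : (i < j.+1)%N -> inner (f i) g = c i.
  by move=> ij; rewrite inner_basis_sum// ij.
have ng : norm2 g ^+ 2 = \sum_(i < j.+1) c i ^+ 2.
  rewrite -inner_norm2 {1}/g inner_suml; apply: eq_bigr => i _.
  by rewrite innerZl fg// expr2.
have ng0 : 0 < norm2 g ^+ 2.
  rewrite ng (bigD1 (Ordinal i0j))//= ltr_pwDl//.
    by rewrite lt_neqAle sqr_ge0 eq_sym sqrf_eq0 ci0.
  by apply: sumr_ge0 => i _; exact: sqr_ge0.
have h : inner (T g) g <= tau * norm2 g ^+ 2.
  apply: H => k kj; rewrite /g inner_sumr -[RHS](cf k kj).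
  by apply: eq_bigr => i _; rewrite innerZr.
rewrite -(ler_pM2r ng0); apply: le_trans h.
rewrite T_sym {2}/g inner_suml ng mulr_sumr; apply: ler_sum => i _.
rewrite innerZl -T_sym eigf fg// [leRHS]mulrCA -expr2 ler_wpM2r ?sqr_ge0//.
by case: lf => _ l_ni _ _; apply: l_ni; rewrite -ltnS.
Qed.

(** Some g in the span of e_0, ..., e_j is orthogonal to f_0, ..., f_(j-1).
    Subtracting from T its part along these f leaves the value of the form at g
    unchanged, and makes every eigenvector of positive eigenvalue orthogonal to
    them; so the eigenvector given by [qform_eigenvector] for the deflated
    matrix is one of T to which the definition of l_j applies. *)
Lemma eigenvalue_ge (H t : R) : 0 < t ->
  (forall N, \sum_(k < N) \sum_(i < N) A k i ^+ 2 <= H) ->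
  (forall g, (forall i, (j < i)%N -> inner (e i) g = 0) ->
     t * norm2 g ^+ 2 <= inner (T g) g) -> t <= l j.
Proof.
move=> t0 HA HT; have [oe _] := e_basis.
have [c [[i0 i0j ci0] cf]] := underdetermined j (fun i k => inner (e i) (f k)).
pose g0 := \sum_(i < j.+1) c i *: e i.
pose g := (norm2 g0)^-1 *: g0.
have ng0 : norm2 g0 != 0.
  rewrite -sqrf_eq0 -inner_norm2 {1}/g0 inner_suml gt_eqF//.
  under eq_bigr do rewrite innerZl inner_basis_sum// ltn_ord -expr2.
  rewrite (bigD1 (Ordinal i0j))//= ltr_pwDl//.
    by rewrite lt_neqAle sqr_ge0 eq_sym sqrf_eq0 ci0.
  by apply: sumr_ge0 => i _; exact: sqr_ge0.
have ng : norm2 g ^+ 2 = 1.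
  by rewrite -inner_norm2 innerZl innerZr inner_norm2; field.
have gj i : (j < i)%N -> inner (e i) g = 0.
  by move=> ji; rewrite innerZr inner_basis_sum// ltnS leqNgt ji mulr0.
have gf k : (k < j)%N -> inner (f k) g = 0.
  move=> kj; rewrite innerZr inner_sumr.
  under eq_bigr do rewrite innerZr innerC.
  by rewrite cf// mulr0.
have Tg : t <= inner (T g) g by have := HT g gj; rewrite ng mulr1.
(* the matrix in the basis e of the part of T along f_0, ..., f_(j-1) *)
pose D k i := \sum_(n < j) l n * inner (e k) (f n) * inner (e i) (f n).
pose A' k i := A k i - D k i.
have A'sym k i : A' k i = A' i k.
  rewrite /A' matrix_operator_sym; congr (_ - _).
  by apply: eq_bigr => n _; ring.
have [H' A'H] : exists H', forall N, \sum_(k < N) \sum_(i < N) A' k i ^+ 2 <= H'.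
  exists (2 * H + 2 * ((\sum_(n < j) l n ^+ 2) * j%:R)) => N.
  apply: (@le_trans _ _ (2 * (\sum_(k < N) \sum_(i < N) A k i ^+ 2) + 2 *
     ((\sum_(n < j) l n ^+ 2) * \sum_(k < N) \sum_(i < N) \sum_(n < j)
       (inner (e k) (f n) * inner (e i) (f n)) ^+ 2))).
    rewrite !mulr_sumr -big_split; apply: ler_sum => k _.
    rewrite !mulr_sumr -big_split; apply: ler_sum => i _ /=.
    apply: (@le_trans _ _ (2 * A k i ^+ 2 + 2 * D k i ^+ 2)).
      rewrite -subr_ge0 /A'.
      have -> : 2 * A k i ^+ 2 + 2 * D k i ^+ 2 - (A k i - D k i) ^+ 2 =
        (A k i + D k i) ^+ 2 by ring.
      exact: sqr_ge0.
    rewrite lerD2l ler_pM2l// /D.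
    by under [X in X ^+ 2]eq_bigr do rewrite -mulrA; exact: sum_CS.
  apply: lerD; first by rewrite ler_pM2l.
  rewrite ler_pM2l// ler_wpM2l ?sumr_ge0// => [n _|]; first exact: sqr_ge0.
  have -> : j%:R = \sum_(n < j) (1 : R).
    by rewrite sumr_const card_ord.
  have B1 n : \sum_(k < N) inner (e k) (f n) ^+ 2 <= 1.
    by apply: le_trans (Bessel e_basis (f n) N) _; rewrite -inner_norm2 of_ eqxx.
  have -> : \sum_(k < N) \sum_(i < N) \sum_(n < j)
       (inner (e k) (f n) * inner (e i) (f n)) ^+ 2 =
    \sum_(n < j) (\sum_(k < N) inner (e k) (f n) ^+ 2) *
                 (\sum_(i < N) inner (e i) (f n) ^+ 2).
    under eq_bigr do rewrite exchange_big/=.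
    rewrite exchange_big/=; apply: eq_bigr => n _; rewrite mulr_suml.
    apply: eq_bigr => k _; rewrite mulr_sumr.
    by apply: eq_bigr => i _; rewrite exprMn.
  apply: ler_sum => n _; rewrite -[leRHS]mulr1.
  by apply: ler_pM => //; apply: sumr_ge0 => k _; exact: sqr_ge0.
have Dform N x : qform A' N x = qform A N x -
    \sum_(n < j) l n * (\sum_(k < N) inner (e k) (f n) * x k) ^+ 2.
  have -> : \sum_(n < j) l n * (\sum_(k < N) inner (e k) (f n) * x k) ^+ 2 =
      \sum_(k < N) \sum_(i < N) D k i * x k * x i.
    under [RHS]eq_bigr do under eq_bigr do rewrite !mulr_suml.
    under [RHS]eq_bigr do rewrite exchange_big/=.
    rewrite [RHS]exchange_big/=; apply: eq_bigr => n _.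
    rewrite expr2 mulr_suml mulr_sumr; apply: eq_bigr => k _.
    by rewrite !mulr_sumr; apply: eq_bigr => i _; ring.
  rewrite /qform -sumrB; apply: eq_bigr => k _; rewrite -sumrB.
  by apply: eq_bigr => i _; rewrite /A'; ring.
have gB : l2_ball (fun k => inner (e k) g).
  by move=> N; rewrite -ng; exact: Bessel.
have gA' : qform A' N (fun k => inner (e k) g) @[N --> \oo] --> inner (T g) g.
  have : qform A N (fun k => inner (e k) g) -
    \sum_(n < j) l n * (\sum_(k < N) inner (e k) (f n) * inner (e k) g) ^+ 2
    @[N --> \oo] --> inner (T g) g - \sum_(n < j) l n * inner (f n) g ^+ 2.
    apply: cvgB; first exact: matrix_operator_form.
    apply: cvg_sum => n _; apply: cvgM; first exact: cvg_cst.
    apply: (@cvg_comp _ _ _ _ (fun y : R => y ^+ 2)); last exact: exprn_continuous.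
    exact: Parseval.
  rewrite [X in _ - X]big1 ?subr0//; last by move=> n _; rewrite gf// expr0n mulr0.
  by apply: cvg_trans; apply: near_eq_cvg; apply: nearW => N; rewrite Dform.
have gA'lim := cvg_lim (@Rhausdorff _) gA'.
have [|x [M [xB [i xi] gM xE]]] := qform_eigenvector A'sym A'H gB.
  by rewrite gA'lim (lt_le_trans t0).
have tM : t <= M by rewrite (le_trans Tg)// -gA'lim.
have M0 : 0 < M := lt_le_trans t0 tM.
have [u uE] := Riesz_Fischer oe xB.
have ux k : inner (e k) u = x k.
  have := L2_cvg_inner uE (e k); rewrite innerC => h.
  apply: (cvg_unique (@Rhausdorff R) h).
  apply: cvg_near_cst; exists k.+1 => // N /= kN.
  by rewrite innerC inner_basis_sum// kN.
have Tu : T u = M *: u + \sum_(n < j) (l n * inner (f n) u) *: f n %[ae mu].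
  apply: (ae_eq_of_coef e_basis) => k.
  rewrite innerDr innerZr ux inner_sumr.
  under [X in _ = _ + X]eq_bigr do rewrite innerZr.
  have h := matrix_operator_coef u k.
  apply: (cvg_unique (@Rhausdorff R) h) => {h}.
  have : \sum_(i < N) A' k i * x i +
      \sum_(n < j) l n * (\sum_(i < N) inner (e i) (f n) * inner (e i) u)
        * inner (e k) (f n) @[N --> \oo] -->
      M * x k + \sum_(n < j) l n * inner (f n) u * inner (e k) (f n).
    apply: cvgD; first exact: xE.
    apply: cvg_sum => n _; apply: cvgM; last exact: cvg_cst.
    by apply: cvgM; [exact: cvg_cst|exact: Parseval].
  apply: cvg_trans; apply: near_eq_cvg; apply: nearW => N.
  have -> : \sum_(n < j) l n * (\sum_(i < N) inner (e i) (f n) * inner (e i) u)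
      * inner (e k) (f n) = \sum_(i < N) D k i * x i.
    under [RHS]eq_bigr do rewrite mulr_suml.
    rewrite [RHS]exchange_big/=; apply: eq_bigr => n _.
    by rewrite mulr_sumr mulr_suml; apply: eq_bigr => i' _; rewrite ux; ring.
  rewrite -big_split; apply: eq_bigr => i' _ /=.
  by rewrite ux /A' matrix_operator_sym; ring.
have uf n : (n < j)%N -> inner (f n) u = 0.
  move=> nj; have := inner_ae_eq (f n) Tu.
  rewrite T_sym innerC eigf innerDl innerZl inner_suml.
  under [X in _ + X]eq_bigr do rewrite innerZl.
  rewrite (bigD1 (Ordinal nj))//= of_ eqxx mulr1 big1 ?addr0; last first.
    by move=> m; rewrite -val_eqE/= of_ => /negbTE ->; rewrite mulr0.
  move=> /eqP; rewrite -subr_eq subrr eq_sym mulf_eq0 gt_eqF//= => /eqP.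
  by rewrite innerC.
have {}Tu : T u = M *: u %[ae mu].
  by move: Tu; rewrite big1 ?addr0// => n _; rewrite uf// mulr0 scale0r.
apply: (le_trans tM); case: lf => _ _ _ max; apply: (max j M u) => //.
apply/negP => /eqP u0; move/negP: xi; apply; rewrite -ux.
have := inner_CS (e i) u; rewrite u0 mulr0 normr_le0; exact.
Qed.

End eigenvalue_bounds.
End matrix_operator.
Arguments matrix_operator_coef {d X R mu e A T} _ _ f k.
Arguments matrix_operator_form {d X R mu e A T} _ f.

(** * A relative Weyl inequality *)

Section weyl.
Context d (X : measurableType d) (R : realType).
Variable mu : {measure set X -> \bar R}.
Variables (e f : nat -> L2 mu) (T : L2 mu -> L2 mu).
Variables (lam l G : nat -> R) (A : nat -> nat -> R) (j : nat) (y om Gmax : R).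
Hypothesis e_basis : orthonormal_basis e.
Hypothesis TE : forall f, L2_cvg (fun N => \sum_(i < N) \sum_(l < N)
  ((lam i * (i == l :> nat)%:R + A i l) * inner (e i) f) *: e l) (T f).
Hypothesis T_sym : forall f g, inner (T f) g = inner f (T g).
Hypothesis lf : ordered_eigensystem T l f.
Hypothesis lam_ni : nonincreasing_seq lam.
Hypothesis lam_ge0 : forall k, 0 <= lam k.
Hypothesis y_gt0 : 0 < y.
Hypothesis y_lt : y < lam j.
Hypothesis GjE : G j = y.
Hypothesis GE : forall k, k != j -> G k = `|lam j - lam k|.
Hypothesis G_gt0 : forall k, 0 < G k.
Hypothesis G_le : forall k, G k <= Gmax.
Hypothesis lam2_le : exists B : R, forall N, \sum_(k < N) lam k ^+ 2 <= B.
Hypothesis om_ge0 : 0 <= om.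
Hypothesis om_le1 : om <= 1.
Hypothesis A_om : forall N,
  \sum_(k < N) \sum_(l < N) A k l ^+ 2 / (G k * G l) <= om ^+ 2.

Let form_le (x : nat -> R) N :
  `|\sum_(k < N) \sum_(i < N) A k i * x k * x i| <=
  om * \sum_(k < N) G k * x k ^+ 2.
Proof.
have S0 : 0 <= \sum_(k < N) G k * x k ^+ 2.
  by apply: sumr_ge0 => k _; rewrite mulr_ge0 ?sqr_ge0// ltW.
rewrite -ler_sqr ?nnegrE ?mulr_ge0// real_normK ?num_real//.
pose s k := Num.sqrt (G k).
have s0 k : s k != 0 by rewrite gt_eqF// sqrtr_gt0.
have sE k : s k ^+ 2 = G k by rewrite sqr_sqrtr// ltW.
have -> : \sum_(k < N) \sum_(i < N) A k i * x k * x i =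
    \sum_(k < N) \sum_(i < N) (A k i / (s k * s i)) * ((s k * x k) * (s i * x i)).
  apply: eq_bigr => k _; apply: eq_bigr => i _; field.
  by rewrite !s0.
rewrite pair_bigA/=; apply: (le_trans (sum_CS _ _ _ _)).
rewrite exprMn; apply: ler_pM.
- by apply: sumr_ge0 => i _; exact: sqr_ge0.
- by apply: sumr_ge0 => i _; exact: sqr_ge0.
- apply: le_trans (A_om N); rewrite pair_bigA/=; apply: ler_sum => i _.
  by rewrite expr_div_n exprMn !sE.
- rewrite -(pair_bigA _ (fun k i : 'I_N => (s k * x k * (s i * x i)) ^+ 2))/=.
  rewrite le_eqVlt; apply/orP; left; apply/eqP.
  rewrite expr2 mulr_suml; apply: eq_bigr => k _; rewrite mulr_sumr.
  by apply: eq_bigr => i _; rewrite !exprMn !sE.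
Qed.

Let formE x N : qform (fun i k => lam i * (i == k :> nat)%:R + A i k) N x =
  \sum_(k < N) lam k * x k ^+ 2 + \sum_(k < N) \sum_(i < N) A k i * x k * x i.
Proof.
rewrite /qform -big_split; apply: eq_bigr => k _ /=.
rewrite (eq_bigr (fun i : 'I_N => lam k * (k == i :> nat)%:R * x k * x i +
  A k i * x k * x i)); last by move=> i _; ring.
rewrite big_split; congr (_ + _) => /=.
rewrite (bigD1 k)//= eqxx big1 ?addr0; first by rewrite mulr1; ring.
by move=> i; rewrite -val_eqE/= eq_sym => /negbTE ->; rewrite mulr0 !mul0r.
Qed.

Lemma weyl_upper : l j <= lam j + y.
Proof.
apply: (eigenvalue_le (e := e) T_sym lf) => g gj.
have c := matrix_operator_form
  (A := fun i k => lam i * (i == k :> nat)%:R + A i k) TE g.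
rewrite -(cvg_lim (@Rhausdorff _) c); apply: limr_le.
  by apply/cvg_ex; eexists; exact: c.
apply: nearW => N; rewrite formE.
have lamy0 : 0 <= lam j + y by rewrite addr_ge0 ?lam_ge0// ltW.
apply: le_trans (ler_wpM2l lamy0 (Bessel e_basis g N)).
apply: (@le_trans _ _ (\sum_(k < N) lam k * inner (e k) g ^+ 2 +
    om * \sum_(k < N) G k * inner (e k) g ^+ 2)).
  rewrite lerD2l; apply: le_trans (ler_norm _) _.
  exact: (form_le (fun k => inner (e k) g)).
rewrite !mulr_sumr -big_split; apply: ler_sum => k _ /=.
case: (ltnP k j) => kj; first by rewrite gj// expr0n !mulr0 addr0.
rewrite mulrA -mulrDl ler_wpM2r ?sqr_ge0//.
have [->|kneq] := eqVneq (k : nat) j.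
  by rewrite GjE lerD2l ler_piMl// ltW.
have := lam_ni kj; rewrite GE// => lkj; rewrite ger0_norm ?subr_ge0//.
have : om * (lam j - lam k) <= lam j - lam k by rewrite ler_piMl// subr_ge0.
by have := ltW y_gt0; lra.
Qed.

Let hs : exists H : R, forall N, \sum_(k < N) \sum_(i < N)
  (lam k * (k == i :> nat)%:R + A k i) ^+ 2 <= H.
Proof.
have [B lB] := lam2_le; exists (2 * B + 2 * (Gmax ^+ 2 * om ^+ 2)) => N.
apply: (@le_trans _ _ (2 * (\sum_(k < N) lam k ^+ 2) +
   2 * (Gmax ^+ 2 * \sum_(k < N) \sum_(i < N) A k i ^+ 2 / (G k * G i)))).
  have -> : \sum_(k < N) lam k ^+ 2 =
      \sum_(k < N) \sum_(i < N) (lam k * (k == i :> nat)%:R) ^+ 2.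
    apply: eq_bigr => k _; rewrite (bigD1 k)//= eqxx mulr1 big1 ?addr0//.
    by move=> i; rewrite -val_eqE/= eq_sym => /negbTE ->; rewrite mulr0 expr0n.
  rewrite !mulr_sumr -big_split; apply: ler_sum => k _.
  rewrite !mulr_sumr -big_split; apply: ler_sum => i _ /=.
  move: (lam k * _) => a.
  apply: (@le_trans _ _ (2 * a ^+ 2 + 2 * A k i ^+ 2)).
    rewrite -subr_ge0.
    have -> : 2 * a ^+ 2 + 2 * A k i ^+ 2 - (a + A k i) ^+ 2 = (a - A k i) ^+ 2.
      by ring.
    exact: sqr_ge0.
  rewrite lerD2l ler_pM2l// mulrA ler_pdivlMr ?mulr_gt0//.
  rewrite mulrC ler_wpM2r ?sqr_ge0// expr2.
  by apply: ler_pM; rewrite ?(ltW (G_gt0 _)).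
apply: lerD; first by rewrite ler_pM2l.
by rewrite ler_pM2l// ler_wpM2l ?sqr_ge0.
Qed.

Lemma weyl_lower : lam j - y <= l j.
Proof.
have [H HH] := hs.
have t0 : 0 < lam j - y by rewrite subr_gt0.
apply: (eigenvalue_ge (A := fun i k => lam i * (i == k :> nat)%:R + A i k)
  e_basis TE T_sym lf t0 HH) => g gj.
have c := matrix_operator_form
  (A := fun i k => lam i * (i == k :> nat)%:R + A i k) TE g.
have c2 : (lam j - y) * \sum_(k < N) inner (e k) g ^+ 2 @[N --> \oo] -->
    (lam j - y) * norm2 g ^+ 2.
  by apply: cvgM; [exact: cvg_cst|exact: Parseval_sqr].
rewrite -(cvg_lim (@Rhausdorff _) c) -(cvg_lim (@Rhausdorff _) c2).
apply: ler_lim; [by apply/cvg_ex; eexists; exact: c2|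
  by apply/cvg_ex; eexists; exact: c|].
apply: nearW => N; rewrite formE.
apply: (@le_trans _ _ (\sum_(k < N) lam k * inner (e k) g ^+ 2 -
    om * \sum_(k < N) G k * inner (e k) g ^+ 2)); last first.
  rewrite lerD2l lerNl; apply: le_trans (ler_norm _) _; rewrite normrN.
  exact: (form_le (fun k => inner (e k) g)).
rewrite !mulr_sumr -sumrB; apply: ler_sum => k _ /=.
case: (ltnP j k) => kj; first by rewrite gj// expr0n !mulr0 subr0.
rewrite mulrA -mulrBl ler_wpM2r ?sqr_ge0//.
have [->|kneq] := eqVneq (k : nat) j.
  by rewrite GjE lerD2l lerN2 ler_piMl// ltW.
have := lam_ni kj; rewrite GE// => lkj; rewrite ler0_norm ?subr_le0// opprB.
have : om * (lam k - lam j) <= lam k - lam j by rewrite ler_piMl// subr_ge0.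
by have := ltW y_gt0; lra.
Qed.

End weyl.

(** * Moments *)

Section moments.
Import HBNNSimple.
Context d (Om : measurableType d) (R : realType).
Variable P : {measure set Om -> \bar R}.

(** f need not be measurable: the integral of a nonnegative function is the
    supremum over the simple functions below it. *)
Lemma ge0_le_integral_dominated (f g : Om -> \bar R) :
  (forall w, (0 <= f w)%E) -> (forall w, (0 <= g w)%E) -> measurable_fun setT g ->
  {ae P, forall w, (f w <= g w)%E} -> (\int[P]_w f w <= \int[P]_w g w)%E.
Proof.
move=> f0 g0 mg fg; rewrite ge0_integralTE//.
apply: ge_ereal_sup => _ [h hf <-]; rewrite -integralT_nnsfun.
apply: ae_ge0_le_integral => //.
- by move=> w _; rewrite lee_fin; exact: fun_ge0.
- exact/measurable_EFinP.
- by apply: filterS fg => w fgw _; apply: le_trans fgw; exact: hf.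
Qed.

Lemma Lnorm_le_integral (p K : R) (f : Om -> R) : 0 < p -> 0 <= K ->
  (\int[P]_w (`|f w| `^ p)%:E <= K%:E)%E ->
  ('N[P]_p%:E[EFin \o f] <= (K `^ p^-1)%:E)%E.
Proof.
move=> p0 K0 fK; rewrite unlock -poweR_EFin.
apply: gt0_ler_poweR => //; rewrite ?invr_ge0 ?(ltW p0)//.
- by rewrite in_itv/= leey andbT; apply: integral_ge0.
- by rewrite in_itv/= leey andbT lee_fin.
Qed.

Lemma integral_le_Lnorm (p b : R) (f : Om -> R) : 0 < p -> 0 <= b ->
  ('N[P]_p%:E[EFin \o f] <= b%:E)%E ->
  (\int[P]_w (`|f w| `^ p)%:E <= (b `^ p)%:E)%E.
Proof.
move=> p0 b0 fb; rewrite -poweR_EFin.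
rewrite (_ : (\int[P]_w (`|f w| `^ p)%:E = 'N[P]_p%:E[EFin \o f] `^ p)%E).
  apply: gt0_ler_poweR; rewrite ?in_itv/= ?leey ?andbT ?Lnorm_ge0 ?lee_fin//.
  exact: ltW.
by rewrite poweR_Lnorm ?gt_eqF.
Qed.

Lemma Lnorm_sum_le (I : Type) (s : seq I) (r : R) (f : I -> Om -> R) (b : I -> R) :
  1 <= r -> (forall i, measurable_fun setT (f i)) ->
  (forall i, ('N[P]_r%:E[EFin \o f i] <= (b i)%:E)%E) ->
  ('N[P]_r%:E[EFin \o (fun w => (\sum_(i <- s) f i w)%R)] <= (\sum_(i <- s) b i)%:E)%E.
Proof.
move=> r1 mf fb; elim: s => [|i s IH].
  rewrite big_nil (_ : _ \o _ = cst 0%E) ?Lnorm0//; last first.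
    by apply/funext => w /=; rewrite big_nil.
  by rewrite gt_eqF// lte_fin (lt_le_trans _ r1).
rewrite big_cons EFinD (_ : _ \o _ = EFin \o (f i \+ (fun w => \sum_(i <- s) f i w))).
  apply: le_trans (minkowski_EFin _ _ _ r1) _ => //.
    exact: measurable_sum.
  exact: leeD.
by apply/funext => w /=; rewrite big_cons.
Qed.

(** Phi is the monotone limit of the r-th powers of the partial sums.  Stating
    the bound for the powers, with Phi possibly infinite, avoids showing that
    the double series converges. *)
Lemma weighted_square_moment (r kappa a : R) (alpha : nat -> nat -> R)
    (zeta : nat -> nat -> Om -> R) :
  1 <= r -> 0 <= kappa -> 0 <= a -> (forall k l, 0 <= alpha k l) ->
  (forall k l, measurable_fun setT (zeta k l)) ->
  (forall k l, ('N[P]_(2 * r)%:E[EFin \o zeta k l] <= kappa%:E)%E) ->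
  (forall N, \sum_(k < N) \sum_(l < N) alpha k l <= a) ->
  exists Phi : Om -> \bar R, [/\ measurable_fun setT Phi,
    forall w, (0 <= Phi w)%E,
    (\int[P]_w Phi w <= ((a * kappa ^+ 2) `^ r)%:E)%E &
    forall w N, (((\sum_(k < N) \sum_(l < N) alpha k l * zeta k l w ^+ 2) `^ r)%:E
      <= Phi w)%E].
Proof.
move=> r1 k0 a0 al0 mz zk ala.
have r0 : 0 < r := lt_le_trans ltr01 r1.
pose S N w := \sum_(k < N) \sum_(l < N) alpha k l * zeta k l w ^+ 2.
have S0 N w : 0 <= S N w.
  by apply: sumr_ge0 => k _; apply: sumr_ge0 => l _; rewrite mulr_ge0 ?sqr_ge0.
have mt k l : measurable_fun setT (fun w => alpha k l * zeta k l w ^+ 2).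
  by apply: measurable_funM => //; exact: measurable_funX.
have mS N : measurable_fun setT (S N).
  by apply: measurable_sum => k; apply: measurable_sum => l.
have Snd w : nondecreasing_seq (S ^~ w).
  move=> M N MN; rewrite /S.
  apply: (@le_trans _ _ (\sum_(k < M) \sum_(l < N) alpha k l * zeta k l w ^+ 2)).
    apply: ler_sum => k _.
    apply: (sum_ord_nondecreasing
      (a := fun l => alpha k l * zeta k l w ^+ 2)) => // l.
    by rewrite mulr_ge0 ?sqr_ge0.
  apply: (sum_ord_nondecreasing
    (a := fun k => \sum_(l < N) alpha k l * zeta k l w ^+ 2)) => // k.
  by apply: sumr_ge0 => l _; rewrite mulr_ge0 ?sqr_ge0.
have mSr N : measurable_fun setT (fun w => (S N w `^ r)%:E).
  by apply/measurable_EFinP; apply: (measurableT_comp (measurable_powR _)).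
have Srnd w : {homo (fun N => (S N w `^ r)%:E) : m n / (m <= n)%N >-> (m <= n)%E}.
  move=> M N MN; rewrite lee_fin; apply: ge0_ler_powR; rewrite ?nnegrE//.
    exact: ltW.
  exact: Snd.
exists (fun w => limn (fun N => (S N w `^ r)%:E)); split.
- apply: (emeasurable_fun_cvg (fun N w => (S N w `^ r)%:E)) => // w _.
  exact: ereal_nondecreasing_is_cvgn.
- move=> w; apply: lime_ge; first exact: ereal_nondecreasing_is_cvgn.
  by apply: nearW => N; rewrite lee_fin powR_ge0.
- rewrite monotone_convergence//; last by move=> N w _; rewrite lee_fin powR_ge0.
  apply: lime_le.
    apply: ereal_nondecreasing_is_cvgn => M N MN; apply: ge0_le_integral => //.
    + by move=> w _; rewrite lee_fin powR_ge0.
    + by move=> w _; exact: Srnd.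
  apply: nearW => N.
  have -> : (\int[P]_w (S N w `^ r)%:E = \int[P]_w (`|S N w| `^ r)%:E)%E.
    by apply: eq_integral => w _; rewrite ger0_norm.
  apply: integral_le_Lnorm => //; first by rewrite mulr_ge0 ?sqr_ge0.
  have tk k l : ('N[P]_r%:E[EFin \o (fun w => (alpha k l * zeta k l w ^+ 2)%R)] <=
      (alpha k l * kappa ^+ 2)%:E)%E.
    have -> : alpha k l * kappa ^+ 2 = ((alpha k l * kappa ^+ 2) `^ r) `^ r^-1.
      by rewrite -powRrM mulfV ?gt_eqF// powRr1// mulr_ge0 ?sqr_ge0.
    apply: Lnorm_le_integral => //; first exact: powR_ge0.
    have -> : (\int[P]_w (`|alpha k l * zeta k l w ^+ 2| `^ r)%:E =
        \int[P]_w ((alpha k l `^ r)%:E * (`|zeta k l w| `^ (2 * r))%:E))%E.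
      apply: eq_integral => w _; rewrite -EFinM ger0_norm; last first.
        by apply: mulr_ge0 => //; exact: sqr_ge0.
      rewrite powRM ?sqr_ge0//; congr (_ * _)%:E.
      by rewrite powRrM (powR_mulrn 2 (normr_ge0 _)) real_normK ?num_real.
    rewrite ge0_integralZl_EFin ?powR_ge0//; last first.
      apply/measurable_EFinP; apply: (measurableT_comp (measurable_powR _)) => //.
      exact: measurableT_comp.
    rewrite powRM ?sqr_ge0// EFinM lee_wpmul2l ?lee_fin ?powR_ge0//.
    apply: le_trans (integral_le_Lnorm _ k0 (zk k l)) _; first by rewrite mulr_gt0.
    by rewrite lee_fin powRrM powR_mulrn.
  apply: (@le_trans _ _ (\sum_(k < N) \sum_(l < N) alpha k l * kappa ^+ 2)%:E).
    apply: Lnorm_sum_le => // [k|k]; first exact: measurable_sum.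
    exact: Lnorm_sum_le.
  rewrite lee_fin; under eq_bigr do rewrite -mulr_suml.
  by rewrite -mulr_suml ler_wpM2r ?sqr_ge0.
- move=> w N; rewrite (cvg_lim _ (ereal_nondecreasing_cvgn (Srnd w)))//.
  by apply: ereal_sup_ubound; exists N.
Qed.

Lemma Lnorm_bigmax_le (J : nat) (p K b : R) (E : nat -> Om -> R)
    (Psi : nat -> Om -> \bar R) :
  0 < p -> 0 <= K -> 0 <= b ->
  (forall j w, 0 <= E j w) ->
  (forall j, (j < J)%N -> measurable_fun setT (Psi j)) ->
  (forall j, (j < J)%N -> forall w, (0 <= Psi j w)%E) ->
  (forall j, (j < J)%N -> (\int[P]_w Psi j w <= K%:E)%E) ->
  (forall j, (j < J)%N ->
     {ae P, forall w, ((E j w `^ p)%:E <= (b `^ p)%:E * Psi j w)%E}) ->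
  ('N[P]_p%:E[EFin \o (fun w => (\big[Num.max/0]_(j < J) E j w)%R)]
    <= (K `^ p^-1 * J%:R `^ p^-1 * b)%:E)%E.
Proof.
move=> p0 K0 b0 E0 mPsi Psi0 PsiK EPsi.
have -> : K `^ p^-1 * J%:R `^ p^-1 * b = (b `^ p * (J%:R * K)) `^ p^-1.
  rewrite powRM ?powR_ge0 ?mulr_ge0// -powRrM mulfV ?gt_eqF// powRr1//.
  by rewrite powRM//; ring.
apply: Lnorm_le_integral => //; first by rewrite !mulr_ge0 ?powR_ge0.
apply: (@le_trans _ _ (\int[P]_w ((b `^ p)%:E * \sum_(j < J) Psi j w))%E).
  apply: ge0_le_integral_dominated.
  - by move=> w; rewrite lee_fin powR_ge0.
  - by move=> w; rewrite mule_ge0 ?lee_fin ?powR_ge0// sume_ge0// => j _; exact: Psi0.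
  - apply: emeasurable_funM => //; apply: emeasurable_sum => j; exact: mPsi.
  - have /ae_foralln H : forall j, {ae P, forall w, (j < J)%N ->
        ((E j w `^ p)%:E <= (b `^ p)%:E * Psi j w)%E}.
      move=> j; have [jJ|jJ] := ltnP j J.
        by apply: filterS (EPsi j jJ).
      by apply: nearW.
    apply: filterS H => w H.
    have B0 : 0 <= \big[Num.max/0]_(j < J) E j w by exact: bigmax_ge_id.
    rewrite ger0_norm//.
    rewrite ge0_sume_distrr; last by move=> j _; exact: Psi0.
    apply: (@le_trans _ _ (\sum_(j < J) (E j w `^ p)%:E)%E); last first.
      by apply: lee_sum => j _; exact: H.
    rewrite sumEFin lee_fin.
    have : \big[Num.max/0]_(j < J) E j w = 0 \/
        exists j : 'I_J, \big[Num.max/0]_(j < J) E j w = E j w.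
      elim/big_ind: _ => [|x y hx hy|j _]; [by left| |by right; exists j].
      by rewrite /Num.max; case: ifP.
    case=> [->|[j ->]].
      by rewrite powR0 ?gt_eqF// sumr_ge0// => j _; exact: powR_ge0.
    by rewrite (bigD1 j)//= lerDl sumr_ge0// => i _; exact: powR_ge0.
rewrite ge0_integralZl_EFin ?powR_ge0//; last 2 first.
- by move=> w _; rewrite sume_ge0// => j _; exact: Psi0.
- by apply: emeasurable_sum => j; exact: mPsi.
rewrite EFinM lee_wpmul2l ?lee_fin ?powR_ge0//.
rewrite ge0_integral_sum//; [|by move=> j; exact: mPsi|
  by move=> j w _; exact: Psi0].
apply: (@le_trans _ _ (\sum_(j < J) K%:E)%E).
  by apply: lee_sum => j _; exact: PsiK.
by rewrite sumEFin lee_fin sumr_const card_ord mulr_natl.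
Qed.

End moments.

(** * The expansion for a realization of the model *)

Section pathwise.
Context d (X : measurableType d) (R : realType)
  (mu : {measure set X -> \bar R}) d' (Om : measurableType d')
  (P : probability Om R) (M : model mu P).

Let e := eigfun M.
Let e_basis : orthonormal_basis e. Proof. exact: eigfun_basis. Qed.
Let oe : orthonormal_system e. Proof. by case: e_basis. Qed.

Lemma opD_entry i k : inner (e k) (opD M (e i)) = lam M i * (i == k)%:R.
Proof.
have := L2_cvg_inner (opDE M (e i)) (e k); rewrite innerC => h.
apply: (cvg_unique (@Rhausdorff R) h); apply: cvg_near_cst; exists k.+1 => // N /= kN.
rewrite innerC (inner_basis_sum (fun j => lam M j * inner (e j) (e i)))// kN.
by rewrite oe eq_sym; case: eqVneq => [->|]; rewrite ?mulr0.
Qed.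

Lemma mean_entry i k :
  Num.sqrt (lamt M i * lamt M k) * fine 'E_P[etaD M i k] = lam M i * (i == k)%:R.
Proof.
rewrite -opD_entry.
exact: (matrix_operator_entry
  (A := fun i k => Num.sqrt (lamt M i * lamt M k) * fine 'E_P[etaD M i k])
  e_basis (opD_meanE M)).
Qed.

(** Up to the factor sqrt (lamt_i lamt_k), the entry of the perturbation. *)
Definition noise i k (w : Om) : R := centered P (etaD M i k) w - etaR M i k w.

Definition typical (w : Om) := [/\
  forall f, L2_cvg (fun N => \sum_(i < N) \sum_(j < N)
        (Num.sqrt (lamt M i * lamt M j) * (etaD M i j w - etaR M i j w)
           * inner (eigfun M i) f) *: eigfun M j)
      (opDhat M w f),
  forall f g, inner (opDhat M w f) g = inner f (opDhat M w g),
  ordered_eigensystem (opDhat M w) (fun j => lamhat M j w) (eigfunhat M ^~ w) &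
  forall j, 0 <= inner (eigfunhat M j w) (eigfun M j)].

Lemma ae_typical : {ae P, forall w, typical w}.
Proof.
have FP : Filter (nbhs (almost_everywhere P)) by exact: ae_filter_ringOfSetsType.
have S := @filterS _ (nbhs (almost_everywhere P)) FP.
have I := @filterI _ (nbhs (almost_everywhere P)) FP.
have h := I _ _ (I _ _ (opDhatE M) (opDhat_selfadjoint M))
  (I _ _ (eigfunhatP M) (eigfunhat_sign M)).
by apply: (S _ _ _ h) => w [[h1 h2] [h3 h4]]; split.
Qed.

Variable w : Om.
Hypothesis w_typ : typical w.

Let TE := let: And4 h _ _ _ := w_typ in h.
Let T_sym := let: And4 _ h _ _ := w_typ in h.
Let T_eig := let: And4 _ _ h _ := w_typ in h.
Let T_sign := let: And4 _ _ _ h := w_typ in h.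

Lemma pertE k j : pert M k j w = Num.sqrt (lamt M k * lamt M j) * noise k j w.
Proof.
rewrite /pert innerBl innerC -(matrix_operator_entry
  (A := fun i k => Num.sqrt (lamt M i * lamt M k) * (etaD M i k w - etaR M i k w))
  e_basis TE) innerC opD_entry -mean_entry -mulrBr /noise /centered.
by congr (_ * _); ring.
Qed.

Let A k j := pert M k j w.

Let T_pert f : L2_cvg (fun N => \sum_(i < N) \sum_(l < N)
  ((lam M i * (i == l :> nat)%:R + A i l) * inner (e i) f) *: e l)
  (opDhat M w f).
Proof.
have -> : (fun N => \sum_(i < N) \sum_(l < N)
    ((lam M i * (i == l :> nat)%:R + A i l) * inner (e i) f) *: e l) =
  (fun N => \sum_(i < N) \sum_(j < N)
        (Num.sqrt (lamt M i * lamt M j) * (etaD M i j w - etaR M i j w)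
           * inner (eigfun M i) f) *: eigfun M j).
  apply/funext => N; apply: eq_bigr => i _; apply: eq_bigr => l _.
  congr ((_ * _) *: _); rewrite /A pertE -mean_entry /noise /centered; ring.
exact: TE.
Qed.

Let A_sym k l : A k l = A l k.
Proof.
have := matrix_operator_sym
  (A := fun i l => lam M i * (i == l :> nat)%:R + A i l) e_basis T_pert T_sym k l.
rewrite [l == k]eq_sym; case: eqVneq => [->//|_].
by rewrite !mulr0 !add0r.
Qed.

Variable j : nat.
Let x k := inner (e k) (eigfunhat M j w).
Let F k := A k j / (lam M j - lam M k).
Let diff := eigfunhat M j w - e j.
Let remainder := diff + (norm2 diff ^+ 2 / 2) *: e j - first_order M j w.

Let x_unit : \sum_(k < N) x k ^+ 2 @[N --> \oo] --> (1 : R).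
Proof.
have := Parseval_sqr e_basis (eigfunhat M j w).
by case: T_eig => of_ _ _ _; rewrite -inner_norm2 of_ eqxx.
Qed.

Let xj_ge0 : 0 <= x j.
Proof. by rewrite /x innerC; exact: T_sign. Qed.

Lemma diff_sqr : norm2 diff ^+ 2 = 2 * (1 - x j).
Proof.
have hj : inner (eigfunhat M j w) (eigfunhat M j w) = 1.
  by case: T_eig => oh _ _ _; rewrite oh eqxx.
rewrite -inner_norm2 innerBl !innerBr oe eqxx hj (innerC (eigfunhat M j w) (e j)).
by rewrite -/(x j) /=; ring.
Qed.

Section first_order_bounded.
Variable ph : R.
Hypothesis F_le : forall N, \sum_(k < N | k != j :> nat) F k ^+ 2 <= ph ^+ 2.

(** The term |ehat_j - e_j|^2 / 2 is what makes coordinate j of the remainder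
    vanish. *)
Lemma remainder_cvg :
  \sum_(k < N | k != j :> nat) (x k - F k) ^+ 2 @[N --> \oo] --> norm2 remainder ^+ 2.
Proof.
have FO k : inner (e k) (first_order M j w) = if k != j then F k else 0.
  rewrite /first_order.
  under [X in L2_lim X]eq_fun do rewrite big_mkcond/=.
  rewrite -(L2_limP (c := fun k => if k != j then F k else 0) (B := ph ^+ 2) oe).
    congr (inner _ (L2_lim _)); apply/funext => N; apply: eq_bigr => i _.
    by case: ifP => _ //; rewrite scale0r.
  move=> N; apply: le_trans (F_le N); rewrite [leRHS]big_mkcond/=.
  by apply: ler_sum => i _; case: ifP => _ //; rewrite expr0n.
have RE k : inner (e k) remainder = if k != j then x k - F k else 0.
  rewrite innerBr FO innerDr innerZr diff_sqr innerBr oe -/(x k).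
  case: eqVneq => [->|kj] /=; last by rewrite mulr0 subr0 addr0.
  by field.
have := Parseval_sqr e_basis remainder; apply: cvg_trans.
apply: near_eq_cvg; apply: nearW => N; rewrite [RHS]big_mkcond/=.
by apply: eq_bigr => k _; rewrite RE; case: ifP => _ //; rewrite expr0n.
Qed.

Lemma remainder_le B : (forall N, \sum_(k < N | k != j :> nat) (x k - F k) ^+ 2 <= B) ->
  norm2 remainder ^+ 2 <= B.
Proof.
move=> xB; have c := remainder_cvg.
rewrite -(cvg_lim (@Rhausdorff _) c); apply: limr_le; last exact: nearW.
by apply/cvg_ex; eexists; exact: c.
Qed.

Let F_cvg : cvgn (fun N => \sum_(k < N | k != j :> nat) F k ^+ 2).
Proof.
apply: nondecreasing_is_cvgn.
  move=> m n mn.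
  by apply: (@ler_sum_sub R (fun k => k != j) (fun k => k != j) m n
    (fun k => F k ^+ 2)) => // k; exact: sqr_ge0.
by exists (ph ^+ 2) => _ [N _ <-].
Qed.

Lemma first_order_series :
  fine (\sum_(0 <= k <oo | k != j)
     ((pert M k j w) ^+ 2 / (lam M j - lam M k) ^+ 2)%:E)%E =
  limn (fun N => \sum_(k < N | k != j :> nat) F k ^+ 2).
Proof.
rewrite (_ : (fun n => (\sum_(0 <= k < n | k != j)
     ((pert M k j w) ^+ 2 / (lam M j - lam M k) ^+ 2)%:E)%E) =
   EFin \o (fun N => \sum_(k < N | k != j :> nat) F k ^+ 2)); last first.
  apply/funext => N /=; rewrite big_mkord sumEFin; congr EFin.
  by apply: eq_bigr => k _; rewrite expr_div_n.
by rewrite EFin_lim.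
Qed.

Lemma remainder_crude : norm2 remainder ^+ 2 <= 2 + 2 * ph ^+ 2.
Proof.
apply: remainder_le => N.
apply: (@le_trans _ _ (2 * (\sum_(k < N) x k ^+ 2) +
   2 * (\sum_(k < N | k != j :> nat) F k ^+ 2))).
  rewrite big_mkcond [X in _ + 2 * X]big_mkcond/= !mulr_sumr -big_split/=.
  apply: ler_sum => k _; case: ifP => _; last first.
    by rewrite mulr0 addr0 mulr_ge0 ?sqr_ge0.
  rewrite -subr_ge0.
  have -> : 2 * x k ^+ 2 + 2 * F k ^+ 2 - (x k - F k) ^+ 2 = (x k + F k) ^+ 2 by ring.
  exact: sqr_ge0.
apply: lerD; last by rewrite ler_pM2l//; exact: F_le.
rewrite -[leRHS]mulr1 ler_pM2l//.
rewrite -(cvg_lim (@Rhausdorff _) x_unit).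
apply: (nondecreasing_cvgn_le (sum_ord_nondecreasing (fun k => sqr_ge0 (x k)))).
by apply/cvg_ex; eexists; exact: x_unit.
Qed.

Lemma norm_crude :
  `|norm2 diff ^+ 2 - limn (fun N => \sum_(k < N | k != j :> nat) F k ^+ 2)| <=
  2 + ph ^+ 2.
Proof.
have l0 : 0 <= limn (fun N => \sum_(k < N | k != j :> nat) F k ^+ 2).
  apply: limr_ge => //; apply: nearW => N; apply: sumr_ge0 => k _; exact: sqr_ge0.
have l1 : limn (fun N => \sum_(k < N | k != j :> nat) F k ^+ 2) <= ph ^+ 2.
  by apply: limr_le => //; exact: nearW.
have := sqr_ge0 (norm2 diff); rewrite diff_sqr ler_norml => n0.
by apply/andP; split; have := xj_ge0; have := sqr_ge0 ph; lra.
Qed.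

End first_order_bounded.

Section weights.
Variables (G : nat -> R) (y om ph Gmax : R).
Hypothesis y_gt0 : 0 < y.
Hypothesis y_lt : y < lam M j.
Hypothesis GjE : G j = y.
Hypothesis GE : forall k, k != j -> G k = `|lam M j - lam M k|.
Hypothesis G_ge : forall k, k != j -> 4 * y <= G k.
Hypothesis G_le : forall k, G k <= Gmax.
Hypothesis lam2_le : exists B : R, forall N, \sum_(k < N) lam M k ^+ 2 <= B.
Hypothesis om_ge0 : 0 <= om.
Hypothesis ph_ge0 : 0 <= ph.
Hypothesis A_om : forall N,
  \sum_(k < N) \sum_(l < N) A k l ^+ 2 / (G k * G l) <= om ^+ 2.
Hypothesis A_ph : forall N,
  \sum_(k < N | k != j :> nat) \sum_(l < N) A k l ^+ 2 * y / (G k ^+ 2 * G l)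
  <= ph ^+ 2.

Lemma first_order_le N : \sum_(k < N | k != j :> nat) F k ^+ 2 <= ph ^+ 2.
Proof. exact: (first_order_sqr_le y_gt0 GjE GE G_ge A_ph). Qed.

Section good.
Hypothesis om_le : om <= 8^-1.

Let ev_close : `|lamhat M j w - lam M j| <= y.
Proof.
have G_gt0 k : 0 < G k.
  have [->|kj] := eqVneq k j; first by rewrite GjE.
  by rewrite (lt_le_trans _ (G_ge kj))// mulr_gt0.
have om1 : om <= 1 by apply: (le_trans om_le); rewrite invf_le1 ?ler1n.
rewrite ler_distl; apply/andP; split.
  exact: (weyl_lower e_basis T_pert T_sym T_eig (@lam_nonincreasing _ _ _ _ _ _ _ M)
    y_gt0 y_lt GjE GE G_gt0 G_le lam2_le om_ge0 om1 A_om).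
exact: (weyl_upper e_basis T_pert T_sym T_eig (@lam_nonincreasing _ _ _ _ _ _ _ M)
    (lam_ge0 M) y_gt0 GjE GE G_gt0 om_ge0 om1 A_om).
Qed.

Let ev_eq k : \sum_(l < N) A k l * x l @[N --> \oo] --> (lamhat M j w - lam M k) * x k.
Proof.
have := matrix_operator_coef
  (A := fun i l => lam M i * (i == l :> nat)%:R + A i l) e_basis T_pert
  (eigfunhat M j w) k.
case: T_eig => _ _ /(_ j) ej _.
rewrite [inner (e k) _]innerC (inner_ae_eq _ ej) innerZl innerC -/(x k) => h.
have : \sum_(i < N) (lam M i * (i == k :> nat)%:R + A i k) * x i - lam M k * x k
    @[N --> \oo] --> lamhat M j w * x k - lam M k * x k.
  by apply: cvgB; [exact: h|exact: cvg_cst].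
rewrite -mulrBl; apply: cvg_trans; apply: near_eq_cvg; exists k.+1 => // N /= kN.
rewrite (sum_ord_split (fun i => (lam M i * (i == k :> nat)%:R + A i k) * x i) kN).
rewrite (sum_ord_split (fun l => A k l * x l) kN) eqxx.
have -> : \sum_(i < N | i != k :> nat) (lam M i * (i == k :> nat)%:R + A i k) * x i =
    \sum_(i < N | i != k :> nat) A k i * x i.
  by apply: eq_bigr => i /negbTE ik; rewrite ik mulr0 add0r A_sym.
by rewrite /= mulr1; ring.
Qed.

Lemma remainder_fine : norm2 remainder ^+ 2 <= 16 * om ^+ 2 * ph ^+ 2.
Proof.
apply: (remainder_le first_order_le) => N.
exact: (expansion_remainder_le y_gt0 GjE GE G_ge G_le om_ge0 om_le
  A_om A_ph x_unit xj_ge0 ev_eq ev_close).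
Qed.

Lemma norm_fine :
  `|norm2 diff ^+ 2 - limn (fun N => \sum_(k < N | k != j :> nat) F k ^+ 2)| <=
  11 * (om * ph ^+ 2).
Proof.
rewrite diff_sqr.
exact: (norm_expansion_le y_gt0 GjE GE G_ge G_le om_ge0 ph_ge0 om_le
  A_om A_ph x_unit xj_ge0 ev_eq ev_close).
Qed.

End good.
End weights.
End pathwise.

(** * Spectral gaps and weights *)

Section spectral_gaps.
Context (R : realType).

Lemma partial_sum_le_nneseries (p : pred nat) (u : nat -> \bar R) (v : nat -> R) (b : R) :
  (forall k, p k -> (0 <= u k)%E) -> (forall k, p k -> u k = (v k)%:E) ->
  (\sum_(0 <= k <oo | p k) u k <= b%:E)%E ->
  forall N, \sum_(k < N | p k) v k <= fine (\sum_(0 <= k <oo | p k) u k)%E.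
Proof.
move=> u0 uv ub N; rewrite -lee_fin fineK.
  rewrite -sumEFin (eq_bigr (fun k : 'I_N => u k)); last by move=> k pk; rewrite uv.
  rewrite -(big_mkord p (fun k => u k)).
  by apply: nneseries_lim_ge => k _; exact: u0.
rewrite ge0_fin_numE; first exact: le_lt_trans (ltry b).
by apply: nneseries_ge0 => k _; exact: u0.
Qed.

Context d (X : measurableType d) (mu : {measure set X -> \bar R})
  d' (Om : measurableType d') (P : probability Om R) (M : model mu P).
Variable j : nat.
Hypothesis lamj_gt0 : 0 < lam M j.

(** A vanishing gap would contribute an infinite term to [gap_sum]. *)
Lemma gap_neq0 (b : R) : (gap_sum M j <= b%:E)%E ->
  forall k, k != j -> lam M j - lam M k != 0.
Proof.
move=> gb k kj; apply/eqP => jk; move: gb; apply/negP; rewrite -ltNge.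
have t0 i : (0 <= (lam M i)%:E / `|lam M j - lam M i|%:E)%E.
  by rewrite mule_ge0 ?lee_fin ?lam_ge0// inve_ge0 lee_fin.
apply: (@lt_le_trans _ _ +oo%E); first exact: ltry.
apply: le_trans (nneseries_lim_ge k.+1 _); last by move=> i _ _; exact: t0.
rewrite big_mkcond big_mkord big_ord_recr/= kj.
have -> : ((lam M k)%:E / `|lam M j - lam M k|%:E = +oo)%E.
  rewrite jk normr0 inve0 gt0_muley// lte_fin.
  by move: jk => /eqP; rewrite subr_eq0 => /eqP <-.
rewrite addey// -ltNye (lt_le_trans ltNy0)// sume_ge0// => i _.
by case: ifP.
Qed.

Lemma gap_partial_sums (b : R) : (gap_sum M j <= b%:E)%E ->
  forall N, \sum_(k < N | k != j :> nat) lam M k / `|lam M j - lam M k| <= b.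
Proof.
move=> gb N; have g0 := gap_neq0 gb.
have t0 i : (0 <= (lam M i)%:E / `|lam M j - lam M i|%:E)%E.
  by rewrite mule_ge0 ?lee_fin ?lam_ge0// inve_ge0 lee_fin.
apply: (le_trans (partial_sum_le_nneseries (p := fun k => k != j)
  (v := fun k => lam M k / `|lam M j - lam M k|) _ _ gb N)) => //.
  by move=> k kj; rewrite inver normr_eq0 (negbTE (g0 k kj)) EFinM.
rewrite -lee_fin fineK// ge0_fin_numE; first exact: le_lt_trans (ltry b).
exact: nneseries_ge0.
Qed.

Lemma Lambda_partial_sums (b : R) : (Lambda M j <= b%:E)%E ->
  (forall k, k != j -> lam M j - lam M k != 0) ->
  forall N, \sum_(k < N | k != j :> nat)
    lam M j * lam M k / (lam M j - lam M k) ^+ 2 <= fine (Lambda M j).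
Proof.
move=> gb g0 N.
apply: (partial_sum_le_nneseries (p := fun k => k != j)
  (v := fun k => lam M j * lam M k / (lam M j - lam M k) ^+ 2) _ _ gb N).
  move=> k _; rewrite mule_ge0 ?lee_fin ?mulr_ge0 ?lam_ge0//.
  by rewrite inve_ge0 lee_fin sqr_ge0.
by move=> k kj; rewrite inver sqrf_eq0 (negbTE (g0 k kj)) EFinM.
Qed.

End spectral_gaps.

Section gap_weights.
Context (R : realType).
Variables (lam nu : nat -> R) (j : nat) (Gam C L mu : R).
Hypothesis lam_ge0 : forall k, 0 <= lam k.
Hypothesis lam_le : forall k, lam k <= C.
Hypothesis nu_ge0 : forall k, 0 <= nu k.
Hypothesis nu_le : forall k, nu k <= C * lam k.
Hypothesis lamj_gt0 : 0 < lam j.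
Hypothesis Gam_ge1 : 1 <= Gam.
Hypothesis gap0 : forall k, k != j -> lam j - lam k != 0.
Hypothesis gap_le : forall N,
  \sum_(k < N | k != j :> nat) lam k / `|lam j - lam k| <= Gam.
Hypothesis L_gt0 : 0 < L.
Hypothesis L_ge : forall N,
  \sum_(k < N | k != j :> nat) lam j * lam k / (lam j - lam k) ^+ 2 <= L.

(** The fictitious gap y of the index j: small against every true gap, but such
    that lam_j / y is only 8 Gam. *)
Definition gap_shift := lam j / (8 * Gam).
Definition gap_weight k := if k == j then gap_shift else `|lam j - lam k|.

Let Gam_gt0 : 0 < Gam := lt_le_trans ltr01 Gam_ge1.
Let C_ge0 : 0 <= C := le_trans (lam_ge0 0) (lam_le 0).

Lemma gap_shift_gt0 : 0 < gap_shift.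
Proof. by rewrite divr_gt0// mulr_gt0. Qed.

Lemma gap_shift_lt : gap_shift < lam j.
Proof. by rewrite ltr_pdivrMr ?mulr_gt0// ltr_pMr//; have := Gam_ge1; lra. Qed.

Lemma gap_weight_j : gap_weight j = gap_shift. Proof. by rewrite /gap_weight eqxx. Qed.

Lemma gap_weightE k : k != j -> gap_weight k = `|lam j - lam k|.
Proof. by rewrite /gap_weight => /negbTE ->. Qed.

(** If lam_k is at least lam_j / 2, the gap is bounded below because the term
    lam_k / g_k is at most Gam; otherwise the gap is itself at least lam_j / 2. *)
Lemma gap_weight_ge k : k != j -> 4 * gap_shift <= gap_weight k.
Proof.
move=> kj; rewrite gap_weightE//.
have gp : 0 < `|lam j - lam k| by rewrite normr_gt0 gap0.
have -> : 4 * gap_shift = lam j / (2 * Gam).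
  by rewrite /gap_shift; field; rewrite gt_eqF.
rewrite ler_pdivrMr ?mulr_gt0//.
case: (lerP (lam j / 2) (lam k)) => h.
  have : lam k / `|lam j - lam k| <= Gam.
    apply: le_trans (gap_le k.+1); rewrite big_mkcond big_ord_recr/= kj lerDr.
    by apply: sumr_ge0 => i _; case: ifP => // _; rewrite divr_ge0.
  rewrite ler_pdivrMr// => h2; rewrite mulrCA.
  by move: h2; rewrite mulrC; lra.
have : lam j / 2 <= `|lam j - lam k| by rewrite (le_trans _ (ler_norm _))//; lra.
move=> h2; apply: (@le_trans _ _ (`|lam j - lam k| * 2)); first by lra.
by rewrite ler_wpM2l// ler_pMr.
Qed.

Lemma gap_weight_gt0 k : 0 < gap_weight k.
Proof.
have [->|kj] := eqVneq k j; first by rewrite gap_weight_j gap_shift_gt0.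
by rewrite (lt_le_trans _ (gap_weight_ge kj))// mulr_gt0// gap_shift_gt0.
Qed.

Lemma gap_weight_le k : gap_weight k <= C.
Proof.
rewrite /gap_weight; case: ifP => _; first by rewrite (le_trans (ltW gap_shift_lt)).
rewrite ler_norml; have := lam_ge0 k; have := lam_ge0 j.
by have := lam_le k; have := lam_le j => *; apply/andP; split; lra.
Qed.

Lemma gap_weight_sum_le N : \sum_(k < N) lam k / gap_weight k <= 9 * Gam.
Proof.
have t0 k : 0 <= lam k / gap_weight k by rewrite divr_ge0// ltW// gap_weight_gt0.
apply: (@le_trans _ _ (\sum_(k < maxn N j.+1) lam k / gap_weight k)).
  exact: (sum_ord_nondecreasing t0 (leq_maxl _ _)).
rewrite (sum_ord_split (fun k => lam k / gap_weight k) (leq_maxr N j.+1)).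
have -> : lam j / gap_weight j = 8 * Gam.
  by rewrite gap_weight_j /gap_shift; field; rewrite !gt_eqF.
rewrite [X in _ + X](eq_bigr (fun k : 'I_(maxn N j.+1) => lam k / `|lam j - lam k|)).
  by have := gap_le (maxn N j.+1); lra.
by move=> k kj; rewrite gap_weightE.
Qed.

Let nu_weight_sum N : \sum_(l < N) nu l / gap_weight l <= C * (9 * Gam).
Proof.
apply: le_trans (ler_wpM2l C_ge0 (gap_weight_sum_le N)).
rewrite mulr_sumr; apply: ler_sum => l _.
by rewrite mulrA ler_pM2r ?invr_gt0 ?gap_weight_gt0.
Qed.

Lemma weights_square_sum N : 0 <= mu ->
  \sum_(k < N) \sum_(l < N) mu * (nu k * nu l / (gap_weight k * gap_weight l)) <=
  mu * (81 * C ^+ 2 * Gam ^+ 2).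
Proof.
move=> mu0.
have -> : \sum_(k < N) \sum_(l < N) mu * (nu k * nu l / (gap_weight k * gap_weight l)) =
    mu * (\sum_(k < N) nu k / gap_weight k) ^+ 2.
  rewrite expr2 mulr_suml mulr_sumr; apply: eq_bigr => k _.
  rewrite !mulr_sumr; apply: eq_bigr => l _; field.
  by rewrite !gt_eqF ?gap_weight_gt0.
rewrite ler_wpM2l//.
have -> : 81 * C ^+ 2 * Gam ^+ 2 = (C * (9 * Gam)) ^+ 2 by ring.
rewrite lerXn2r ?nnegrE ?nu_weight_sum//.
  by apply: sumr_ge0 => k _; rewrite divr_ge0// ltW// gap_weight_gt0.
by rewrite !mulr_ge0// ltW.
Qed.

Lemma weights_gap_sum N :
  \sum_(k < N | k != j :> nat) \sum_(l < N)
    L^-1 * (nu k * nu l * gap_shift / (gap_weight k ^+ 2 * gap_weight l)) <= 9 / 8 * C ^+ 2.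
Proof.
have -> : \sum_(k < N | k != j :> nat) \sum_(l < N)
    L^-1 * (nu k * nu l * gap_shift / (gap_weight k ^+ 2 * gap_weight l)) =
  L^-1 * gap_shift * ((\sum_(k < N | k != j :> nat) nu k / gap_weight k ^+ 2) *
                  (\sum_(l < N) nu l / gap_weight l)).
  rewrite mulr_suml mulr_sumr; apply: eq_bigr => k _.
  rewrite !mulr_sumr; apply: eq_bigr => l _; field.
  by rewrite !gt_eqF ?gap_weight_gt0.
have h1 : \sum_(k < N | k != j :> nat) nu k / gap_weight k ^+ 2 <= C * (L / lam j).
  rewrite mulrA ler_pdivlMr//; apply: le_trans (ler_wpM2l C_ge0 (L_ge N)).
  rewrite mulr_sumr mulr_suml; apply: ler_sum => k kj.
  rewrite gap_weightE// real_normK ?num_real//.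
  rewrite mulrAC mulrA ler_wpM2r ?invr_ge0 ?sqr_ge0//.
  by rewrite mulrCA mulrC ler_pM2l.
have h3 : 0 <= \sum_(k < N | k != j :> nat) nu k / gap_weight k ^+ 2.
  by apply: sumr_ge0 => k _; rewrite divr_ge0 ?sqr_ge0.
have h4 : 0 <= \sum_(l < N) nu l / gap_weight l.
  by apply: sumr_ge0 => k _; rewrite divr_ge0// ltW// gap_weight_gt0.
apply: (@le_trans _ _ (L^-1 * gap_shift * ((C * (L / lam j)) * (C * (9 * Gam))))).
  apply: ler_wpM2l.
    by apply: mulr_ge0; rewrite ?invr_ge0 ltW// gap_shift_gt0.
  by apply: ler_pM => //; exact: nu_weight_sum.
rewrite le_eqVlt; apply/orP; left; apply/eqP; rewrite /gap_shift; field.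
by rewrite !gt_eqF.
Qed.

End gap_weights.

(** * From typical to arbitrary realizations *)

Section combination.
Context (R : realType).

(** In the bad case om > 1/8, the crude bound 2 + 2 ph is used: each of its
    terms picks up a factor 8 om >= 1, raised to the power sig for the term that
    does not contain ph. *)
Lemma vector_error_le (om ph r sig : R) : 0 <= om -> 0 <= ph -> 0 <= r -> 0 <= sig ->
  r ^+ 2 <= 2 + 2 * ph ^+ 2 ->
  (om <= 8^-1 -> r ^+ 2 <= 16 * om ^+ 2 * ph ^+ 2) ->
  r <= 16 * (om * ph) + 2 * (8 * om) `^ sig.
Proof.
move=> om0 ph0 r0 s0 h1 h2; have omph0 := mulr_ge0 om0 ph0.
have [le8|gt8] := lerP om 8^-1.
  apply: (@le_trans _ _ (4 * (om * ph))); last first.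
    by have := powR_ge0 (8 * om) sig; lra.
  rewrite -ler_sqr ?nnegrE// ?mulr_ge0// (le_trans (h2 le8))//.
  by rewrite le_eqVlt; apply/orP; left; apply/eqP; ring.
have om1 : 1 <= 8 * om by lra.
have p1 : 1 <= (8 * om) `^ sig by rewrite -[leLHS](powRr0 (8 * om)); exact: ler_powR.
have q1 : ph <= 8 * (om * ph) by rewrite mulrA ler_peMl.
apply: (@le_trans _ _ (2 + 2 * ph)); last by lra.
rewrite -ler_sqr ?nnegrE// ?addr_ge0 ?mulr_ge0// (le_trans h1)//.
rewrite -subr_ge0.
have -> : (2 + 2 * ph) ^+ 2 - (2 + 2 * ph ^+ 2) = 2 + 8 * ph + 2 * ph ^+ 2 by ring.
by rewrite !addr_ge0 ?mulr_ge0 ?sqr_ge0.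
Qed.

Lemma norm_error_le (om ph r sig : R) : 0 <= om -> 0 <= ph -> 0 <= sig ->
  r <= 2 + ph ^+ 2 ->
  (om <= 8^-1 -> r <= 11 * (om * ph ^+ 2)) ->
  r <= 16 * (om * ph ^+ 2) + 2 * (8 * om) `^ sig.
Proof.
move=> om0 ph0 s0 h1 h2; have omph0 := mulr_ge0 om0 (sqr_ge0 ph).
have [le8|gt8] := lerP om 8^-1.
  by have := h2 le8; have := powR_ge0 (8 * om) sig; lra.
have om1 : 1 <= 8 * om by lra.
have p1 : 1 <= (8 * om) `^ sig by rewrite -[leLHS](powRr0 (8 * om)); exact: ler_powR.
have q1 : ph ^+ 2 <= 8 * (om * ph ^+ 2) by rewrite mulrA ler_peMl ?sqr_ge0.
by lra.
Qed.

Lemma powR_le_1D (x p q : R) : 0 <= x -> 0 <= p -> p <= q -> x `^ p <= 1 + x `^ q.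
Proof.
move=> x0 p0 pq; have [x1|x1] := lerP x 1.
  apply: (@le_trans _ _ 1); last by rewrite lerDl powR_ge0.
  by have := ge0_ler_powR p0 x0 ler01 x1; rewrite powR1.
by rewrite (le_trans (ler_powR (ltW x1) pq))// lerDr.
Qed.

(** As t <= 2 and sig >= 4, all powers on the left are covered by the moments
    of order p sig.  This replaces an application of Hoelder's inequality. *)
Lemma product_moment_le (x z p sig : R) (t : nat) : 0 <= x -> 0 <= z -> 1 <= p ->
  4 <= sig -> (t <= 2)%N ->
  (x * z ^+ t + x `^ sig) `^ p <= 4 `^ p * (1 + x `^ (p * sig) + z `^ (p * sig)).
Proof.
move=> x0 z0 p1 s4 t2.
have p0 : 0 <= p by lra.
have zt0 : 0 <= z ^+ t by rewrite exprn_ge0.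
have add_le (u v : R) : 0 <= u -> 0 <= v -> (u + v) `^ p <= 2 `^ p * (u `^ p + v `^ p).
  move=> u0 v0; wlog uv : u v u0 v0 / u <= v.
    move=> H; have [uv|vu] := lerP u v; first exact: H.
    by rewrite addrC [u `^ p + _]addrC; apply: H => //; exact: ltW.
  apply: (@le_trans _ _ ((2 * v) `^ p)).
    by apply: ge0_ler_powR; rewrite ?nnegrE ?addr_ge0 ?mulr_ge0//; lra.
  by rewrite powRM// ler_wpM2l ?powR_ge0// lerDr powR_ge0.
have prod_le : (x * z ^+ t) `^ p <= 2 + x `^ (p * sig) + z `^ (p * sig).
  rewrite powRM// -(powR_mulrn t z0).
  have h (u v : R) : 0 <= u -> 0 <= v -> u * v <= u ^+ 2 + v ^+ 2.
    by move=> u0 v0; nra.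
  apply: le_trans (h _ _ (powR_ge0 _ _) (powR_ge0 _ _)) _.
  rewrite -!(powR_mulrn 2 (powR_ge0 _ _)) -!powRrM.
  have t2R : t%:R <= 2 :> R by rewrite (ler_nat _ t 2).
  have t0R : 0 <= t%:R :> R by rewrite ler0n.
  have e1 : x `^ (p * 2) <= 1 + x `^ (p * sig).
    apply: powR_le_1D => //; first by rewrite mulr_ge0.
    by rewrite ler_wpM2l//; lra.
  have e2 : z `^ (t%:R * (p * 2)) <= 1 + z `^ (p * sig).
    apply: powR_le_1D => //; first by rewrite !mulr_ge0.
    have -> : t%:R * (p * 2) = p * (t%:R * 2) by ring.
    by rewrite ler_wpM2l//; lra.
  by lra.
have -> : 4 `^ p = 2 `^ p * 2 `^ p :> R by rewrite -powRM//; congr (_ `^ _); ring.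
apply: le_trans (add_le _ _ _ _) _; rewrite ?mulr_ge0 ?powR_ge0//.
rewrite -mulrA ler_wpM2l ?powR_ge0// -powRrM [sig * p]mulrC.
apply: (@le_trans _ _ (2 * (1 + x `^ (p * sig) + z `^ (p * sig)))).
  by have := powR_ge0 z (p * sig); lra.
rewrite ler_wpM2r//.
  by rewrite !addr_ge0 ?powR_ge0.
by rewrite -[leLHS]powRr1//; apply: ler_powR => //; lra.
Qed.

Lemma bounded_negative_power (m : nat -> R) (t : R) : (forall n, 0 < m n) ->
  m n @[n --> \oo] --> +oo -> 0 <= t -> exists2 B, 0 < B & forall n, m n `^ (- t) <= B.
Proof.
move=> m0 my t0.
have /cvgryPge/(_ 1)[N _ NP] := my.
exists (1 + \sum_(i < N) m i `^ (- t)).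
  by rewrite ltr_pwDl// sumr_ge0// => i _; exact: powR_ge0.
move=> n; have [nN|Nn] := ltnP n N.
  rewrite (bigD1 (Ordinal nN))//= addrCA lerDl addr_ge0// sumr_ge0// => i _.
  exact: powR_ge0.
apply: (@le_trans _ _ 1); last by rewrite lerDl sumr_ge0// => i _; exact: powR_ge0.
rewrite -[leRHS](powRr0 (m n)); apply: ler_powR; last by rewrite oppr_le0.
exact: NP.
Qed.

End combination.

Section scaling.
Context d (Om : measurableType d) (R : realType).
Variable P : {measure set Om -> \bar R}.

Lemma Lnorm_scale (q c : R) (f : Om -> R) : 0 < q -> 0 <= c ->
  measurable_fun setT f ->
  ('N[P]_q%:E[EFin \o (fun w => (c * f w)%R)] = c%:E * 'N[P]_q%:E[EFin \o f])%E.
Proof.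
move=> q0 c0 mf; rewrite unlock.
have -> : (\int[P]_w (`|(EFin \o (fun w => (c * f w)%R)) w| `^ q) =
    \int[P]_w ((c `^ q)%:E * (`|f w| `^ q)%:E))%E.
  apply: eq_integral => w _ /=.
  by rewrite -EFinM normrM powRM// (ger0_norm c0).
rewrite ge0_integralZl_EFin ?powR_ge0//; last first.
  apply/measurable_EFinP; apply: (measurableT_comp (measurable_powR _)) => //.
  exact: measurableT_comp.
rewrite poweRM ?lee_fin ?powR_ge0//; last by apply: integral_ge0.
by rewrite poweR_EFin -powRrM mulfV ?gt_eqF// powRr1.
Qed.

Lemma Lnorm_scaled_difference_le (q c b1 b2 : R) (f g : Om -> R) : 1 <= q -> 0 <= c ->
  measurable_fun setT f -> measurable_fun setT g ->
  (c%:E * 'N[P]_q%:E[EFin \o f] <= b1%:E)%E ->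
  (c%:E * 'N[P]_q%:E[EFin \o g] <= b2%:E)%E ->
  ('N[P]_q%:E[EFin \o (fun w => (c * (f w - g w))%R)] <= (b1 + b2)%:E)%E.
Proof.
move=> q1 c0 mf mg fb gb; have q0 : 0 < q := lt_le_trans ltr01 q1.
rewrite Lnorm_scale//; last exact: measurable_funB.
apply: (@le_trans _ _ (c%:E * ('N[P]_q%:E[EFin \o f] + 'N[P]_q%:E[EFin \o g]))%E).
  rewrite lee_wpmul2l ?lee_fin//.
  rewrite -[X in (_ <= _ + X)%E]oppe_Lnorm.
  by apply: (@minkowski_EFin _ _ _ P f (fun w => (- g w)%R)) => //;
    exact: measurableT_comp.
rewrite ge0_muleDr ?Lnorm_ge0//.
by rewrite EFinD leeD.
Qed.

Lemma poweR_domination (p sig X Y b rate E : R) (t : nat) (Phi1 Phi2 : \bar R) :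
  0 <= X -> 0 <= Y -> 1 <= p -> 4 <= sig -> (t <= 2)%N ->
  0 <= b -> 0 <= rate -> 0 <= E ->
  Phi1 = (X `^ (p * sig))%:E -> Phi2 = (Y `^ (p * sig))%:E ->
  E <= b * rate * (X * Y ^+ t + X `^ sig) ->
  ((E `^ p)%:E <= ((4 * b * rate) `^ p)%:E * (1 + Phi1 + Phi2))%E.
Proof.
move=> X0 Y0 p1 s4 t2 b0 r0 E0 -> -> h.
have p0 : 0 <= p by lra.
have Z0 : 0 <= X * Y ^+ t + X `^ sig.
  by rewrite addr_ge0 ?powR_ge0 ?mulr_ge0 ?exprn_ge0.
rewrite -!EFinD -EFinM lee_fin.
apply: (@le_trans _ _ ((b * rate * (X * Y ^+ t + X `^ sig)) `^ p)).
  by apply: ge0_ler_powR; rewrite ?nnegrE ?mulr_ge0.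
rewrite powRM ?mulr_ge0//.
have -> : (4 * b * rate) `^ p = (b * rate) `^ p * 4 `^ p.
  by rewrite -powRM ?mulr_ge0//; congr (_ `^ _); ring.
by rewrite -mulrA ler_wpM2l ?powR_ge0// product_moment_le.
Qed.

End scaling.

(** * Moments of the errors for one index *)

Section error_moments.
Context d (X : measurableType d) (R : realType)
  (mu : {measure set X -> \bar R}) d' (Om : measurableType d')
  (P : probability Om R) (M : model mu P).
Variables (m a p sig C S D : R) (j : nat).
Hypothesis m_gt0 : 0 < m.
Hypothesis p_ge1 : 1 <= p.
Hypothesis sig_ge4 : 4 <= sig.
Hypothesis C_gt0 : 0 < C.
Hypothesis S_ge0 : 0 <= S.
Hypothesis D_ge0 : 0 <= D.
Hypothesis etaD_le : forall i k,
  ((m `^ 2^-1)%:E * 'N[P]_(p * sig)%:E[EFin \o centered P (etaD M i k)] <= C%:E)%E.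
Hypothesis etaR_le : forall i k,
  ((m `^ 2^-1)%:E * 'N[P]_(p * sig)%:E[EFin \o etaR M i k] <= S%:E)%E.
Hypothesis gap1_le : ((m `^ (- 2^-1 + a))%:E * gap_sum M 1 <= C%:E)%E.
Hypothesis gapj_le : ((m `^ (- 2^-1 + a))%:E * gap_sum M j <= C%:E)%E.
Hypothesis Lambda_le : ((m `^ (- 1 + 2 * a))%:E * Lambda M j <= C%:E)%E.
Hypothesis lam1_gt0 : 0 < lam M 1.
Hypothesis lamj_gt0 : 0 < lam M j.
Hypothesis mean_ge : forall k, ((C^-1)%:E <= 'E_P[etaD M k k] <= C%:E)%E.
Hypothesis lam_sum : (\sum_(0 <= k <oo) (lam M k)%:E <= C%:E)%E.

Let L := fine (Lambda M j).
Hypothesis L_gt0 : 0 < L.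
Hypothesis rare_le1 :
  (Num.sqrt L)^-1 * (m `^ (- a)) `^ sig <= D * (m `^ (- a) / Num.sqrt m).
Hypothesis rare_le2 : L^-1 * (m `^ (- a)) `^ sig <= D * (m `^ (- a) / m).

Let Gam := C * m `^ (2^-1 - a).

Let lam_partial N : \sum_(k < N) lam M k <= C.
Proof.
rewrite -lee_fin -sumEFin -(big_mkord predT (fun k => (lam M k)%:E)).
apply: le_trans lam_sum; apply: nneseries_lim_ge => k _ _.
by rewrite lee_fin lam_ge0.
Qed.

Let lam_le k : lam M k <= C.
Proof.
apply: le_trans (lam_partial k.+1); rewrite big_ord_recr/= lerDr.
by apply: sumr_ge0 => i _; exact: lam_ge0.
Qed.

Let lam2_le : exists B : R, forall N, \sum_(k < N) lam M k ^+ 2 <= B.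
Proof.
exists (C * C) => N; apply: le_trans (ler_wpM2l (ltW C_gt0) (lam_partial N)).
rewrite mulr_sumr; apply: ler_sum => k _.
by rewrite expr2 ler_wpM2r ?lam_ge0.
Qed.

Let lamt_le k : lamt M k <= C * lam M k.
Proof.
have := mean_entry M k k; rewrite eqxx mulr1 -expr2 sqrtr_sqr ger0_norm ?lamt_ge0//.
move=> <-; have /andP[h1 h2] := mean_ge k.
have hf : C^-1 <= fine 'E_P[etaD M k k].
  rewrite -lee_fin fineK// fin_numElt (lt_le_trans _ h1) ?ltNyr//.
  by rewrite (le_lt_trans h2) ?ltry.
rewrite mulrCA -[leLHS]mulr1 ler_wpM2l ?lamt_ge0//.
by rewrite -(mulfV (lt0r_neq0 C_gt0)) ler_pM2l.
Qed.

Let gap_le_Gam (i : nat) :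
  ((m `^ (- 2^-1 + a))%:E * gap_sum M i <= C%:E)%E -> (gap_sum M i <= Gam%:E)%E.
Proof.
rewrite -lee_pdivlMl ?powR_gt0// => h; apply: (le_trans h).
by rewrite -EFinM lee_fin mulrC -powRN opprD opprK.
Qed.

Let Gam_ge1 : 1 <= Gam.
Proof.
have g1 := gap_le_Gam gap1_le.
(* the term of index 0 in the gap sum of index 1 is at least 1 *)
have n0 := gap_neq0 lam1_gt0 g1 (isT : 0%N != 1%N).
have := gap_partial_sums lam1_gt0 g1 1.
rewrite big_mkcond big_ord1/= => h; apply: le_trans h.
have ni : lam M 1 <= lam M 0 by exact: lam_nonincreasing.
rewrite ler_pdivlMr ?normr_gt0// mul1r ler0_norm ?subr_le0//.
by rewrite opprB gerBl lam_ge0.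
Qed.

Let gap0 k : k != j -> lam M j - lam M k != 0.
Proof. exact: gap_neq0 (gap_le_Gam gapj_le) k. Qed.

Let gap_le N : \sum_(k < N | k != j :> nat) lam M k / `|lam M j - lam M k| <= Gam.
Proof. exact: gap_partial_sums (gap_le_Gam gapj_le) N. Qed.

Let L_ge N : \sum_(k < N | k != j :> nat)
  lam M j * lam M k / (lam M j - lam M k) ^+ 2 <= L.
Proof.
apply: Lambda_partial_sums gap0 N => //.
have := Lambda_le; rewrite -lee_pdivlMl ?powR_gt0// -EFinM => h; exact: h.
Qed.

Let W := gap_weight (lam M) j Gam.
Let y := gap_shift (lam M) j Gam.

Let q_ge1 : 1 <= p * sig.
Proof. by rewrite mulr_ege1//; apply: le_trans sig_ge4; rewrite ler1n. Qed.

Let zeta k l (w : Om) := Num.sqrt m * noise M k l w.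

Let m_noise k l : measurable_fun setT (noise M k l).
Proof. by apply: measurable_funB => //; apply: measurable_funB. Qed.

Let m_zeta k l : measurable_fun setT (zeta k l).
Proof. by apply: measurable_funM => //; exact: m_noise. Qed.

Let zeta_le k l : ('N[P]_(p * sig)%:E[EFin \o zeta k l] <= (C + S)%:E)%E.
Proof.
have := etaD_le k l; have := etaR_le k l; rewrite !powR12_sqrt ?(ltW m_gt0)// => h1 h2.
apply: Lnorm_scaled_difference_le => //.
by apply: measurable_funB.
Qed.

(** The weights of m^(2a) om^2 and of (m / L) ph^2 as sums of squares of the
    normalized noise. *)
Let alpha1 k l := m `^ (2 * a - 1) * (lamt M k * lamt M l / (W k * W l)).
Let alpha2 k l := if k == j then 0 else
  L^-1 * (lamt M k * lamt M l * y / (W k ^+ 2 * W l)).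

Let W_gt0 k : 0 < W k.
Proof. exact: (gap_weight_gt0 (lam_ge0 M) lamj_gt0 Gam_ge1 gap0 gap_le). Qed.

Let y_gt0 : 0 < y.
Proof. exact: gap_shift_gt0. Qed.

Let alpha1_ge0 k l : 0 <= alpha1 k l.
Proof.
by rewrite mulr_ge0 ?powR_ge0// divr_ge0 ?mulr_ge0 ?lamt_ge0// ltW// W_gt0.
Qed.

Let alpha2_ge0 k l : 0 <= alpha2 k l.
Proof.
rewrite /alpha2; case: ifP => // _; apply: mulr_ge0; first by rewrite invr_ge0 ltW.
apply: divr_ge0; apply: mulr_ge0; rewrite ?sqr_ge0//.
- by apply: mulr_ge0; exact: lamt_ge0.
- exact: ltW.
- by apply: ltW; exact: W_gt0.
Qed.

Let alpha1_sum N : \sum_(k < N) \sum_(l < N) alpha1 k l <= 81 * C ^+ 4.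
Proof.
apply: le_trans (weights_square_sum (lam_ge0 M) lam_le (lamt_ge0 M) lamt_le lamj_gt0 Gam_ge1
  gap0 gap_le N (powR_ge0 _ _)) _.
rewrite le_eqVlt; apply/orP; left; apply/eqP; rewrite /Gam exprMn.
rewrite -(powR_mulrn 2 (powR_ge0 _ _)) -powRrM.
have -> : m `^ (2 * a - 1) * (81 * C ^+ 2 * (C ^+ 2 * m `^ ((2^-1 - a) * 2))) =
  81 * C ^+ 4 * (m `^ (2 * a - 1) * m `^ ((2^-1 - a) * 2)) by ring.
rewrite -powRD; last by rewrite (gt_eqF m_gt0) implybT.
have -> : 2 * a - 1 + (2^-1 - a) * 2 = 0 by field.
by rewrite powRr0 mulr1.
Qed.

Let alpha2_sum N : \sum_(k < N) \sum_(l < N) alpha2 k l <= 9 / 8 * C ^+ 2.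
Proof.
apply: le_trans (weights_gap_sum (lam_ge0 M) lam_le (lamt_ge0 M) lamt_le lamj_gt0 Gam_ge1
  gap0 gap_le L_gt0 L_ge N).
rewrite [leRHS]big_mkcond/=; apply: ler_sum => k _; rewrite /alpha2.
by case: (eqVneq (k : nat) j) => //= _; rewrite big1.
Qed.

Let r := p * sig / 2.

Let r_ge1 : 1 <= r.
Proof.
rewrite ler_pdivlMr// mul1r; apply: (@le_trans _ _ sig).
  by apply: le_trans sig_ge4; rewrite ler_nat.
by rewrite ler_peMl//; apply: le_trans sig_ge4.
Qed.

(** Bounds the mean of 1 + Phi1 + Phi2, with one term for each set of weights. *)
Definition moment_bound : R :=
  1 + (81 * C ^+ 4 * (C + S) ^+ 2) `^ r + (9 / 8 * C ^+ 2 * (C + S) ^+ 2) `^ r.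

(** The constants of [vector_error_le], the second one weighted by D, which
    bounds the rare-event contribution relative to the rate. *)
Definition error_factor : R := 16 + 2 * 8 `^ sig * D.

Let rare_event_term (c rate X0 : R) : 0 <= X0 -> 0 <= c ->
  c * (m `^ (- a)) `^ sig <= D * rate ->
  c * (2 * (8 * (m `^ (- a) * X0)) `^ sig) <= 2 * 8 `^ sig * D * rate * X0 `^ sig.
Proof.
move=> X00 c0 h.
rewrite !powRM ?mulr_ge0 ?powR_ge0//.
have -> : c * (2 * (8 `^ sig * ((m `^ (- a)) `^ sig * X0 `^ sig))) =
  2 * 8 `^ sig * (c * (m `^ (- a)) `^ sig) * X0 `^ sig by ring.
by rewrite -[2 * _ * D * _]mulrA ler_wpM2r ?powR_ge0// ler_wpM2l// mulr_ge0 ?powR_ge0.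
Qed.

Lemma error_moments : exists Psi : Om -> \bar R, [/\ measurable_fun setT Psi,
  forall w, (0 <= Psi w)%E, (\int[P]_w Psi w <= moment_bound%:E)%E,
  {ae P, forall w, ((eigenfunction_error M j w `^ p)%:E <=
    ((4 * error_factor * (m `^ (- a) / Num.sqrt m)) `^ p)%:E * Psi w)%E} &
  {ae P, forall w, ((norm_error M j w `^ p)%:E <=
    ((4 * error_factor * (m `^ (- a) / m)) `^ p)%:E * Psi w)%E}].
Proof.
have CS0 : 0 <= C + S by rewrite addr_ge0// ltW.
have zl k l : ('N[P]_(2 * r)%:E[EFin \o zeta k l] <= (C + S)%:E)%E.
  by rewrite (_ : 2 * r = p * sig) ?zeta_le// /r; field.
have a10 : 0 <= 81 * C ^+ 4 by rewrite mulr_ge0// exprn_ge0// ltW.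
have a20 : 0 <= 9 / 8 * C ^+ 2 by rewrite mulr_ge0// exprn_ge0// ltW.
have [Phi1 [mPhi1 Phi10 iPhi1 sPhi1]] := weighted_square_moment
  r_ge1 CS0 a10 alpha1_ge0 m_zeta zl alpha1_sum.
have [Phi2 [mPhi2 Phi20 iPhi2 sPhi2]] := weighted_square_moment
  r_ge1 CS0 a20 alpha2_ge0 m_zeta zl alpha2_sum.
pose Psi w := (1 + Phi1 w + Phi2 w)%E.
have m0 := ltW m_gt0.
have sm : 0 < Num.sqrt m by rewrite sqrtr_gt0.
have sL : 0 < Num.sqrt L by rewrite sqrtr_gt0.
have ef0 : 0 < error_factor.
  by rewrite ltr_pwDl// mulr_ge0// mulr_ge0// powR_ge0.
pose q := p * sig.
have q0 : 0 < q := lt_le_trans ltr01 q_ge1.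
have sig0 : 0 <= sig by apply: le_trans sig_ge4.
suff H w : typical M w ->
    ((eigenfunction_error M j w `^ p)%:E <=
      ((4 * error_factor * (m `^ (- a) / Num.sqrt m)) `^ p)%:E * Psi w)%E /\
    ((norm_error M j w `^ p)%:E <=
      ((4 * error_factor * (m `^ (- a) / m)) `^ p)%:E * Psi w)%E.
  have FP : Filter (nbhs (almost_everywhere P)) by exact: ae_filter_ringOfSetsType.
  have SP := @filterS _ (nbhs (almost_everywhere P)) FP.
  exists Psi; split.
  - by apply: emeasurable_funD => //; apply: emeasurable_funD.
  - by move=> w; rewrite /Psi !adde_ge0.
  - rewrite /Psi ge0_integralD//; last 2 first.
      by move=> w _; rewrite adde_ge0.
      exact: emeasurable_funD.
    rewrite ge0_integralD// integral_cst// mul1e.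
    rewrite (_ : _ [set: Om] = 1%E); last exact: probability_setT.
    by rewrite /moment_bound !EFinD; apply: leeD => //; apply: leeD.
  - by apply: (SP _ _ _ (ae_typical M)) => w /H[].
  - by apply: (SP _ _ _ (ae_typical M)) => w /H[].
move=> wt.
have rate1 : 0 < m `^ (- a) / Num.sqrt m by rewrite divr_gt0// powR_gt0.
have rate2 : 0 < m `^ (- a) / m by rewrite divr_gt0// powR_gt0.
have [fin|infin] := boolP ((Phi1 w \is a fin_num) && (Phi2 w \is a fin_num)); last first.
  (* an infinite dominating variable leaves nothing to prove *)
  have -> : Psi w = +oo%E.
    move: infin (Phi10 w) (Phi20 w); rewrite /Psi.
    by case: (Phi1 w) => [?||]; case: (Phi2 w) => [?||].
  have ef4 : 0 < 4 * error_factor by exact: mulr_gt0.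
  by split; rewrite gt0_muley ?leey// lte_fin powR_gt0//; exact: mulr_gt0.
have /andP[f1 f2] := fin.
pose X1 := (fine (Phi1 w)) `^ q^-1.
pose Y1 := (fine (Phi2 w)) `^ q^-1.
have X10 : 0 <= X1 by exact: powR_ge0.
have Y10 : 0 <= Y1 by exact: powR_ge0.
have Phi1E : Phi1 w = (X1 `^ (p * sig))%:E.
  by rewrite -powRrM mulVf ?gt_eqF// powRr1 ?fine_ge0// fineK.
have Phi2E : Phi2 w = (Y1 `^ (p * sig))%:E.
  by rewrite -powRrM mulVf ?gt_eqF// powRr1 ?fine_ge0// fineK.
have unpow (s z : R) : 0 <= s -> 0 <= z ->
    ((s `^ r)%:E <= (z `^ (p * sig))%:E)%E -> s <= z ^+ 2.
  move=> s0 z0; rewrite lee_fin.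
  have -> : p * sig = 2 * r by rewrite /r; field.
  rewrite powRrM powR_mulrn// => h.
  have r0 : 0 < r := lt_le_trans ltr01 r_ge1.
  have := ge0_ler_powR (ltW (_ : 0 < r^-1)).
  move=> /(_ _ (s `^ r) ((z ^+ 2) `^ r)).
  rewrite invr_gt0 -!powRrM mulfV ?gt_eqF// !powRr1 ?sqr_ge0//; apply => //.
    by rewrite nnegrE powR_ge0.
  by rewrite nnegrE powR_ge0.
pose om := m `^ (- a) * X1.
pose ph := Num.sqrt (L / m) * Y1.
have om0 : 0 <= om by rewrite mulr_ge0 ?powR_ge0.
have ph0 : 0 <= ph by rewrite mulr_ge0 ?sqrtr_ge0.
have pert2 k l : pert M k l w ^+ 2 = lamt M k * lamt M l * noise M k l w ^+ 2.
  by rewrite pertE// exprMn sqr_sqrtr// mulr_ge0 ?lamt_ge0.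
have zeta2 k l : zeta k l w ^+ 2 = m * noise M k l w ^+ 2.
  by rewrite exprMn sqr_sqrtr.
have A_om N : \sum_(k < N) \sum_(l < N) pert M k l w ^+ 2 / (W k * W l) <= om ^+ 2.
  have h := sPhi1 w N; rewrite Phi1E in h.
  have S0 : 0 <= \sum_(k < N) \sum_(l < N) alpha1 k l * zeta k l w ^+ 2.
    by apply: sumr_ge0 => k _; apply: sumr_ge0 => l _; rewrite mulr_ge0 ?sqr_ge0.
  have := unpow _ _ S0 X10 h; rewrite /om exprMn => {}h.
  apply: le_trans (ler_wpM2l (sqr_ge0 _) h).
  rewrite mulr_sumr le_eqVlt; apply/orP; left; apply/eqP; apply: eq_bigr => k _.
  rewrite mulr_sumr; apply: eq_bigr => l _; rewrite pert2 zeta2 /alpha1.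
  rewrite -(powR_mulrn 2 (powR_ge0 _ _)) -powRrM.
  have -> : m `^ (- a * 2) * (m `^ (2 * a - 1) * (lamt M k * lamt M l / (W k * W l)) *
      (m * noise M k l w ^+ 2)) = m `^ (- a * 2) * m `^ (2 * a - 1) * m *
      (lamt M k * lamt M l * noise M k l w ^+ 2 / (W k * W l)) by ring.
  have -> : m `^ (- a * 2) * m `^ (2 * a - 1) * m = 1.
    rewrite -[X in _ * X = _](powRr1 m0) -!powRD ?(gt_eqF m_gt0) ?implybT//.
    have -> : - a * 2 + (2 * a - 1) + 1 = 0 by ring.
    exact: powRr0.
  by rewrite mul1r.
have A_ph N : \sum_(k < N | k != j :> nat) \sum_(l < N)
    pert M k l w ^+ 2 * y / (W k ^+ 2 * W l) <= ph ^+ 2.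
  have h := sPhi2 w N; rewrite Phi2E in h.
  have S0 : 0 <= \sum_(k < N) \sum_(l < N) alpha2 k l * zeta k l w ^+ 2.
    by apply: sumr_ge0 => k _; apply: sumr_ge0 => l _; rewrite mulr_ge0 ?sqr_ge0.
  have := unpow _ _ S0 Y10 h; rewrite /ph exprMn sqr_sqrtr ?divr_ge0 ?(ltW L_gt0)//.
  move=> {}h; have Lm0 : 0 <= L / m by rewrite divr_ge0// ltW.
  apply: le_trans (ler_wpM2l Lm0 h).
  rewrite mulr_sumr big_mkcond/=; apply: ler_sum => k _.
  case: (eqVneq (k : nat) j) => kj /=.
    rewrite mulr_ge0// sumr_ge0// => l _; rewrite mulr_ge0 ?sqr_ge0//.
  rewrite mulr_sumr le_eqVlt; apply/orP; left; apply/eqP; apply: eq_bigr => l _.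
  rewrite pert2 zeta2 /alpha2 (negbTE kj); field.
  by rewrite !gt_eqF ?W_gt0.
have GE k := @gap_weightE R (lam M) j Gam k.
have G_ge := gap_weight_ge (lam_ge0 M) Gam_ge1 gap0 gap_le.
have G_le := gap_weight_le (lam_ge0 M) lam_le lamj_gt0 Gam_ge1.
have y_lt := gap_shift_lt lamj_gt0 Gam_ge1.
have GjE := gap_weight_j (lam M) j Gam.
have F_le := first_order_le y_gt0 GjE GE G_ge A_ph.
have sLm : Num.sqrt (L / m) = Num.sqrt L / Num.sqrt m.
  by rewrite sqrtrM ?(ltW L_gt0)// sqrtrV.
split.
- apply: (poweR_domination (t := 1) X10 Y10 p_ge1 sig_ge4 _ (ltW ef0) (ltW rate1) _
    Phi1E Phi2E) => //; first exact: norm2_ge0.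
  rewrite /eigenfunction_error norm2Z ger0_norm ?invr_ge0 ?sqrtr_ge0//.
  set rem := norm2 _.
  have remle : rem <= 16 * (om * ph) + 2 * (8 * om) `^ sig.
    apply: vector_error_le => //; first exact: norm2_ge0.
      exact: (remainder_crude wt F_le).
    move=> om8.
    exact: (remainder_fine wt y_gt0 y_lt GjE GE G_ge G_le lam2_le om0 A_om A_ph om8).
  have sLV : 0 <= (Num.sqrt L)^-1 by rewrite invr_ge0 ltW.
  apply: le_trans (ler_wpM2l sLV remle) _.
  have h := rare_event_term X10 sLV rare_le1.
  have e1 : (Num.sqrt L)^-1 * (16 * (om * ph)) =
      16 * (m `^ (- a) / Num.sqrt m) * (X1 * Y1).
    by rewrite /om /ph sLm; field; rewrite !gt_eqF.
  rewrite mulrDr e1 expr1.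
  have z1 : 0 <= X1 * Y1 by rewrite mulr_ge0.
  have z2 : 0 <= X1 `^ sig by exact: powR_ge0.
  have z3 : 0 <= 2 * 8 `^ sig * D by rewrite !mulr_ge0 ?powR_ge0.
  rewrite /error_factor.
  move: h z1 z2 z3 (ltW rate1); rewrite -/om.
  move: (_ * (2 * _)) (2 * 8 `^ sig * D) (m `^ (- a) / Num.sqrt m) (X1 * Y1)
    (X1 `^ sig) => t b g u v h u0 v0 b0 g0.
  apply: le_trans (_ : 16 * g * u + b * g * v <= _); first by rewrite lerD2l.
  have n1 : 0 <= b * g * u by rewrite !mulr_ge0.
  have n2 : 0 <= 16 * g * v by rewrite !mulr_ge0.
  have -> : (16 + b) * g * (u + v) = 16 * g * u + b * g * v + b * g * u + 16 * g * v.
    by ring.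
  by lra.
- apply: (poweR_domination (t := 2) X10 Y10 p_ge1 sig_ge4 _ (ltW ef0) (ltW rate2) _
    Phi1E Phi2E) => //; first exact: normr_ge0.
  have LV : 0 <= L^-1 by rewrite invr_ge0 ltW.
  rewrite /norm_error normrM ger0_norm// (first_order_series F_le).
  set dif := `|_ - _|.
  have difle : dif <= 16 * (om * ph ^+ 2) + 2 * (8 * om) `^ sig.
    apply: norm_error_le => //; first exact: (norm_crude wt F_le).
    move=> om8.
    exact: (norm_fine wt y_gt0 y_lt GjE GE G_ge G_le lam2_le om0 ph0 A_om A_ph om8).
  apply: le_trans (ler_wpM2l LV difle) _.
  have h := rare_event_term X10 LV rare_le2.
  have e1 : L^-1 * (16 * (om * ph ^+ 2)) =
      16 * (m `^ (- a) / m) * (X1 * Y1 ^+ 2).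
    rewrite /om /ph exprMn sqr_sqrtr; last by rewrite divr_ge0// ltW.
    by field; rewrite !gt_eqF.
  rewrite mulrDr e1.
  have z1 : 0 <= X1 * Y1 ^+ 2 by rewrite mulr_ge0// sqr_ge0.
  have z2 : 0 <= X1 `^ sig by exact: powR_ge0.
  have z3 : 0 <= 2 * 8 `^ sig * D by rewrite !mulr_ge0 ?powR_ge0.
  rewrite /error_factor.
  move: h z1 z2 z3 (ltW rate2); rewrite -/om.
  move: (_ * (2 * _)) (2 * 8 `^ sig * D) (m `^ (- a) / m) (X1 * Y1 ^+ 2)
    (X1 `^ sig) => t b g u v h u0 v0 b0 g0.
  apply: le_trans (_ : 16 * g * u + b * g * v <= _); first by rewrite lerD2l.
  have n1 : 0 <= b * g * u by rewrite !mulr_ge0.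
  have n2 : 0 <= 16 * g * v by rewrite !mulr_ge0.
  have -> : (16 + b) * g * (u + v) = 16 * g * u + b * g * v + b * g * u + 16 * g * v.
    by ring.
  by lra.
Qed.

End error_moments.

(** * Uniform constants *)

Section constants.
Context (R : realType).

Lemma cvg_upper_bound (s : nat -> R) : s n @[n --> \oo] --> (0 : R) ->
  exists2 S, 0 <= S & forall n, s n <= S.
Proof.
move=> s0; have [N _ NP] := (@cvgr0_norm_lt _ _ _ _ _ _ s0) 1 ltr01.
exists (1 + \sum_(i < N) `|s i|); first by rewrite addr_ge0// sumr_ge0.
move=> n; apply: le_trans (ler_norm _) _; have [nN|Nn] := ltnP n N.
  rewrite (bigD1 (Ordinal nN))//= addrCA lerDl addr_ge0//.
  exact: sumr_ge0.
by rewrite (le_trans (ltW (NP n Nn)))// lerDl sumr_ge0.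
Qed.

(** Here 2^t >= t + 1 for the integer t = ceil (h / a) is all that is needed of
    the exponential size of the number of moments. *)
Lemma moment_order_ge (a h : R) : 0 < a -> 1 <= h ->
  4 <= 2 ^ (Num.ceil (h / a) + 4) :> R /\
  h + a + 1 <= a * 2 ^ (Num.ceil (h / a) + 4).
Proof.
move=> a0 h1; have h0 : 0 < h := lt_le_trans ltr01 h1.
set c := Num.ceil (h / a).
have hc : h / a <= c%:~R by exact: ceil_ge.
have c0 : 0 <= c by rewrite -(ler_int R) (le_trans _ hc)// divr_ge0// ltW.
have [t ct] : exists t : nat, c = t%:Z by exists `|c|%N; rewrite gez0_abs.
have -> : 2 ^ (c + 4) = 16 * 2 ^+ t :> R.
  rewrite ct (_ : t%:Z + 4 = (t + 4)%N%:Z)// -exprnP exprD mulrC.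
  by congr (_ * _); ring.
have t2 : t%:R + 1 <= 2 ^+ t :> R.
  rewrite -(natrD _ t 1) -natrX ler_nat addn1; exact: ltn_expl.
have ht : h <= a * t%:R.
  by move: hc; rewrite ct ler_pdivrMr// mulrC.
split; first by have := ler0n R t; lra.
have : a * (t%:R + 1) <= a * 2 ^+ t by rewrite ler_pM2l.
by rewrite mulrDr mulr1 [a * (16 * _)]mulrCA; lra.
Qed.

Lemma rare_event_rates (m a h C L sig B : R) : 0 < m -> 0 < C -> 0 < L -> 0 <= B ->
  m `^ (- h) / C ^+ 2 <= L ->
  m `^ (- (a * sig - h / 2 - a - 2^-1)) <= B ->
  m `^ (- (a * sig - h - a - 1)) <= B ->
  (Num.sqrt L)^-1 * (m `^ (- a)) `^ sig <= (C + C ^+ 2) * B * (m `^ (- a) / Num.sqrt m) /\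
  L^-1 * (m `^ (- a)) `^ sig <= (C + C ^+ 2) * B * (m `^ (- a) / m).
Proof.
move=> m0 C0 L0 B0 LC B1 B2.
have mn := gt_eqF m0.
have Dpow x y : m `^ (x + y) = m `^ x * m `^ y by rewrite powRD// mn implybT.
have pow0 x : 0 <= m `^ x by exact: powR_ge0.
have LV : L^-1 <= C ^+ 2 * m `^ h.
  rewrite -[leRHS]invrK lef_pV2 ?posrE//.
    by rewrite invfM -powRN mulrC.
  by rewrite invr_gt0 mulr_gt0 ?exprn_gt0// powR_gt0.
have sLV : (Num.sqrt L)^-1 <= C * m `^ (h / 2).
  rewrite -ler_sqr ?nnegrE ?invr_ge0 ?sqrtr_ge0// ?mulr_ge0 ?(ltW C0)//.
  rewrite exprVn sqr_sqrtr ?(ltW L0)// exprMn -(powR_mulrn 2 (pow0 _)) -powRrM.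
  by rewrite mulfVK ?pnatr_eq0.
have C2 : 0 <= C ^+ 2 by rewrite sqr_ge0.
split.
- apply: (@le_trans _ _ (C * m `^ (h / 2) * (m `^ (- a)) `^ sig)).
    by rewrite ler_wpM2r ?powR_ge0.
  rewrite -powRrM.
  have -> : C * m `^ (h / 2) * m `^ (- a * sig) =
      C * m `^ (- (a * sig - h / 2 - a - 2^-1)) * (m `^ (- a) / Num.sqrt m).
    rewrite -(powR12_sqrt (ltW m0)) -powRN -!mulrA -!Dpow.
    by congr (_ * _ `^ _); field.
  rewrite ler_wpM2r ?divr_ge0 ?sqrtr_ge0//.
  apply: (@le_trans _ _ (C * B)); first by rewrite ler_pM2l.
  by rewrite ler_wpM2r// lerDl.
- apply: (@le_trans _ _ (C ^+ 2 * m `^ h * (m `^ (- a)) `^ sig)).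
    by rewrite ler_wpM2r ?powR_ge0.
  rewrite -powRrM.
  have -> : C ^+ 2 * m `^ h * m `^ (- a * sig) =
      C ^+ 2 * m `^ (- (a * sig - h - a - 1)) * (m `^ (- a) / m).
    rewrite -[X in _ = _ * (_ / X)](powRr1 (ltW m0)) -powRN -!mulrA -!Dpow.
    by congr (_ * (_ * _ `^ _)); ring.
  rewrite ler_wpM2r ?divr_ge0 ?(ltW m0)//.
  apply: (@le_trans _ _ (C ^+ 2 * B)); first by rewrite ler_wpM2l.
  by rewrite ler_wpM2r// lerDr ltW.
Qed.

End constants.

Section Lambda_lower_bound.
Context d (X : measurableType d) (R : realType)
  (mu : {measure set X -> \bar R}) d' (Om : measurableType d')
  (P : probability Om R) (M : model mu P).

(** The term of index j + 1 alone is at least lam_(j+1) / lam_j. *)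
Lemma Lambda_ge (j : nat) (b1 b2 C l : R) : 0 < lam M j -> lam M j <= C -> 0 < C ->
  (gap_sum M j <= b1%:E)%E -> (Lambda M j <= b2%:E)%E -> l <= lam M j.+1 ->
  l / C <= fine (Lambda M j).
Proof.
move=> lj0 ljC C0 gb Lb ll.
have g0 := gap_neq0 lj0 gb.
apply: le_trans (Lambda_partial_sums Lb g0 j.+2).
have jj : j.+1 != j by rewrite gtn_eqF.
rewrite big_mkcond big_ord_recr/= jj.
apply: (@le_trans _ _ (lam M j * lam M j.+1 / (lam M j - lam M j.+1) ^+ 2)); last first.
  rewrite lerDr sumr_ge0// => i _; case: ifP => // _.
  by rewrite divr_ge0 ?sqr_ge0// mulr_ge0 ?lam_ge0.
have ni : lam M j.+1 <= lam M j by exact: lam_nonincreasing.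
have d0 : 0 < lam M j - lam M j.+1 by rewrite lt_neqAle eq_sym g0//= subr_ge0.
apply: (@le_trans _ _ (lam M j.+1 / lam M j)).
  apply: (@le_trans _ _ (lam M j.+1 / C)); first by rewrite ler_pM2r ?invr_gt0.
  by rewrite ler_wpM2l ?lam_ge0// lef_pV2 ?posrE.
rewrite ler_pdivlMr ?exprn_gt0// mulrAC ler_pdivrMr//.
rewrite mulrC [leRHS]mulrAC ler_wpM2r ?lam_ge0// -expr2.
by rewrite lerXn2r ?nnegrE ?(ltW d0) ?(ltW lj0)// gerBl lam_ge0.
Qed.

End Lambda_lower_bound.

Unset Implicit Arguments.

Theorem theorem2p6 (R : realType) (dim : nat) (T : set 'rV[R]_dim)
    (cT : compact T)
    (disp : nat -> measure_display)
    (Om : forall n, measurableType (disp n))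
    (P : forall n, probability (Om n) R)
    (m : nat -> R) (Jp : nat -> nat)
    (M : forall n, model (lebesgue_on cT) (P n))
    (a h p C : R) (s : nat -> R) :
  let q := p * 2 ^ (Num.ceil (h / a) + 4) in
  (forall n, 0 < m n) -> m n @[n --> \oo] --> +oo ->
  0 < a -> 1 <= h -> 1 <= p ->
  (forall n, (0 < Jp n)%N) ->
  0 < C -> s n @[n --> \oo] --> 0 ->
  (forall n i j,
    ((m n `^ 2^-1)%:E
      * 'N[P n]_q%:E[EFin \o centered (P n) (etaD (M n) i j)] <= C%:E)%E) ->
  (forall n i j,
    ((m n `^ 2^-1)%:E * 'N[P n]_q%:E[EFin \o etaR (M n) i j] <= (s n)%:E)%E) ->
  (forall n j, (j < Jp n)%N ->
    ((m n `^ (- 2^-1 + a))%:E * gap_sum (M n) j <= C%:E)%E) ->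
  (forall n j, (j < Jp n)%N ->
    ((m n `^ (- 1 + 2 * a))%:E * Lambda (M n) j <= C%:E)%E) ->
  (forall n, m n `^ (- h) / C <= lam (M n) (Jp n).-1) ->
  (forall n j, ((C^-1)%:E <= 'E_(P n)[etaD (M n) j j] <= C%:E)%E) ->
  (forall n, (\sum_(0 <= j <oo) (lam (M n) j)%:E <= C%:E)%E) ->
  exists c : R, forall n J, (1 <= J < Jp n)%N ->
    ('N[P n]_p%:E[EFin \o
        (fun w => (\big[Num.max/0]_(j < J) eigenfunction_error (M n) j w)%R)]
      <= (c * (J%:R `^ p^-1 * m n `^ (- a) / Num.sqrt (m n)))%:E)%E /\
    ('N[P n]_p%:E[EFin \o
        (fun w => (\big[Num.max/0]_(j < J) norm_error (M n) j w)%R)]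
      <= (c * (J%:R `^ p^-1 * m n `^ (- a) / m n))%:E)%E.

Proof.
move=> q m_gt0 m_oo a_gt0 h_ge1 p_ge1 Jp_gt0 C_gt0 s0 etaD_le etaR_le gap_le Lam_le
  lam_ge mean_ge lam_sum.
pose sig : R := 2 ^ (Num.ceil (h / a) + 4).
have [sig_ge4 sig_ge] := moment_order_ge a_gt0 h_ge1.
have [S S_ge0 sS] := cvg_upper_bound s0.
have [B1 B1_gt0 mB1] : exists2 B, 0 < B &
    forall n, m n `^ (- (a * sig - h / 2 - a - 2^-1)) <= B.
  by apply: bounded_negative_power => //; rewrite /sig; lra.
have [B2 B2_gt0 mB2] : exists2 B, 0 < B &
    forall n, m n `^ (- (a * sig - h - a - 1)) <= B.
  by apply: bounded_negative_power => //; rewrite /sig; lra.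
pose D := (C + C ^+ 2) * (B1 + B2).
have D_ge0 : 0 <= D.
  by apply: mulr_ge0; rewrite addr_ge0 ?sqr_ge0// ltW.
pose K := moment_bound p sig C S.
pose b := 4 * error_factor sig D.
have K_ge0 : 0 <= K by rewrite /K /moment_bound !addr_ge0 ?powR_ge0.
have b_ge0 : 0 <= b.
  rewrite /b /error_factor mulr_ge0// addr_ge0// mulr_ge0// mulr_ge0// powR_ge0.
exists (K `^ p^-1 * b) => n J /andP[J_gt0 JJp].
have m0 := m_gt0 n.
have lam_pos k : (k < Jp n)%N -> m n `^ (- h) / C <= lam (M n) k.
  move=> kJ; apply: (le_trans (lam_ge n)); apply: lam_nonincreasing.
  by rewrite -ltnS prednK.
have lb0 : 0 < m n `^ (- h) / C by rewrite divr_gt0// powR_gt0.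
have lam_gt0 k : (k < Jp n)%N -> 0 < lam (M n) k.
  by move=> kJ; apply: lt_le_trans lb0 (lam_pos k kJ).
have lam_leC k : lam (M n) k <= C.
  rewrite -lee_fin; apply: le_trans (lam_sum n).
  apply: le_trans (nneseries_lim_ge k.+1 _).
    rewrite big_mkord big_ord_recr/= leeDr// sume_ge0// => i _.
    by rewrite lee_fin lam_ge0.
  by move=> i _ _; rewrite lee_fin lam_ge0.
have one_lt : (1 < Jp n)%N by exact: leq_ltn_trans JJp.
have /choice[Psi HPsi] : forall j, exists Psi : Om n -> \bar R, (j < J)%N ->
  [/\ measurable_fun setT Psi,
  forall w, (0 <= Psi w)%E, (\int[P n]_w Psi w <= K%:E)%E,
  {ae P n, forall w, ((eigenfunction_error (M n) j w `^ p)%:E <=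
    ((b * (m n `^ (- a) / Num.sqrt (m n))) `^ p)%:E * Psi w)%E} &
  {ae P n, forall w, ((norm_error (M n) j w `^ p)%:E <=
    ((b * (m n `^ (- a) / m n)) `^ p)%:E * Psi w)%E}].
  move=> j; have [jJ|jJ] := ltnP j J; last by exists (fun=> 0%E).
  have jp : (j < Jp n)%N by exact: ltn_trans JJp.
  have j1p : (j.+1 < Jp n)%N by exact: leq_ltn_trans JJp.
  have gapj : (gap_sum (M n) j <= ((m n `^ (- 2^-1 + a))^-1 * C)%:E)%E.
    by rewrite EFinM lee_pdivlMl ?powR_gt0// gap_le.
  have Lamj : (Lambda (M n) j <= ((m n `^ (- 1 + 2 * a))^-1 * C)%:E)%E.
    by rewrite EFinM lee_pdivlMl ?powR_gt0// Lam_le.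
  have L_ge : m n `^ (- h) / C ^+ 2 <= fine (Lambda (M n) j).
    have -> : m n `^ (- h) / C ^+ 2 = m n `^ (- h) / C / C.
      by field; rewrite gt_eqF.
    exact: (Lambda_ge (lam_gt0 j jp) (lam_leC j) C_gt0 gapj Lamj (lam_pos _ j1p)).
  have L_gt0 : 0 < fine (Lambda (M n) j).
    by apply: lt_le_trans L_ge; rewrite divr_gt0 ?exprn_gt0// powR_gt0.
  have [r1 r2] := @rare_event_rates _ _ _ _ _ _ sig (B1 + B2) m0 C_gt0 L_gt0
    (ltW (addr_gt0 B1_gt0 B2_gt0)) L_ge
    (le_trans (mB1 n) (ler_wpDr (ltW B2_gt0) (lexx B1)))
    (le_trans (mB2 n) (ler_wpDl (ltW B1_gt0) (lexx B2))).
  have etaRS i k : ((m n `^ 2^-1)%:E * 'N[P n]_(p * sig)%:E[EFin \o etaR (M n) i k]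
      <= S%:E)%E.
    by apply: (le_trans (etaR_le n i k)); rewrite lee_fin.
  have [Psi [h1 h2 h3 h4 h5]] := error_moments m0 p_ge1 sig_ge4 C_gt0 S_ge0 D_ge0
    (etaD_le n) etaRS (gap_le n 1%N one_lt) (gap_le n j jp) (Lam_le n j jp)
    (lam_gt0 1%N one_lt) (lam_gt0 j jp) (mean_ge n) (lam_sum n) L_gt0 r1 r2.
  by exists Psi.
have PsiP j (jJ : (j < J)%N) := HPsi j jJ.
split.
- rewrite [X in (_ <= X%:E)%E](_ : _ =
    K `^ p^-1 * J%:R `^ p^-1 * (b * (m n `^ (- a) / Num.sqrt (m n)))); last by ring.
  apply: (@Lnorm_bigmax_le _ _ _ (P n) J p K _ (eigenfunction_error (M n)) Psi).
  - exact: lt_le_trans p_ge1.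
  - exact: K_ge0.
  - by rewrite mulr_ge0// divr_ge0 ?powR_ge0 ?sqrtr_ge0.
  - by move=> j w; exact: norm2_ge0.
  - by move=> j /PsiP[].
  - by move=> j /PsiP[].
  - by move=> j /PsiP[].
  - by move=> j /PsiP[].
- rewrite [X in (_ <= X%:E)%E](_ : _ =
    K `^ p^-1 * J%:R `^ p^-1 * (b * (m n `^ (- a) / m n))); last by ring.
  apply: (@Lnorm_bigmax_le _ _ _ (P n) J p K _ (norm_error (M n)) Psi).
  - exact: lt_le_trans p_ge1.
  - exact: K_ge0.
  - by rewrite mulr_ge0// divr_ge0 ?powR_ge0// ltW.
  - by move=> j w; exact: normr_ge0.
  - by move=> j /PsiP[].
  - by move=> j /PsiP[].
  - by move=> j /PsiP[].
  - by move=> j /PsiP[].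
Qed.
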